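(* For all $\alpha>1$ and $\tau>\max\{3,\alpha/(\alpha-1)\}$ there are constants $M=M(\alpha,\tau)$, $A=A(\alpha,\tau)$, $L=L(\alpha,\tau)$ in $[1,\infty)$ such that the following holds. Let $Z$ be a metric space and let $X$ be a hyperbolic filling of $Z$ with parameters $\alpha$ and $\tau$, with height function $h$, density $\rho(x)=\alpha^{-h(x)}$, and distinguished point $\omega\in\partial X$. Then $X$ is $\frac12$-roughly starlike from $\omega$ and $\rho$ is a GH-density with constant $M$. Thus: (i) every geodesic in $X$ is an $A$-uniform curve in $X_\rho$, $X_\rho$ is an $A$-uniform metric space, and $X_\rho$ is unbounded; (ii) the canonical map $\varphi:\partial_\omega X\to\partial X_\rho$ is a well-defined bijection, under which the restriction of $d_\rho$ to $\partial X_\rho$ defines a visual metric on $\partial_\omega X$ based at $\omega$ with parameter $\log\alpha$ and comparison constant $L$ (to $\theta_{\log\alpha,b}$). In particular there is a canonical $L$-biLipschitz identification $\varphi\circ\psi:\bar Z\to\partial X_\rho$ of $\bar Z$ with $\partial X_\rho$.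
   Context: Hyperbolic filling. Let $(Z,d)$ be a metric space, $\alpha,\tau>1$. A set $S\subset Z$ is $r$-separated if $d(x,y)\ge r$ for distinct $x,y\in S$. For each $n\in\mathbb{Z}$ choose a maximal $\alpha^{-n}$-separated set $S_n\subset Z$; $V_n=\{(z,n):z\in S_n\}$, $V=\bigcup_n V_n$ is the vertex set, $h(z,n)=n$ the height. For $v=(z,n)$ let $B(v)=B(z,\tau\alpha^{-n})$ (open ball in $Z$). Distinct vertices $v,w$ are joined by an edge iff $|h(v)-h(w)|\le1$ and $B(v)\cap B(w)\ne\emptyset$. The resulting graph $X$ (connected for the $\tau$ considered), with path metric in which edges have length $1$, is a hyperbolic filling of $Z$ with parameters $\alpha,\tau$. It is a Gromov hyperbolic geodesic space. $h$ is extended to $X$ linearly along edges. An edge is vertical if its endpoints have different heights; a vertical geodesic is a path of vertical edges along which $h$ is strictly monotone. $\bar Z$ is the completion of $Z$ (metric still $d$), $B'(\cdot,r)$ its open balls. A vertical geodesic is anchored at $z\in\bar Z$ if $z\in B'(z_m,\frac{\tau}{3}\alpha^{-m})$ for each vertex $(z_m,m)$ on it. Ascending (descending) geodesic rays $[0,\infty)\to X$ are vertical geodesic rays along which $h$ is increasing (decreasing). All anchored descending geodesic rays determine the same point $\omega\in\partial X$. Fix an anchored descending geodesic ray $\gamma$ starting at a vertex of height $0$ and set $b(x)=b_\gamma(x)=\lim_{t\to\infty}(|\gamma(t)x|-t)$. The map $\psi:\bar Z\to\partial_\omega X$ sends $z$ to the class in $\partial X$ of any ascending geodesic ray anchored at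 $z$. Boundary notation. $|xy|$ is the distance in $X$. Geodesics are isometric maps of intervals. $(x|y)_p=\frac12(|xp|+|yp|-|xy|)$. The Gromov boundary $\partial X$ is the set of sequences with $(x_n|x_m)_p\to\infty$, modulo $\{x_n\}\sim\{y_n\}$ iff $(x_n|y_n)_p\to\infty$; $\{x_n\}\in\xi$ means $\{x_n\}$ represents $\xi$. A geodesic ray $\gamma$ on $[0,\infty)$ belongs to $\xi$ ($\gamma\in\xi$) if $\{\gamma(n)\}\in\xi$; for $\gamma$ on $(-\infty,0]$, $\gamma\in\xi$ if $\{\gamma(-n)\}\in\xi$. $\partial_\omega X=\partial X\setminus\{\omega\}$. $X$ is $K$-roughly starlike from $\omega\in\partial X$ if (1) for each $x\in X$ there is a geodesic line $\gamma:\mathbb{R}\to X$ with $\mathrm{dist}(x,\gamma)\le K$ and $\gamma|_{(-\infty,0]}\in\omega$; (2) for each $\xi\in\partial_\omega X$ there is a geodesic line $\gamma$ with $\gamma|_{[0,\infty)}\in\xi$, $\gamma|_{(-\infty,0]}\in\omega$. Visual metric. $(x|y)_b=\frac12(b(x)+b(y)-|xy|)$; for $\xi,\zeta\in\partial_\omega X$, $(\xi|\zeta)_b=\inf\liminf_n(x_n|y_n)_b$ over $\{x_n\}\in\xi$, $\{y_n\}\in\zeta$; $\theta_{\varepsilon,b}=e^{-\varepsilon(\xi|\zeta)_b}$. A visual metric with parameter $\varepsilon$ and comparison constant $L$ is a metric $\theta$ on $\partial_\omega X$ with $L^{-1}\theta_{\varepsilon,b}\le\theta\le L\theta_{\varepsilon,b}$.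 Conformal deformation. $\ell_\rho(\gamma)=\int_\gamma\rho\,ds$, $d_\rho(x,y)=\inf\ell_\rho(\gamma)$ over all curves joining $x,y$; $X_\rho=(X,d_\rho)$; $\partial X_\rho=\bar X_\rho\setminus X_\rho$ with $\bar X_\rho$ the completion (extended metric still $d_\rho$). $\rho$ is a GH-density with constant $M$ if $\ell_\rho(\gamma)\le M d_\rho(x,y)$ for all $x,y\in X$ and each geodesic $\gamma$ of $X$ joining $x$ to $y$. The canonical map $\varphi$ sends $\xi\in\partial_\omega X$ to the limit in $\bar X_\rho$ of any sequence $\{x_n\}\in\xi$. Uniformity. Let $(\Omega,d)$ be incomplete, $\partial\Omega=\bar\Omega\setminus\Omega$, $d_\Omega(x)=\mathrm{dist}(x,\partial\Omega)$, $\gamma:I\to\Omega$ a curve on an interval with endpoints $t_-\in[-\infty,\infty)$, $t_+\in(-\infty,\infty]$, $I_{\le t}=\{s\in I:s\le t\}$, $I_{\ge t}=\{s\in I:s\ge t\}$, $\ell$ length. If $\ell(\gamma)<\infty$, with $\gamma_\pm=\lim_{t\to t_\pm}\gamma(t)\in\bar\Omega$, $\gamma$ is $A$-uniform if (a) $\ell(\gamma)\le A\,d(\gamma_-,\gamma_+)$ and (b) $\min\{\ell(\gamma|_{I_{\le t}}),\ell(\gamma|_{I_{\ge t}})\}\le A\,d_\Omega(\gamma(t))$ for all $t\in I$. If $\ell(\gamma)=\infty$, $\gamma$ is $A$-uniform if (b) holds and $d(\gamma(s),\gamma(t))\to\infty$ as $s\to t_-$, $t\to t_+$. $\Omega$ is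 $A$-uniform if any two points are joined by an $A$-uniform curve. A map $f$ is $L$-biLipschitz if it distorts distances by a factor between $L^{-1}$ and $L$. *)

(* Defs.v *)
From HB Require Import structures.
From mathcomp Require Import all_boot all_order all_algebra.
From mathcomp Require Import all_classical all_reals all_analysis.

Set Implicit Arguments.
Unset Strict Implicit.
Unset Printing Implicit Defensive.

Import Order.TTheory GRing.Theory Num.Theory.
Import numFieldNormedType.Exports.

Local Open Scope classical_set_scope.
Local Open Scope ring_scope.

(* A metric space is a type with a distance function [d : T -> T -> R]; this
   lets one carrier bear several metrics (X and X_rho below). *)
Definition is_metric_on {R : realType} {T : Type} (A : set T) (d : T -> T -> R) :
    Prop :=
  [/\ forall x y, A x -> A y -> 0 <= d x y,
      forall x y, A x -> A y -> (d x y = 0 <-> x = y),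
      forall x y, A x -> A y -> d x y = d y x &
      forall x y z, A x -> A y -> A z -> d x z <= d x y + d y z].

Definition biLipschitz_on {R : realType} {U V : Type} (dU : U -> U -> R)
    (dV : V -> V -> R) (A : set U) (L : R) (f : U -> V) : Prop :=
  forall x y, A x -> A y ->
    L^-1 * dU x y <= dV (f x) (f y) /\ dV (f x) (f y) <= L * dU x y.

Section Metric.
Context {R : realType} {T : Type} (d : T -> T -> R).
Implicit Types (I : set R) (gamma : R -> T) (u v : nat -> T).

Definition unbounded : Prop := forall K : R, exists x y, K < d x y.

(* The points of the completion are the equivalence classes of Cauchy
   sequences, as sets of sequences. *)
Definition cauchy_seq u : Prop :=
  d (u mn.1) (u mn.2) @[mn --> filter_prod \oo \oo] --> (0 : R).

Definition cauchy_class u : set (nat -> T) :=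
  [set v | cauchy_seq v /\ d (u n) (v n) @[n --> \oo] --> (0 : R)].

Definition completion : set (set (nat -> T)) :=
  [set xi | exists2 u, cauchy_seq u & xi = cauchy_class u].

Definition completion_dist (xi zeta : set (nat -> T)) : R :=
  xget 0 [set r : R | forall u v, xi u -> zeta v ->
    d (u n) (v n) @[n --> \oo] --> r].

Definition to_completion (x : T) : set (nat -> T) := cauchy_class (fun=> x).

Definition metric_boundary : set (set (nat -> T)) :=
  completion `\` range to_completion.

Definition converges_in_completion u (xi : set (nat -> T)) : Prop :=
  completion_dist (to_completion (u n)) xi @[n --> \oo] --> (0 : R).

Definition dist_to_boundary (x : T) : R :=
  inf [set completion_dist (to_completion x) xi | xi in metric_boundary].

(* Curves are functions on R of which only the restriction to the interval [I]
   matters. *)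
Definition curve I gamma : Prop :=
  [/\ is_interval I, I !=set0 &
      forall t, I t -> d (gamma t) (gamma s) @[s --> within I (nbhs t)] --> (0 : R)].

Definition geodesic I gamma : Prop :=
  [/\ is_interval I, I !=set0 &
      forall s t, I s -> I t -> d (gamma s) (gamma t) = `|s - t|].

Definition curve_length gamma I : \bar R :=
  ereal_sup [set (\sum_(i < (size s).-1)
                    d (gamma (nth 0 s i)) (gamma (nth 0 s i.+1)))%:E
            | s in [set s : seq R | sorted <=%R s /\ [set` s] `<=` I]].

(* [t] tends to the left/right endpoint of [I] inside [I].  If that endpoint
   belongs to [I] this is evaluation there, which for a curve agrees with the
   limit by continuity. *)
Definition left_end I : set_system R :=
  filter_from I (fun s => [set t | I t /\ t <= s]).
Definition right_end I : set_system R :=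
  filter_from I (fun s => [set t | I t /\ s <= t]).

Definition uniform_curve (A : R) I gamma : Prop :=
  [/\ curve I gamma,
      (curve_length gamma I < +oo)%E ->
        exists xim xip, [/\ completion xim, completion xip,
          completion_dist (to_completion (gamma t)) xim
            @[t --> left_end I] --> (0 : R),
          completion_dist (to_completion (gamma t)) xip
            @[t --> right_end I] --> (0 : R) &
          (curve_length gamma I <= (A * completion_dist xim xip)%:E)%E],
      curve_length gamma I = +oo%E ->
        d (gamma st.1) (gamma st.2)
          @[st --> filter_prod (left_end I) (right_end I)] --> +oo &
      forall t, I t ->
        (Order.min (curve_length gamma (I `&` [set s | s <= t]%R))
                   (curve_length gamma (I `&` [set s | t <= s]%R))
           <= (A * dist_to_boundary (gamma t))%:E)%E].

Definition uniform_space (A : R) : Prop :=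
  [/\ is_metric_on setT d, metric_boundary !=set0 &
      forall x y, exists a b gamma,
        [/\ a <= b, gamma a = x, gamma b = y & uniform_curve A `[a, b] gamma]].

(* Conformal deformation.  For a rectifiable curve on [a, b], the integral of
   [rho ds] is the integral of [rho] along the arc length parametrization
   [l |-> gamma (arc_param gamma a b l)], where [arc_param gamma a b l] is any
   [t] in [a, b] such that [gamma] has length [l] on [a, t]. *)
Definition arc_param gamma (a b l : R) : R :=
  xget a [set t | a <= t <= b /\ curve_length gamma `[a, t] = l%:E].

Definition rho_length (rho : T -> R) gamma (a b : R) : \bar R :=
  if (curve_length gamma `[a, b] < +oo)%E then
    (\int[lebesgue_measure]_(l in `[0%R, fine (curve_length gamma `[a, b])])
       (rho (gamma (arc_param gamma a b l)))%:E)%E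
  else +oo%E.

Definition rho_dist (rho : T -> R) (x y : T) : R :=
  fine (ereal_inf [set l | exists a b gamma,
    [/\ a <= b, curve `[a, b] gamma, gamma a = x, gamma b = y &
        l = rho_length rho gamma a b]]).

Definition GH_density (rho : T -> R) (M : R) : Prop :=
  forall a b gamma, a <= b -> geodesic `[a, b] gamma ->
    (rho_length rho gamma a b <= (M * rho_dist rho (gamma a) (gamma b))%:E)%E.

(* Gromov boundary, again as a set of classes of sequences.  The conditions do
   not depend on the basepoint [p]. *)
Definition gromov_prod (p x y : T) : R := (d x p + d y p - d x y) / 2.

Definition gromov_seq u : Prop := forall p,
  gromov_prod p (u mn.1) (u mn.2) @[mn --> filter_prod \oo \oo] --> +oo.

Definition gromov_class u : set (nat -> T) :=
  [set v | gromov_seq v /\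
    forall p, gromov_prod p (u n) (v n) @[n --> \oo] --> +oo].

Definition gromov_boundary : set (set (nat -> T)) :=
  [set xi | exists2 u, gromov_seq u & xi = gromov_class u].

Definition roughly_starlike (K : R) (omega : set (nat -> T)) : Prop :=
  (forall x, exists gamma,
     [/\ geodesic setT gamma, inf (range (fun t => d x (gamma t))) <= K &
         omega (fun n => gamma (- n%:R))]) /\
  (forall xi, (gromov_boundary `\ omega) xi -> exists gamma,
     [/\ geodesic setT gamma, xi (fun n => gamma n%:R) &
         omega (fun n => gamma (- n%:R))]).

Definition busemann gamma (x : T) : R :=
  lim ((d (gamma t) x - t) @[t --> +oo]).

Definition busemann_prod (b : T -> R) (x y : T) : R :=
  (b x + b y - d x y) / 2.

Definition boundary_prod (b : T -> R) (xi zeta : set (nat -> T)) : \bar R :=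
  ereal_inf [set l | exists u v, [/\ xi u, zeta v &
    l = limn_einf (fun n => (busemann_prod b (u n) (v n))%:E)]].

(* theta_(eps, b), with the convention exp (- oo) = 0 *)
Definition visual_kernel (eps : R) (b : T -> R) (xi zeta : set (nat -> T)) :
    \bar R :=
  expeR (- (eps%:E * boundary_prod b xi zeta))%E.

Definition visual_metric (omega : set (nat -> T)) (b : T -> R) (eps L : R)
    (theta : set (nat -> T) -> set (nat -> T) -> R) : Prop :=
  is_metric_on (gromov_boundary `\ omega) theta /\
  forall xi zeta, (gromov_boundary `\ omega) xi ->
    (gromov_boundary `\ omega) zeta ->
    ((L^-1)%:E * visual_kernel eps b xi zeta <= (theta xi zeta)%:E /\
     (theta xi zeta)%:E <= L%:E * visual_kernel eps b xi zeta)%E.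

End Metric.

(* [canonical_map d' xi] is the common limit, in the completion of (T, d'), of
   the sequences in the point [xi] of the Gromov boundary. *)
Definition canonical_map {R : realType} {T : Type} (d' : T -> T -> R)
    (xi : set (nat -> T)) : set (nat -> T) :=
  xget set0 [set eta | completion d' eta /\
    forall u, xi u -> converges_in_completion d' u eta].

Section Filling.
Context {R : realType} {Z : metricType R}.
Variables (alpha tau : R) (S : int -> set Z).

Definition separated (r : R) (A : set Z) : Prop :=
  forall x y, A x -> A y -> x <> y -> r <= mdist x y.

Definition maximal_separated (r : R) (A : set Z) : Prop :=
  separated r A /\ forall B, separated r B -> A `<=` B -> B = A.

(* [S n] is the chosen separated set at height [n]; the vertex (z, n) is the
   pair itself. *)
Definition vertex (v : Z * int) : Prop := S v.2 v.1.

Definition vertex_ball (v : Z * int) : set Z := ball v.1 (tau * alpha ^ (- v.2)).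

Definition edge (v w : Z * int) : Prop :=
  [/\ vertex v, vertex w, v <> w, `|v.2 - w.2| <= 1 &
      vertex_ball v `&` vertex_ball w !=set0].

(* Points of the graph are represented by their barycentric coordinates:
   [bary v w t] is the point at distance [t] from [v] on the edge [vw], and
   [bary v v t] is the vertex [v]. *)
Definition bary (v w : Z * int) (t : R) : Z * int -> R :=
  fun u => (1 - t) * (u == v)%:R + t * (u == w)%:R.

Definition filling_points : set (Z * int -> R) :=
  [set x | exists v w t, [/\ (vertex v /\ v = w) \/ edge v w, 0 <= t <= 1 &
                             x = bary v w t]].

Definition filling : Type := set_type filling_points.

Definition height (x : filling) : R :=
  \sum_(v \in [set: Z * int]) val x v * v.2%:~R.

(* [pl_path x y l]: a concatenation of segments of edges, of total length [l],
   leads from [x] to [y]. *)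
Inductive pl_path : filling -> filling -> R -> Prop :=
| pl_nil x : pl_path x x 0
| pl_cons x y z v w s t l :
    edge v w -> 0 <= s <= 1 -> 0 <= t <= 1 ->
    val x = bary v w s -> val y = bary v w t ->
    pl_path y z l -> pl_path x z (`|s - t| + l).

(* The infimum is over a nonempty set as soon as the graph is connected, as it is
   for S n maximal alpha^-n-separated and alpha, tau > 1. *)
Definition path_dist (x y : filling) : R := inf [set l | pl_path x y l].

Definition filling_density (x : filling) : R := alpha `^ (- height x).

(* [gamma], on the half-line [0, +oo[, runs at unit speed through the vertices
   v 0, v 1, ... along vertical edges, the height changing by [e] at each step. *)
Definition vertical_ray (e : int) (gamma : R -> filling) (v : nat -> Z * int) :
    Prop :=
  forall i : nat, [/\ edge (v i) (v i.+1), (v i.+1).2 = (v i).2 + e &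
    forall s, 0 <= s <= 1 -> val (gamma (i%:R + s)) = bary (v i) (v i.+1) s].

Definition ascending_ray := vertical_ray 1.
Definition descending_ray := vertical_ray (- 1).

Definition anchored (v : nat -> Z * int) (z : set (nat -> Z)) : Prop :=
  forall i, completion_dist mdist (to_completion mdist (v i).1) z
            < tau / 3 * alpha ^ (- (v i).2).

Definition ray_class (gamma : R -> filling) : set (nat -> filling) :=
  gromov_class path_dist (fun n => gamma n%:R).

Definition anchored_class (z : set (nat -> Z)) : set (nat -> filling) :=
  xget set0 [set xi | gromov_boundary path_dist xi /\
    forall gamma v, ascending_ray gamma v -> anchored v z ->
      xi (fun n => gamma n%:R)].

End Filling.

(* Main.v *)
(* Write E t = alpha^t, h for the height and rho = E (- h).  Each x in X is close
   to a vertex (proj x, n), and the proof compares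
     quasi x y = d_Z (proj x) (proj y) + rho x + rho y,
     geo x y   = E ((d x y - h x - h y) / 2),
   the latter being alpha^-(x|y) for the Gromov product based at the common end
   of the descending rays.
   Descending from two vertices to the scale of their distance in Z gives
   geo <= C quasi.  Integrating rho along a geodesic, on which h is bounded
   below by the 1-Lipschitz bounds from both ends, gives d_rho <= C geo.  Since
   proj moves at speed at most C rho, also
   d_Z (proj x) (proj y) <= C (d_rho x y + rho x + rho y), so quasi <= C geo.
   Thus quasi, geo and d_rho + rho x + rho y are comparable, and the exact
   triangle inequality of quasi plays the role of Gromov hyperbolicity.
   The GH property follows for d x y >= 1 because then rho x + rho y <= C d_rho,
   and uniformity because every w on a geodesic from x to y has
   min (geo x w) (geo w y) <= C rho w.  Both the points of partial_omega and
   those of the boundary of X_rho turn out to be the classes of sequences for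
   which quasi (u m) (u n) tends to 0, so that phi is the identity, while omega
   is the class of the sequences for which quasi (u n) p tends to infinity.
   Along sequences of boundary points quasi converges to the distance in the
   completion of Z, which compares it with d_rho and, as the Busemann function
   is h up to a bounded error, with the visual kernel. *)
Require Import Defs.
From HB Require Import structures.
From mathcomp Require Import all_boot all_order all_algebra.
From mathcomp Require Import all_classical all_reals all_analysis.
From mathcomp Require Import ring lra zify.

Set Implicit Arguments.
Unset Strict Implicit.
Unset Printing Implicit Defensive.

Import Order.TTheory GRing.Theory Num.Theory.
Import numFieldNormedType.Exports.

Local Open Scope classical_set_scope.
Local Open Scope ring_scope.

(** Two features of the definitions shape the technical work. The conformal length is an integral
    along an arc length parametrization picked by [xget], so curves are replaced by 1-Lipschitz maps
    of the whole line. Integrals of [rho] along two parametrizations of one curve are then compared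
    by subdivision: on a step of length t the Harnack inequality costs only a factor alpha^(c t),
    which tends to 1, so that exact inequalities result. Reversal and concatenation of curves, hence
    symmetry and the triangle inequality of d_rho, are treated in this way. Secondly, the infimum in
    [path_dist] is never assumed to be attained: curves of length at most d x y + min 1 (d x y)
    stand in for geodesics. Upper bounds on lengths come from potentials, functions whose increments
    dominate small steps. Lower bounds on d_rho come from test functions with local Lipschitz
    constant at most C rho: a truncated distance, [rho] itself, and the interpolated distance in Z
    to a projection. That rho tends to 0 at the boundary of X_rho rests on the completeness of X: as
    long as rho stays away from 0, a d_rho-Cauchy sequence is d-Cauchy. *)

(** * Limits of real sequences in epsilon form *)

Section Sequences.
Context {R : realType}.
Implicit Types (f : nat -> R) (F : nat * nat -> R) (l : R).

Lemma cvg_seqP f l : f n @[n --> \oo] --> l <->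
  forall e, 0 < e -> exists N, forall n, (N <= n)%N -> `|f n - l| < e.
Proof.
split=> [/cvgrPdist_lt fl e e0|fl].
  have [N _ NP] := fl e e0; exists N => n Nn; rewrite distrC; exact: NP.
apply/cvgrPdist_lt => e e0; have [N NP] := fl e e0.
by exists N => // n Nn; rewrite distrC; exact: NP.
Qed.

Lemma near_pairP (P : nat * nat -> Prop) :
  (\forall mn \near filter_prod \oo \oo, P mn) <->
  exists N, forall m n, (N <= m)%N -> (N <= n)%N -> P (m, n).
Proof.
split=> [[[A B] [[N1 _ NA] [N2 _ NB]] ABP]|[N NP]].
  exists (maxn N1 N2) => m n; rewrite !geq_max => /andP[m1 m2] /andP[n1 n2].
  by apply: ABP; split; [exact: NA|exact: NB].
exists ([set n | (N <= n)%N], [set n | (N <= n)%N]); first by split; exists N.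
by move=> [m n] [/=]; exact: NP.
Qed.

Lemma cvg_pairP F l : F mn @[mn --> filter_prod \oo \oo] --> l <->
  forall e, 0 < e -> exists N, forall m n, (N <= m)%N -> (N <= n)%N ->
    `|F (m, n) - l| < e.
Proof.
split=> [/cvgrPdist_lt fl e e0|fl].
  have [N NP] := (near_pairP _).1 (fl e e0).
  by exists N => m n Nm Nn; rewrite distrC; exact: NP.
apply/cvgrPdist_lt => e e0; have [N NP] := fl e e0.
by apply: (near_pairP _).2; exists N => m n Nm Nn; rewrite distrC; exact: NP.
Qed.

Lemma cvg_seq_pinftyP f : f n @[n --> \oo] --> +oo <->
  forall K, exists N, forall n, (N <= n)%N -> K <= f n.
Proof.
split=> [/cvgryPge fl K|fl]; first by have [N _ NP] := fl K; exists N.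
by apply/cvgryPge => K; have [N NP] := fl K; exists N.
Qed.

Lemma cvg_pair_pinftyP F : F mn @[mn --> filter_prod \oo \oo] --> +oo <->
  forall K, exists N, forall m n, (N <= m)%N -> (N <= n)%N -> K <= F (m, n).
Proof.
split=> [/cvgryPge fl K|fl]; first exact: (near_pairP _).1 (fl K).
by apply/cvgryPge => K; exact: (near_pairP _).2 (fl K).
Qed.

Lemma cvg_seq_ge f l m : f n @[n --> \oo] --> l ->
  (exists N, forall n, (N <= n)%N -> m <= f n) -> m <= l.
Proof.
move=> fl [N NP]; have cm : m @[n --> \oo] --> m by exact: cvg_cst.
by apply: (ler_cvg_to cm fl); exists N.
Qed.

Lemma cvg_seq_le f l m : f n @[n --> \oo] --> l ->
  (exists N, forall n, (N <= n)%N -> f n <= m) -> l <= m.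
Proof.
move=> fl [N NP]; have cm : m @[n --> \oo] --> m by exact: cvg_cst.
by apply: (ler_cvg_to fl cm); exists N.
Qed.

Lemma cauchy_seq_cvg f :
  (forall e, 0 < e -> exists N, forall m n, (N <= m)%N -> (N <= n)%N ->
    `|f m - f n| < e) -> exists l, f n @[n --> \oo] --> l.
Proof.
move=> cf; exists (limn f); apply: cauchy_cvg; apply: cauchy_exP => e e0.
have [N NP] := cf e e0; exists (f N); exists N => // n Nn.
by rewrite -ball_normE /=; exact: NP.
Qed.

Lemma exists_invS_lt (e : R) : 0 < e ->
  exists N : nat, forall n, (N <= n)%N -> n.+1%:R^-1 < e.
Proof.
move=> e0; have /cvg_seqP/(_ e e0)[N NP] := @cvg_harmonic R.
exists N => n /NP; rewrite subr0; apply: le_lt_trans; exact: ler_norm.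
Qed.

(** Retraction of the line onto [a, b]. Composing with it extends a curve on an interval to the
    whole line without losing the Lipschitz bound. *)
Definition clamp (a b t : R) : R := Num.max a (Num.min t b).

Lemma clampP a b t : a <= b -> a <= clamp a b t <= b.
Proof. by move=> ab; rewrite /clamp le_max lexx /= ge_max ab ge_min lexx orbT. Qed.

Lemma clampE a b t : a <= t -> t <= b -> clamp a b t = t.
Proof. by move=> ta tb; rewrite /clamp min_l // max_r. Qed.

Lemma clamp_lipschitz a b s t : a <= b ->
  `|clamp a b s - clamp a b t| <= `|s - t|.
Proof.
wlog st : s t / s <= t => [hw ab|ab].
  by case: (leP s t) => [|/ltW] h; [|rewrite distrC (distrC s)]; exact: hw.
rewrite distrC (distrC s) (ger0_norm (_ : 0 <= t - s)) ?subr_ge0 // ler_norml /clamp.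
by case: (leP t b) => h1; case: (leP s b) => h2;
  case: (leP a t) => h3; case: (leP a s) => h4; case: (leP a b) => h5;
  apply/andP; split; lra.
Qed.

End Sequences.

(** * Completions *)

Section Completion.
Context {R : realType} {T : Type} (d : T -> T -> R).
Hypothesis dM : is_metric_on setT d.
Implicit Types (u v w : nat -> T) (xi zeta : set (nat -> T)).

Lemma dist_ge0 x y : 0 <= d x y. Proof. by have [+ _ _ _] := dM; apply. Qed.

Lemma dist0P x y : d x y = 0 <-> x = y.
Proof. by have [_ + _ _] := dM; apply. Qed.

Lemma distxx x : d x x = 0. Proof. exact/dist0P. Qed.

Lemma dist_sym x y : d x y = d y x. Proof. by have [_ _ + _] := dM; apply. Qed.

Lemma dist_tri y x z : d x z <= d x y + d y z.
Proof. by have [_ _ _ +] := dM; apply. Qed.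

Lemma dist_quad x y x' y' : `|d x y - d x' y'| <= d x x' + d y y'.
Proof.
have h1 := dist_tri x' x y; have h2 := dist_tri y' x' y.
have h3 := dist_tri x x' y'; have h4 := dist_tri y x y'.
move: h2 h3; rewrite (dist_sym y' y) (dist_sym x' x) => h2 h3.
by rewrite ler_norml; apply/andP; split; lra.
Qed.

Lemma cauchyP u : cauchy_seq d u <->
  forall e, 0 < e -> exists N, forall m n, (N <= m)%N -> (N <= n)%N ->
    d (u m) (u n) < e.
Proof.
split=> [/cvg_pairP h e e0|h].
  have [N NP] := h e e0; exists N => m n Nm Nn.
  by have := NP m n Nm Nn; rewrite subr0 ger0_norm ?dist_ge0.
apply/cvg_pairP => e e0; have [N NP] := h e e0; exists N => m n Nm Nn.
by rewrite subr0 ger0_norm ?dist_ge0 //=; exact: NP.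
Qed.

Lemma dist_cvg0P u v : d (u n) (v n) @[n --> \oo] --> (0 : R) <->
  forall e, 0 < e -> exists N, forall n, (N <= n)%N -> d (u n) (v n) < e.
Proof.
split=> [/cvg_seqP h e e0|h].
  have [N NP] := h e e0; exists N => n Nn.
  by have := NP n Nn; rewrite subr0 ger0_norm ?dist_ge0.
apply/cvg_seqP => e e0; have [N NP] := h e e0; exists N => n Nn.
by rewrite subr0 ger0_norm ?dist_ge0 //=; exact: NP.
Qed.

Lemma cauchy_cst x : cauchy_seq d (fun=> x).
Proof. by apply/cauchyP => e e0; exists 0%N => *; rewrite distxx. Qed.

Lemma cauchy_class_refl u : cauchy_seq d u -> cauchy_class d u u.
Proof.
move=> cu; split=> //; apply/dist_cvg0P => e e0.
by exists 0%N => n _; rewrite distxx.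
Qed.

Lemma cvg0_sym u v : d (u n) (v n) @[n --> \oo] --> (0 : R) ->
  d (v n) (u n) @[n --> \oo] --> (0 : R).
Proof. by under eq_fun do rewrite dist_sym. Qed.

Lemma cvg0_trans v u w : d (u n) (v n) @[n --> \oo] --> (0 : R) ->
  d (v n) (w n) @[n --> \oo] --> (0 : R) ->
  d (u n) (w n) @[n --> \oo] --> (0 : R).
Proof.
move=> /dist_cvg0P uv /dist_cvg0P vw; apply/dist_cvg0P => e e0.
have e20 : 0 < e / 2 by lra.
have [N NP] := uv _ e20; have [M MP] := vw _ e20.
exists (maxn N M) => n; rewrite geq_max => /andP[Nn Mn].
have := dist_tri (v n) (u n) (w n); have := NP n Nn; have := MP n Mn; lra.
Qed.

Lemma eq_cauchy_class u v : cauchy_class d u v ->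
  cauchy_class d u = cauchy_class d v.
Proof.
move=> [cv uv]; apply/seteqP; split=> w [cw h]; split=> //.
  exact: cvg0_trans (cvg0_sym uv) h.
exact: cvg0_trans uv h.
Qed.

Lemma completion_inh xi : completion d xi -> exists u, xi u.
Proof. by move=> [u cu ->]; exists u; exact: cauchy_class_refl. Qed.

Lemma completion_mem xi u : completion d xi -> xi u ->
  cauchy_seq d u /\ xi = cauchy_class d u.
Proof.
move=> [v cv ->] uv; split; first by case: uv.
exact: eq_cauchy_class.
Qed.

Lemma completion_classP xi u : completion d xi -> xi u ->
  forall v, xi v <-> cauchy_seq d v /\ d (u n) (v n) @[n --> \oo] --> (0 : R).
Proof. by move=> cx xu v; have [cu ->] := completion_mem cx xu. Qed.

Lemma cauchy_dist_cvg u v : cauchy_seq d u -> cauchy_seq d v ->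
  exists l : R, d (u n) (v n) @[n --> \oo] --> l.
Proof.
move=> /cauchyP cu /cauchyP cv; apply: cauchy_seq_cvg => e e0; have e20 : 0 < e / 2 by lra.
have [N NP] := cu _ e20; have [M MP] := cv _ e20.
exists (maxn N M) => m n; rewrite !geq_max => /andP[Nm Mm] /andP[Nn Mn].
apply: le_lt_trans (dist_quad _ _ _ _) _.
have := NP m n Nm Nn; have := MP m n Mm Mn; lra.
Qed.

(** The choice in [completion_dist] never falls back on its default: the limit exists for one pair
    of representatives, and [dist_quad] carries it over to every other pair. *)
Lemma completion_dist_cvg xi zeta u v : completion d xi -> completion d zeta ->
  xi u -> zeta v -> d (u n) (v n) @[n --> \oo] --> completion_dist d xi zeta.
Proof.
move=> cx cz xu zv; have [cu _] := completion_mem cx xu.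
have [cv _] := completion_mem cz zv.
have [l lP] := cauchy_dist_cvg cu cv.
rewrite /completion_dist; case: xgetP => [r -> /=|/(_ l)]; first exact.
case=> u' v' xu' zv'.
have [_ /dist_cvg0P hu] := (completion_classP cx xu u').1 xu'.
have [_ /dist_cvg0P hv] := (completion_classP cz zv v').1 zv'.
move/cvg_seqP : lP => lP; apply/cvg_seqP => e e0.
have e30 : 0 < e / 3 by lra.
have [N NP] := hu _ e30; have [M MP] := hv _ e30; have [K KP] := lP _ e30.
exists (maxn N (maxn M K)) => n; rewrite !geq_max => /and3P[Nn Mn Kn].
have h := dist_quad (u' n) (v' n) (u n) (v n).
rewrite (dist_sym (u' n) (u n)) (dist_sym (v' n) (v n)) in h.
have -> : d (u' n) (v' n) - l =
  (d (u' n) (v' n) - d (u n) (v n)) + (d (u n) (v n) - l) by ring.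
apply: le_lt_trans (ler_normD _ _) _.
have := NP n Nn; have := MP n Mn; have := KP n Kn; lra.
Qed.

Lemma completion_distE xi zeta u v l : completion d xi -> completion d zeta ->
  xi u -> zeta v -> d (u n) (v n) @[n --> \oo] --> l ->
  completion_dist d xi zeta = l.
Proof.
move=> cx cz xu zv h; have h' := completion_dist_cvg cx cz xu zv.
exact: (cvg_unique _ h' h).
Qed.

Lemma completion_dist_le xi zeta u v e : completion d xi ->
  completion d zeta -> xi u -> zeta v ->
  (exists N, forall n, (N <= n)%N -> d (u n) (v n) <= e) ->
  completion_dist d xi zeta <= e.
Proof.
move=> cx cz xu zv; exact: cvg_seq_le (completion_dist_cvg cx cz xu zv).
Qed.

Lemma completion_dist_ge xi zeta u v e : completion d xi ->
  completion d zeta -> xi u -> zeta v ->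
  (exists N, forall n, (N <= n)%N -> e <= d (u n) (v n)) ->
  e <= completion_dist d xi zeta.
Proof.
move=> cx cz xu zv; exact: cvg_seq_ge (completion_dist_cvg cx cz xu zv).
Qed.

Lemma completion_metric : is_metric_on (completion d) (completion_dist d).
Proof.
split=> [x y cx cy|x y cx cy|x y cx cy|x y z cx cy cz].
- have [u xu] := completion_inh cx; have [v yv] := completion_inh cy.
  by apply: (completion_dist_ge cx cy xu yv); exists 0%N => n _; exact: dist_ge0.
- have [u xu] := completion_inh cx; have [v yv] := completion_inh cy.
  split=> [h|<-].
    have [cu ->] := completion_mem cx xu; have [cv ->] := completion_mem cy yv.
    apply: eq_cauchy_class; split=> //.
    by have := completion_dist_cvg cx cy xu yv; rewrite h.
  apply: (completion_distE cx cx xu xu); apply/dist_cvg0P => e e0.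
  by exists 0%N => n _; rewrite distxx.
- have [u xu] := completion_inh cx; have [v yv] := completion_inh cy.
  apply: (completion_distE cx cy xu yv).
  under eq_fun do rewrite dist_sym.
  exact: completion_dist_cvg.
- have [u xu] := completion_inh cx; have [v yv] := completion_inh cy.
  have [w zw] := completion_inh cz.
  have h : d (u n) (v n) + d (v n) (w n) @[n --> \oo] -->
      completion_dist d x y + completion_dist d y z.
    by apply: cvgD; exact: completion_dist_cvg.
  have := ler_cvg_to (completion_dist_cvg cx cz xu zw) h; apply.
  by exists 0%N => // n _; exact: dist_tri.
Qed.

Lemma completion_to x : completion d (to_completion d x).
Proof. by exists (fun=> x) => //; exact: cauchy_cst. Qed.

Lemma to_completion_cst x : to_completion d x (fun=> x).
Proof. exact/cauchy_class_refl/cauchy_cst. Qed.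

Lemma completion_class u : cauchy_seq d u -> completion d (cauchy_class d u).
Proof. by move=> cu; exists u. Qed.

Lemma converges_in_completion_mem xi u : completion d xi -> xi u ->
  converges_in_completion d u xi.
Proof.
move=> cx xu; have [/cauchyP cu _] := completion_mem cx xu.
apply/cvg_seqP => e e0; have [N NP] := cu (e / 2) ltac:(lra).
exists N => n Nn; rewrite subr0 ger0_norm; last first.
  have [+ _ _ _] := completion_metric; apply=> //; exact: completion_to.
have : completion_dist d (to_completion d (u n)) xi <= e / 2; last by lra.
apply: (completion_dist_le (completion_to _) cx (to_completion_cst _) xu).
by exists N => m Nm; apply/ltW/NP.
Qed.

Lemma converges_in_completion_unique u xi zeta : completion d xi ->
  completion d zeta -> converges_in_completion d u xi ->
  converges_in_completion d u zeta -> xi = zeta.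
Proof.
move=> cx cz /cvg_seqP hx /cvg_seqP hz.
have [m0 m1 m2 m3] := completion_metric.
apply/(m1 _ _ cx cz)/eqP; rewrite eq_le m0 // andbT.
apply/ler_addgt0Pl => e e0; rewrite addr0.
have [N NP] := hx (e / 2) ltac:(lra); have [M MP] := hz (e / 2) ltac:(lra).
have := m3 _ (to_completion d (u (maxn N M))) _ cx (completion_to _) cz.
rewrite (m2 xi _ cx (completion_to _)).
have := NP (maxn N M) (leq_maxl _ _); have := MP (maxn N M) (leq_maxr _ _).
rewrite !subr0 !ger0_norm ?m0 //; try exact: completion_to.
lra.
Qed.

(** Converse of [converges_in_completion_mem]. Since a point is the full class of its Cauchy
    sequences, proving convergence to it is a way to exhibit a representative. *)
Lemma converges_in_completion_in u xi : completion d xi ->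
  converges_in_completion d u xi -> xi u.
Proof.
move=> cx cu; have [v xv] := completion_inh cx.
have [m0 _ ms mt] := completion_metric; have ct x := completion_to x.
move: (cu) => /cvg_seqP hu; have /cvg_seqP hv := converges_in_completion_mem cx xv.
have dE x y : d x y = completion_dist d (to_completion d x) (to_completion d y).
  apply: esym; apply: (completion_distE (ct x) (ct y) (to_completion_cst x)
    (to_completion_cst y)); exact: cvg_cst.
have hn x : `|completion_dist d (to_completion d x) xi - 0| =
    completion_dist d (to_completion d x) xi.
  by rewrite subr0 ger0_norm // m0.
apply/(completion_classP cx xv); split.
  apply/cauchyP => e e0; have [N NP] := hu (e / 2) ltac:(lra).
  exists N => m n /NP hm /NP; rewrite hn => hn'; rewrite hn in hm.
  rewrite dE; have := mt _ xi _ (ct (u m)) cx (ct (u n)); rewrite (ms xi _ cx (ct _)).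
  lra.
apply/dist_cvg0P => e e0; have [N NP] := hu (e / 2) ltac:(lra).
have [M MP] := hv (e / 2) ltac:(lra).
exists (maxn N M) => n; rewrite geq_max => /andP[/NP hm /MP]; rewrite hn => hn'.
rewrite hn in hm; rewrite dE.
have := mt _ xi _ (ct (v n)) cx (ct (u n)); rewrite (ms xi _ cx (ct _)); lra.
Qed.

Lemma metric_boundaryP xi u : completion d xi -> xi u ->
  metric_boundary d xi <->
  forall x, ~ d (u n) x @[n --> \oo] --> (0 : R).
Proof.
move=> cx xu; have [cu xiE] := completion_mem cx xu; split.
  move=> [_ h] x ux; apply: h; exists x => //.
  rewrite xiE; apply: esym; apply: eq_cauchy_class; split; last exact: ux.
  exact: cauchy_cst.
move=> h; split=> // -[x _ xE]; apply: (h x).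
have : to_completion d x u by rewrite xE.
by move=> [_ /cvg0_sym].
Qed.

(** Needed for the ends of a curve, which are limits along the filters [left_end] and [right_end],
    whereas points of the completion are classes of sequences. *)
Lemma cauchy_filter_cvg {I : Type} (F : set_system I) (g : I -> T) :
  ProperFilter F ->
  (forall e, 0 < e -> exists2 A, F A & forall s t, A s -> A t -> d (g s) (g t) <= e) ->
  exists2 xi, completion d xi &
    completion_dist d (to_completion d (g t)) xi @[t --> F] --> (0 : R).
Proof.
move=> FF h.
have hn (n : nat) : {A | F A /\
    forall s t, A s -> A t -> d (g s) (g t) <= n.+1%:R^-1}.
  apply: cid; have [|A FA AP] := h n.+1%:R^-1; first by rewrite invr_gt0.
  by exists A.
pose A n := projT1 (hn n).
have FA n : F (A n) by rewrite /A; case: (hn n) => ? [].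
have AP n s t : A n s -> A n t -> d (g s) (g t) <= n.+1%:R^-1.
  by rewrite /A; case: (hn n) => ? [] ? /=; apply.
(* The sets [A n] need not be nested, so the n-th term of the sequence is taken in the intersection
   of the first n + 1 of them. *)
have FB n : F [set t | forall i, (i <= n)%N -> A i t].
  elim: n => [|n IH].
    by apply: filterS (FA 0%N) => t At i; rewrite leqn0 => /eqP ->.
  apply: filterS (filterI IH (FA n.+1)) => t [/= Bt At] i.
  by rewrite leq_eqVlt => /orP[/eqP -> //|]; rewrite ltnS; exact: Bt.
have hs n : {t | forall i, (i <= n)%N -> A i t}.
  by apply: cid; exact: filter_ex (FB n).
pose s n := projT1 (hs n).
have sP n i : (i <= n)%N -> A i (s n) by rewrite /s; case: (hs n) => ? /=; apply.
have cs : cauchy_seq d (g \o s).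
  apply/cauchyP => e e0; have [N NP] := exists_invS_lt e0.
  exists N => m n Nm Nn /=; apply: le_lt_trans (NP N (leqnn N)).
  by apply: AP; exact: sP.
exists (cauchy_class d (g \o s)); first exact: completion_class.
apply/cvgrPdist_le => e e0; have [N NP] := exists_invS_lt e0.
apply: filterS (FA N) => t At; rewrite sub0r normrN ger0_norm; last first.
  have [+ _ _ _] := completion_metric; apply; first exact: completion_to.
  exact: completion_class.
apply: (completion_dist_le (completion_to _) (completion_class cs)
  (to_completion_cst _) (cauchy_class_refl cs)).
exists N => n Nn /=; apply/ltW/(le_lt_trans _ (NP N (leqnn N))).
by apply: AP => //; exact: sP.
Qed.

End Completion.

(** * Length of curves *)

Section CurveLength.
Context {R : realType} {T : Type} (d : T -> T -> R).
Hypothesis dM : is_metric_on setT d.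
Implicit Types (g : R -> T) (I : set R).

Local Notation dge0 := (dist_ge0 dM).
Local Notation dtri := (dist_tri dM).

(** The polygonal sum of [curve_length] with its first point split off, which suits [path] and
    induction on the list. *)
Fixpoint chain_length g x (s : seq R) : R :=
  if s is y :: s' then d (g x) (g y) + chain_length g y s' else 0.

Lemma chain_lengthE g x s : chain_length g x s =
  \sum_(i < size s) d (g (nth 0 (x :: s) i)) (g (nth 0 (x :: s) i.+1)).
Proof.
elim: s x => [|y s IH] x /=; first by rewrite big_ord0.
by rewrite big_ord_recl /= IH.
Qed.

Lemma chain_length_cat g x s1 s2 : chain_length g x (s1 ++ s2) =
  chain_length g x s1 + chain_length g (last x s1) s2.
Proof. by elim: s1 x => [|y s IH] x /=; rewrite ?add0r // IH addrA. Qed.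

Lemma chain_length_le g (P : R -> R) x s :
  (forall y z, y \in x :: s -> z \in x :: s -> y <= z ->
    d (g y) (g z) <= P z - P y) ->
  path <=%R x s -> chain_length g x s <= P (last x s) - P x.
Proof.
elim: s x => [|y s IH] x h /=; first by rewrite subrr.
case/andP => xy ys.
have hxy : d (g x) (g y) <= P y - P x by apply: h; rewrite ?inE ?eqxx ?orbT.
have hl : chain_length g y s <= P (last y s) - P y.
  by apply: IH ys => u w us ws; apply: h; rewrite inE (us, ws) orbT.
by have := lerD hxy hl; lra.
Qed.

Lemma le_curve_length g I x s : path <=%R x s -> (forall y, y \in x :: s -> I y) ->
  ((chain_length g x s)%:E <= curve_length d g I)%E.
Proof.
move=> xs sI; apply: ereal_sup_ubound => /=.
by exists (x :: s) => //=; rewrite -?chain_lengthE.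
Qed.

Lemma curve_length_le g I (M : R) : 0 <= M ->
  (forall x s, path <=%R x s -> (forall y, y \in x :: s -> I y) ->
    chain_length g x s <= M) -> (curve_length d g I <= M%:E)%E.
Proof.
move=> M0 h; apply: ge_ereal_sup => _ [[|x s] [/= ss sI] <-].
  by rewrite big_ord0 lee_fin.
by rewrite -chain_lengthE lee_fin; apply: h.
Qed.

Lemma curve_length_ge0 g I : (0 <= curve_length d g I)%E.
Proof.
apply: ereal_sup_ubound; exists [::] => /=; last by rewrite big_ord0.
by split=> //= x.
Qed.

Lemma curve_length_approx g I (e : R) : I !=set0 -> (curve_length d g I < +oo)%E ->
  0 < e -> exists x s, [/\ path <=%R x s, forall y, y \in x :: s -> I y &
    fine (curve_length d g I) - e < chain_length g x s].
Proof.
move=> [x0 Ix0] fin e0.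
have finE : curve_length d g I \is a fin_num.
  by rewrite ge0_fin_numE ?curve_length_ge0.
have := @ub_ereal_sup_adherent _ _ _ e0 finE.
case=> _ [[|x s] [/= ss sI] <-]; rewrite /= -[ereal_sup _]fineK //.
  (* An empty near-optimal list is replaced by a one-point chain, whose sum is also 0; this is where
     I has to be nonempty. *)
  rewrite big_ord0 lte_fin => h; exists x0, [::]; split=> //= y.
  by rewrite inE => /eqP ->.
by rewrite -EFinB lte_fin -chain_lengthE => h; exists x, s.
Qed.

Lemma curve_length_dist g I a b : I a -> I b -> a <= b ->
  ((d (g a) (g b))%:E <= curve_length d g I)%E.
Proof.
move=> Ia Ib ab; have := @le_curve_length g I a [:: b].
rewrite /= addr0 ab; apply=> // y.
by rewrite !inE => /orP[] /eqP ->.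
Qed.

Lemma curve_length_sub g I J : I `<=` J ->
  (curve_length d g I <= curve_length d g J)%E.
Proof.
move=> IJ; apply: ereal_sup_le => _ [s [ss sI] <-].
by exists s => //; split=> // x /sI/IJ.
Qed.

(** The increments of P telescope along every chain. Bounding a length thus reduces to finding a
    potential. *)
Lemma curve_length_potential g (P : R -> R) (a b : R) : a <= b ->
  (forall s t, a <= s -> s <= t -> t <= b -> d (g s) (g t) <= P t - P s) ->
  (curve_length d g `[a, b] <= (P b - P a)%:E)%E.
Proof.
move=> ab h.
have hP s t : a <= s -> s <= t -> t <= b -> P s <= P t.
  by move=> as' st tb; rewrite -subr_ge0; exact: le_trans (dge0 _ _) (h _ _ as' st tb).
apply: curve_length_le => [|x s xs sI]; first by rewrite subr_ge0 hP.
have sI' y : y \in x :: s -> a <= y <= b by move=> /sI /=; rewrite in_itv.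
apply: (@le_trans _ _ (P (last x s) - P x)).
  apply: chain_length_le => // y z /sI'/andP[ay _] /sI'/andP[_ zb] yz; exact: h.
have /andP[al lb] := sI' _ (mem_last x s).
have /andP[ax xb] := sI' _ (mem_head x s).
by have := hP _ _ al lb (lexx b); have := hP _ _ (lexx a) ax xb; lra.
Qed.

Lemma path_split g (m x : R) s : path <=%R x s -> x <= m ->
  exists s1 s2, [/\ path <=%R x s1, path <=%R m s2,
    {in s1, forall y, y <= m}, {subset s2 <= s} &
    chain_length g x s <= chain_length g x s1 + chain_length g m s2].
Proof.
elim: s x => [|y s IH] x /=.
  by move=> _ xm; exists [::], [::]; split=> //=; rewrite addr0.
move=> /andP[xy ys] xm; case: (leP y m) => ym.
  have [s1 [s2 [p1 p2 h1 h2 h3]]] := IH y ys ym.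
  exists (y :: s1), s2; split=> //=; first by rewrite xy.
  - by move=> z; rewrite inE => /orP[/eqP -> //|/h1].
  - by move=> z /h2; rewrite inE => ->; rewrite orbT.
  - by rewrite -addrA lerD2l.
exists [:: m], (y :: s); split=> //=.
- by rewrite xm.
- by rewrite (ltW ym).
- by move=> z; rewrite inE => /eqP ->.
- by rewrite addr0 addrA lerD2r dtri.
Qed.

Lemma path_ge (x : R) s y : path <=%R x s -> y \in s -> x <= y.
Proof.
elim: s x => // z s IH x /= /andP[xz zs]; rewrite inE => /orP[/eqP -> //|].
by move=> /(IH _ zs); exact: le_trans.
Qed.

Lemma path_le_last (x : R) s y : path <=%R x s -> y \in x :: s -> y <= last x s.
Proof.
elim: s x y => [|z s IH] x y /=; first by rewrite inE => _ /eqP ->.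
move=> /andP[xz zs]; rewrite inE => /orP[/eqP ->|/(IH _ _ zs) //].
exact: le_trans xz (IH _ _ zs (mem_head _ _)).
Qed.

(** Inserting m into a chain does not shorten it, which gives one inequality; joining a chain on
    [a, m] to one on [m, b] gives the other. *)
Lemma curve_lengthD g (a m b : R) : a <= m -> m <= b ->
  (curve_length d g `[a, b] =
   curve_length d g `[a, m] + curve_length d g `[m, b])%E.
Proof.
move=> am mb; set V := curve_length d g `[a, b].
set V1 := curve_length d g `[a, m]; set V2 := curve_length d g `[m, b].
have V10 : (0 <= V1)%E := curve_length_ge0 _ _.
have V20 : (0 <= V2)%E := curve_length_ge0 _ _.
have V0 : (0 <= V)%E := curve_length_ge0 _ _.
have V1V : (V1 <= V)%E.
  by apply: curve_length_sub => x /=; rewrite !in_itv /= => /andP[-> /le_trans->].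
have V2V : (V2 <= V)%E.
  apply: curve_length_sub => x /=; rewrite !in_itv /= => /andP[mx ->].
  by rewrite (le_trans am).
apply/eqP; rewrite eq_le; apply/andP; split.
  have [V1oo|V1oo] := eqVneq V1 +oo%E;
    first by rewrite V1oo addye ?leey // gt_eqF // (lt_le_trans _ V20) // ltNye.
  have [V2oo|V2oo] := eqVneq V2 +oo%E;
    first by rewrite V2oo addey ?leey // gt_eqF // (lt_le_trans _ V10) // ltNye.
  have f1 : V1 \is a fin_num by rewrite ge0_fin_numE // ltey.
  have f2 : V2 \is a fin_num by rewrite ge0_fin_numE // ltey.
  rewrite -(fineK f1) -(fineK f2) -EFinD; apply: curve_length_le => [|x s xs sI].
    by rewrite addr_ge0 // fine_ge0.
  have [xm|mx] := leP x m.
    have [s1 [s2 [p1 p2 h1 h2 h3]]] := path_split g xs xm.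
    apply: le_trans h3 _; apply: lerD; rewrite -lee_fin fineK //.
      apply: le_curve_length => // y; rewrite inE => /orP[/eqP ->|ys].
        by have := sI x (mem_head _ _); rewrite /= !in_itv /= xm => /andP[->].
      rewrite /= in_itv /= h1 // andbT (le_trans _ (path_ge p1 ys)) //.
      by have := sI x (mem_head _ _); rewrite /= in_itv => /andP[].
    apply: le_curve_length => // y; rewrite inE => /orP[/eqP ->|ys].
      by rewrite /= in_itv /= lexx.
    rewrite /= in_itv /= (path_ge p2 ys).
    have := sI y; rewrite inE (h2 _ ys) orbT => /(_ isT).
    by rewrite /= in_itv => /andP[].
  apply: (@le_trans _ _ (fine V2)); last by rewrite lerDr fine_ge0.
  rewrite -lee_fin fineK //; apply: le_curve_length => // y ys.
  have := sI y ys; rewrite /= !in_itv => /andP[_ yb]; rewrite yb andbT.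
  move: ys; rewrite inE => /orP[/eqP -> |/(path_ge xs) xy]; first exact: ltW.
  exact: ltW (lt_le_trans mx xy).
have [->|Voo] := eqVneq V +oo%E; first by rewrite leey.
have fV : V \is a fin_num by rewrite ge0_fin_numE // ltey.
have f1 : V1 \is a fin_num.
  by rewrite ge0_fin_numE // (le_lt_trans V1V) // ltey.
have key x s y t : path <=%R x s -> (forall z, z \in x :: s -> `[a, m]%classic z) ->
    path <=%R y t -> (forall z, z \in y :: t -> `[m, b]%classic z) ->
    chain_length g x s + chain_length g y t <= fine V.
  move=> xs sI yt tI; rewrite -lee_fin fineK //.
  have : ((chain_length g x (s ++ y :: t))%:E <= V)%E.
    apply: le_curve_length.
      rewrite cat_path xs /= yt andbT.
      have := sI _ (mem_last x s); have := tI _ (mem_head y t).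
      by rewrite /= !in_itv /= => /andP[my _] /andP[_ /le_trans]; apply.
    move=> z; rewrite -cat_cons mem_cat => /orP[/sI|/tI]; rewrite /= !in_itv /=.
      by move=> /andP[-> /le_trans]; apply.
    by move=> /andP[mz ->]; rewrite (le_trans am).
  apply: le_trans; rewrite lee_fin chain_length_cat /= lerD2l lerDr.
  exact: dge0.
have single c e : c <= e -> forall z, z \in [:: c] -> `[c, e]%classic z.
  by move=> ce z; rewrite inE => /eqP ->; rewrite /= in_itv /= lexx.
rewrite -(fineK f1) -leeBrDl // -(fineK fV) -EFinB.
apply: curve_length_le => [|y t yt tI].
  by rewrite subr_ge0 fine_le.
rewrite lerBrDl -lerBrDr -lee_fin fineK //.
apply: curve_length_le => [|x s xs sI].
  rewrite subr_ge0; have := key a [::] y t isT (single _ _ _ am) yt tI.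
  by rewrite /= add0r.
by rewrite lerBrDr; exact: key.
Qed.

Lemma curveP g (a b : R) : a <= b -> curve d `[a, b] g <->
  forall t, a <= t <= b -> forall e, 0 < e -> exists2 r, 0 < r &
    forall s, a <= s <= b -> `|s - t| < r -> d (g t) (g s) < e.
Proof.
move=> ab; split.
  move=> [_ _ h] t tab e e0; have /cvgrPdist_lt/(_ e e0) := h t tab.
  rewrite near_withinE => /nbhs_ballP[r /= r0 rP]; exists r => // s sab st.
  have := rP s; rewrite -ball_normE /= distrC => /(_ st sab).
  by rewrite sub0r normrN ger0_norm ?dge0.
move=> h; split.
- exact: interval_is_interval.
- by exists a; rewrite /= in_itv /= lexx.
- move=> t tab; apply/cvgrPdist_lt => e e0; rewrite near_withinE.
  have [r r0 rP] := h t tab e e0; apply/nbhs_ballP; exists r => // s.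
  rewrite -ball_normE /= distrC => st sab.
  by rewrite sub0r normrN ger0_norm ?dge0 //; exact: rP.
Qed.

Lemma lipschitz_curve g (a b : R) : a <= b ->
  (forall s t, d (g s) (g t) <= `|s - t|) -> curve d `[a, b] g.
Proof.
move=> ab gl; apply/(curveP _ ab) => t tab e e0; exists e => // s sab st.
by apply: le_lt_trans (gl _ _) _; rewrite distrC.
Qed.

(** Each segment has two endpoints, and moving each of them by at most e changes the segment by at
    most 2e. *)
Lemma chain_length_map g (m : R -> R) (e : R) x s :
  (forall y, y \in x :: s -> d (g (m y)) (g y) <= e) ->
  chain_length g x s <=
    chain_length g (m x) (map m s) + 2 * e * (size s)%:R.
Proof.
elim: s x => [|y s IH] x h /=; first by rewrite mulr0 addr0.
have hl : chain_length g y s <=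
    chain_length g (m y) (map m s) + 2 * e * (size s)%:R.
  by apply: IH => z zs; apply: h; rewrite inE zs orbT.
have hx : d (g (m x)) (g x) <= e by apply: h; rewrite mem_head.
have hy : d (g (m y)) (g y) <= e by apply: h; rewrite !inE eqxx orbT.
have := dist_quad dM (g x) (g y) (g (m x)) (g (m y)).
rewrite (dist_sym dM (g x) (g (m x))) (dist_sym dM (g y) (g (m y))).
move=> /(le_trans (ler_norm _)) hd.
rewrite -[(size s).+1%:R]natr1 mulrDr mulr1; lra.
Qed.

Lemma path_map (m : R -> R) (x : R) s : {homo m : u v / u <= v} ->
  path <=%R x s -> path <=%R (m x) (map m s).
Proof. by move=> mm; exact: homo_path. Qed.

Lemma common_radius (A : eqType) (P : A -> R -> Prop) (s : seq A) :
  (forall y r r', 0 < r' -> r' <= r -> P y r -> P y r') ->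
  (forall y, y \in s -> exists2 r, 0 < r & P y r) ->
  exists2 r, 0 < r & forall y, y \in s -> P y r.
Proof.
move=> Pm; elim: s => [|y s IH] h; first by exists 1.
have [r r0 rP] : exists2 r, 0 < r & forall y, y \in s -> P y r.
  by apply: IH => z zs; apply: h; rewrite inE zs orbT.
have [r' r'0 r'P] : exists2 r, 0 < r & P y r by apply: h; rewrite mem_head.
exists (Num.min r r') => [|z]; first by rewrite lt_min r0.
rewrite inE => /orP[/eqP ->|/rP h']; [apply: Pm r'P|apply: Pm h'];
  by rewrite ?lt_min ?r0 ?r'0 // ge_min lexx ?orbT.
Qed.

(** * Arc length of a rectifiable curve *)

Section Rectifiable.
Variables (g : R -> T) (a b : R).
Hypotheses (ab : a <= b) (gc : curve d `[a, b] g)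
  (gf : (curve_length d g `[a, b] < +oo)%E).

Definition arc_length (t : R) : R := fine (curve_length d g `[a, t]).

Lemma curve_length_fin s t : a <= s -> s <= t -> t <= b ->
  curve_length d g `[s, t] \is a fin_num.
Proof.
move=> as' st tb; rewrite ge0_fin_numE ?curve_length_ge0 //.
apply: le_lt_trans gf; apply: curve_length_sub => x /=.
by rewrite !in_itv /= => /andP[sx xt]; rewrite (le_trans as') // (le_trans xt).
Qed.

Lemma arc_lengthE t : a <= t -> t <= b ->
  curve_length d g `[a, t] = (arc_length t)%:E.
Proof. by move=> at' tb; rewrite fineK // curve_length_fin. Qed.

Lemma curve_length_arc s t : a <= s -> s <= t -> t <= b ->
  curve_length d g `[s, t] = (arc_length t - arc_length s)%:E.
Proof.
move=> as' st tb; have := curve_lengthD g as' st.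
rewrite (arc_lengthE as' (le_trans st tb)) (arc_lengthE (le_trans as' st) tb) => h.
by rewrite EFinB h [X in (X - _)%E]addeC addeK.
Qed.

Lemma arc_length_dist s t : a <= s -> s <= t -> t <= b ->
  d (g s) (g t) <= arc_length t - arc_length s.
Proof.
move=> as' st tb; rewrite -lee_fin -curve_length_arc //.
by apply: curve_length_dist => //=; rewrite in_itv /= lexx ?andbT.
Qed.

Lemma arc_length_start : arc_length a = 0.
Proof.
apply/eqP; rewrite eq_le; apply/andP; split; last first.
  by rewrite fine_ge0 ?curve_length_ge0.
rewrite -lee_fin -arc_lengthE //.
have := @curve_length_potential g (fun=> 0) a a (lexx a).
rewrite subrr; apply=> s t as' st ta.
have -> : s = t by apply/eqP; rewrite eq_le st; exact: le_trans ta as'.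
by rewrite (distxx dM).
Qed.

Lemma arc_length_nd s t : a <= s -> s <= t -> t <= b ->
  arc_length s <= arc_length t.
Proof.
move=> as' st tb; rewrite -subr_ge0; apply: le_trans (arc_length_dist as' st tb).
exact: dge0.
Qed.

(* Lower semicontinuity of length: a chain that nearly realizes the length of
   [g] on [p, q] is pushed into [p', q'] by a monotone map close to the
   identity. *)
Lemma curve_length_lsc p q (e : R) : a <= p -> p <= q -> q <= b -> 0 < e ->
  exists s : seq R, (forall y, y \in s -> p <= y <= q) /\
  exists2 e', 0 < e' & forall (m : R -> R) p' q',
    {homo m : u v / u <= v} -> a <= p' -> p' <= q' -> q' <= b ->
    (forall y, y \in s -> d (g (m y)) (g y) <= e' /\ p' <= m y <= q') ->
    arc_length q - arc_length p <= arc_length q' - arc_length p' + e.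
Proof.
move=> ap pq qb e0; have e20 : 0 < e / 2 by lra.
have ne : `[p, q]%classic !=set0 by exists p; rewrite /= in_itv /= lexx.
have fin : (curve_length d g `[p, q] < +oo)%E.
  by rewrite -ge0_fin_numE ?curve_length_ge0 // curve_length_fin.
have [x [s [xs sI hs]]] := curve_length_approx ne fin e20.
exists (x :: s); split; first by move=> y /sI /=; rewrite in_itv.
(* Half of e is spent on approximating the length by a chain, half on moving its points: 2 (e / 4 /
   n) per segment. The 1 keeps n positive for a chain of one point. *)
pose n : R := (size s)%:R + 1; have n0 : 0 < n by rewrite ltr_wpDl.
exists (e / 4 / n); first by rewrite divr_gt0 // divr_gt0.
move=> m p' q' mm ap' pq' qb' h.
have h1 : chain_length g x s <= chain_length g (m x) (map m s) +
    2 * (e / 4 / n) * (size s)%:R.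
  by apply: chain_length_map => y /h[].
have h2 : chain_length g (m x) (map m s) <= arc_length q' - arc_length p'.
  rewrite -lee_fin -curve_length_arc //; apply: le_curve_length.
    exact: path_map.
  by move=> y; rewrite -map_cons => /mapP[z /h[_ zI] ->] /=; rewrite in_itv.
have h3 : 2 * (e / 4 / n) * (size s)%:R <= e / 2.
  rewrite (_ : _ * _ = e / 2 * ((size s)%:R / n)); last by field; rewrite gt_eqF.
  rewrite ger_pMr // ler_pdivrMr // mul1r lerDl ler01 //.
rewrite curve_length_arc //= in hs; lra.
Qed.

(** A chain on [a, t] is pushed into [a, t'] by min(., t'). Points of the chain before t stay fixed
    once t' is close to t, and the point t itself moves little because g is continuous. *)
Lemma arc_length_left t (e : R) : a <= t -> t <= b -> 0 < e ->
  exists2 r, 0 < r & forall t', a <= t' -> t' <= t -> t - t' < r ->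
    arc_length t <= arc_length t' + e.
Proof.
move=> at' tb e0.
have [s [sI [e' e'0 h]]] := curve_length_lsc (lexx a) at' tb e0.
have [r r0 rP] : exists2 r, 0 < r & forall y, y \in s -> forall t', a <= t' ->
    t' <= t -> t - t' < r -> d (g (Num.min y t')) (g y) <= e'.
  apply: (@common_radius _ (fun y r => forall t', a <= t' -> t' <= t ->
    t - t' < r -> d (g (Num.min y t')) (g y) <= e')).
    move=> y r r' r'0 rr' hy t' t1 t2 t3; apply: hy => //.
    exact: lt_le_trans t3 rr'.
  move=> y /sI /andP[ay]; rewrite le_eqVlt => /orP[/eqP ->|yt].
    have tab : a <= t <= b by rewrite at'.
    have [r r0 rP] := (curveP g ab).1 gc t tab e' e'0.
    exists r => // t' at'' tt' tr; rewrite min_r // (dist_sym dM).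
    apply/ltW/rP; first by rewrite at'' (le_trans tt').
    by rewrite distrC ger0_norm // subr_ge0.
  exists (t - y); first by rewrite subr_gt0.
  move=> t' _ _ tr; rewrite min_l; first by rewrite (distxx dM) ltW.
  by apply: ltW; lra.
exists r => // t' at'' tt' tr.
have := h (fun y => Num.min y t') a t' _ (lexx a) at'' (le_trans tt' tb).
rewrite arc_length_start !subr0; apply.
  by move=> u v uv; rewrite le_min !ge_min uv lexx orbT.
move=> y ys; split; first exact: rP.
by have /andP[ay _] := sI y ys; rewrite le_min ay at'' /= ge_min lexx orbT.
Qed.

Lemma arc_length_right t (e : R) : a <= t -> t <= b -> 0 < e ->
  exists2 r, 0 < r & forall t', t <= t' -> t' <= b -> t' - t < r ->
    arc_length t' <= arc_length t + e.
Proof.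
move=> at' tb e0.
have [s [sI [e' e'0 h]]] := curve_length_lsc at' tb (lexx b) e0.
have [r r0 rP] : exists2 r, 0 < r & forall y, y \in s -> forall t', t <= t' ->
    t' <= b -> t' - t < r -> d (g (Num.max y t')) (g y) <= e'.
  apply: (@common_radius _ (fun y r => forall t', t <= t' -> t' <= b ->
    t' - t < r -> d (g (Num.max y t')) (g y) <= e')).
    move=> y r r' r'0 rr' hy t' t1 t2 t3; apply: hy => //.
    exact: lt_le_trans t3 rr'.
  move=> y /sI /andP[]; rewrite le_eqVlt => /orP[/eqP <- _|ty yb].
    have tab : a <= t <= b by rewrite at'.
    have [r r0 rP] := (curveP g ab).1 gc t tab e' e'0.
    exists r => // t' at'' tt' tr; rewrite max_r // (dist_sym dM).
    apply/ltW/rP; first by rewrite tt' (le_trans at').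
    by rewrite ger0_norm // subr_ge0.
  exists (y - t); first by rewrite subr_gt0.
  move=> t' _ _ tr; rewrite max_l; first by rewrite (distxx dM) ltW.
  by apply: ltW; lra.
exists r => // t' at'' tt' tr.
have := h (fun y => Num.max y t') t' b _ (le_trans at' at'') tt' (lexx b).
move=> h'; suff : arc_length b - arc_length t <= arc_length b - arc_length t' + e.
  lra.
apply: h'.
  by move=> u v uv; rewrite ge_max !le_max uv lexx orbT.
move=> y ys; split; first exact: rP.
have /andP[_ yb] := sI y ys; rewrite le_max lexx orbT /=.
by rewrite ge_max yb tt'.
Qed.

(** An intermediate value argument at the supremum of the parameters with arc length at most l: left
    continuity gives one inequality, right continuity the other. *)
Lemma arc_length_surj l : 0 <= l -> l <= arc_length b ->
  exists2 t, a <= t <= b & arc_length t = l.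
Proof.
move=> l0 lb; pose A := [set t | a <= t <= b /\ arc_length t <= l].
have Aa : A a by rewrite /A /= lexx ab arc_length_start.
have hA : has_sup A by split; [exists a|exists b => t [/andP[]]].
pose t := sup A.
have at' : a <= t by exact: sup_upper_bound.
have tb : t <= b by apply: ge_sup; [exists a|move=> u [/andP[]]].
exists t; first by rewrite at'.
apply/eqP; rewrite eq_le; apply/andP; split; apply/ler_addgt0Pl => e e0.
  have [r r0 rP] := arc_length_left at' tb e0.
  have [u [/andP[au ub] ul] tu] := sup_adherent r0 hA.
  have ut : u <= t by apply: sup_upper_bound => //; split=> //; rewrite au.
  by have := rP u au ut ltac:(rewrite -/t in tu; lra); lra.
have [r r0 rP] := arc_length_right at' tb e0.
have [tE|tnb] := eqVneq t b; first by rewrite tE; lra.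
have tb' : t < b by rewrite lt_neqAle tnb.
(* A parameter slightly beyond the supremum t; its arc length must exceed l, yet by right continuity
   exceeds that of t by at most e. *)
pose u := Num.min b (t + r / 2).
have tu : t < u by rewrite /u lt_min tb' ltrDl divr_gt0.
have ub : u <= b by rewrite /u ge_min lexx.
have ur : u - t < r.
  by apply: (@le_lt_trans _ _ (r / 2)); [rewrite lerBlDl /u ge_min lexx orbT|lra].
have := rP u (ltW tu) ub ur.
have [ul|lu] := leP (arc_length u) l; last by move=> h; apply: le_trans (ltW lu) _; lra.
have : u <= t by apply: sup_upper_bound => //; split=> //; rewrite (le_trans at' (ltW tu)).
by rewrite leNgt tu.
Qed.

(** The arc length parametrization as a 1-Lipschitz map of the whole line: each length is sent to
    the image of a chosen parameter, after clamping to the possible lengths. *)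
Lemma arc_length_trace : exists h : R -> T,
  [/\ forall u v, d (h u) (h v) <= `|u - v|, h 0 = g a,
      h (arc_length b) = g b &
      forall t, a <= t -> t <= b -> h (arc_length t) = g t].
Proof.
have L0 : 0 <= arc_length b.
  by rewrite -arc_length_start arc_length_nd.
pose c := clamp 0 (arc_length b).
have cI l : 0 <= c l <= arc_length b by exact: clampP.
have hc l : {t | a <= t <= b /\ arc_length t = c l}.
  apply: cid; have /andP[c0 c1] := cI l.
  by have [t tab tl] := arc_length_surj c0 c1; exists t.
pose h l := g (projT1 (hc l)).
have same s t : a <= s <= b -> a <= t <= b ->
    d (g s) (g t) <= `|arc_length s - arc_length t|.
  move=> /andP[as' sb] /andP[at' tb]; case: (leP s t) => [st|/ltW ts].
    by rewrite distrC; apply: le_trans (ler_norm _); exact: arc_length_dist.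
  rewrite (dist_sym dM); apply: le_trans (ler_norm _); exact: arc_length_dist.
(* The chosen parameter may differ from t, but both have the same arc length, so g takes the same
   value at both. *)
have hg t : a <= t -> t <= b -> h (arc_length t) = g t.
  move=> at' tb; rewrite /h; case: (hc _) => s [sab sl] /=.
  apply/(dist0P dM)/eqP; rewrite eq_le dge0 andbT.
  apply: le_trans (same _ _ sab _) _; first by rewrite at'.
  by rewrite sl /c clampE ?arc_length_nd ?subrr ?normr0 // -arc_length_start arc_length_nd.
exists h; split=> // [u v||]; last 2 first.
- by rewrite -arc_length_start hg.
- exact: hg.
rewrite /h; case: (hc u) => s [sab sl]; case: (hc v) => t [tab tl] /=.
by apply: le_trans (same _ _ sab tab) _; rewrite sl tl; exact: clamp_lipschitz.
Qed.

End Rectifiable.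

End CurveLength.

(** * Exponentials, Lipschitz curves and the conformal length *)

Section Exponential.
Context {R : realType} (alpha : R).
Hypothesis alpha_gt1 : 1 < alpha.
Implicit Types s t : R.

Local Notation E t := (alpha `^ t).

Lemma exp_gt0 t : 0 < E t.
Proof. by apply: powR_gt0; apply: lt_trans alpha_gt1. Qed.

Lemma exp_ge0 t : 0 <= E t. Proof. exact/ltW/exp_gt0. Qed.

Lemma expD s t : E (s + t) = E s * E t.
Proof.
by rewrite powRD //; apply/implyP => _; rewrite gt_eqF // (lt_trans _ alpha_gt1).
Qed.

Lemma exp0 : E 0 = 1. Proof. exact: powRr0. Qed.

Lemma exp_le s t : s <= t -> E s <= E t.
Proof. by apply: ler_powR; exact: ltW. Qed.

Lemma exp_leE s t : (E s <= E t) = (s <= t).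
Proof.
apply/idP/idP; last exact: exp_le.
apply: contraTT; rewrite -!ltNge => ts.
rewrite (_ : s = t + (s - t)); last by ring.
rewrite expD ltr_pMr ?exp_gt0 // /powR gt_eqF ?(lt_trans _ alpha_gt1) //.
by rewrite expR_gt1 mulr_gt0 ?subr_gt0 // ln_gt0.
Qed.

Lemma exp_lt s t : (E s < E t) = (s < t).
Proof. by rewrite !ltNge exp_leE. Qed.

Lemma exp_ge1 t : 0 <= t -> 1 <= E t.
Proof. by rewrite -exp0; exact: exp_le. Qed.

Lemma expN t : E (- t) = (E t)^-1. Proof. exact: powRN. Qed.

Lemma expB s t : E (s - t) = E s / E t. Proof. by rewrite expD expN. Qed.

Lemma expM_N t : E t * E (- t) = 1.
Proof. by rewrite -expD subrr exp0. Qed.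

Lemma exp1 : E 1 = alpha.
Proof. by rewrite powRr1 // ltW // (lt_trans _ alpha_gt1). Qed.

Lemma ln_alpha_gt0 : 0 < ln alpha. Proof. exact: ln_gt0. Qed.

Lemma exp_expR t : E t = expR (t * ln alpha).
Proof. by rewrite /powR gt_eqF // (lt_trans _ alpha_gt1). Qed.

Lemma exp_convex s t : ln alpha * E s * (t - s) <= E t - E s.
Proof.
rewrite (_ : E t = E s * E (t - s)); last by rewrite -expD addrC subrK.
have h := expR_ge1Dx ((t - s) * ln alpha).
rewrite -exp_expR in h; have := ler_wpM2l (exp_ge0 s) h; lra.
Qed.

Lemma exp_small (e : R) : 0 < e -> exists2 r, 0 < r & forall t, t <= r -> E t <= 1 + e.
Proof.
move=> e0; exists (ln (1 + e) / ln alpha).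
  by rewrite divr_gt0 ?ln_gt0 // ltrDl.
move=> t tr; rewrite -[1 + e]lnK; last by rewrite posrE addr_gt0.
by rewrite exp_expR ler_expR -ler_pdivlMr ?ln_alpha_gt0.
Qed.

Lemma exp_log x : 0 < x -> E (ln x / ln alpha) = x.
Proof.
by move=> x0; rewrite exp_expR divfK ?gt_eqF ?ln_alpha_gt0 // lnK.
Qed.

Lemma exp_int (n : int) : E n%:~R = alpha ^ n.
Proof. by rewrite powR_intmul // ltW // (lt_trans _ alpha_gt1). Qed.

(** A relation that is transitive along the interval and holds at scale r holds globally, by
    induction on the number of steps of length r. This serves as the partition argument
    throughout. *)
Lemma local_to_global (P : R -> R -> Prop) (a b r : R) : 0 < r -> a <= b ->
  (forall s t, a <= s -> s <= t -> t <= b -> t - s <= r -> P s t) ->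
  (forall s t u, a <= s -> s <= t -> t <= u -> u <= b -> P s t -> P t u -> P s u) ->
  P a b.
Proof.
move=> r0 ab loc tr.
suff h n s : a <= s -> s <= b -> b - s <= r * n%:R -> P s b.
  apply: (h (Num.bound ((b - a) / r)) a (lexx a) ab).
  rewrite mulrC -ler_pdivrMr //; apply/ltW/archi_boundP.
  by rewrite divr_ge0 ?subr_ge0 // ltW.
elim: n s => [|n IH] s as' sb.
  rewrite mulr0 => h; apply: loc => //; exact: le_trans h (ltW r0).
move=> h; case: (leP (b - s) r) => hr; first exact: loc.
have srb : s + r <= b by lra.
have ssr : s <= s + r by lra.
apply: (tr s (s + r) b) => //; first by apply: loc => //; lra.
apply: IH => //; first exact: le_trans as' ssr.
by move: h; rewrite -natr1 mulrDr mulr1; lra.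
Qed.

(** The local comparison factor E (4 (t - s)) tends to 1 with the step, so subdivision leaves
    exactly the constant K. The 4 is generous: the uses below combine at most three Harnack
    factors. *)
Lemma compare_additive (G H : R -> R -> R) (a b K : R) : 0 <= K -> a <= b ->
  (forall s t u, a <= s -> s <= t -> t <= u -> u <= b -> G s u <= G s t + G t u) ->
  (forall s t u, a <= s -> s <= t -> t <= u -> u <= b -> H s t + H t u <= H s u) ->
  (forall s t, a <= s -> s <= t -> t <= b -> t - s <= 1 ->
    0 <= H s t /\ G s t <= K * E (4 * (t - s)) * H s t) ->
  G a b <= K * H a b.
Proof.
move=> K0 ab Ga Ha loc.
have H0 : 0 <= H a b.
  apply: (@local_to_global (fun s t => 0 <= H s t) a b 1) => //.
    by move=> s t *; have [] := loc s t.
  move=> s t u as' st tu ub h1 h2.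
  exact: le_trans (addr_ge0 h1 h2) (Ha _ _ _ as' st tu ub).
apply/ler_addgt0Pr => e e0.
have e'0 : 0 < e / (K * H a b + 1) by rewrite divr_gt0 // ltr_wpDl // mulr_ge0.
have [r r0 rP] := exp_small e'0.
have r'0 : 0 < Num.min 1 (r / 4) by rewrite lt_min ltr01 divr_gt0.
(* Chosen so that K c H exceeds K H by at most e; the added 1 keeps the denominator positive. *)
pose c := 1 + e / (K * H a b + 1).
apply: (@le_trans _ _ (K * c * H a b)).
  apply: (@local_to_global (fun s t => G s t <= K * c * H s t) a b _ r'0 ab).
    move=> s t as' st tb; rewrite le_min => /andP[h1 h2].
    have [hH hG] := loc s t as' st tb h1; apply: le_trans hG _.
    apply: ler_wpM2r => //; apply: ler_wpM2l => //; apply: rP; lra.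
  move=> s t u as' st tu ub h1 h2.
  apply: le_trans (Ga _ _ _ as' st tu ub) _.
  have k0 : 0 <= K * c by rewrite mulr_ge0 // addr_ge0 // ltW.
  have := ler_wpM2l k0 (Ha _ _ _ as' st tu ub); rewrite mulrDr; lra.
rewrite /c mulrDr mulr1 mulrDl lerD2l.
have h1 : 0 < K * H a b + 1 by rewrite ltr_wpDl // mulr_ge0.
have -> : K * (e / (K * H a b + 1)) * H a b = e * (K * H a b / (K * H a b + 1)).
  by field; rewrite gt_eqF.
by rewrite ger_pMr // ler_pdivrMr // mul1r lerDl.
Qed.

End Exponential.

Section Lipschitz.
Context {R : realType} {T : Type} (d : T -> T -> R).
Hypothesis dM : is_metric_on setT d.
Implicit Types (g : R -> T).

Definition lipschitz1 g := forall u v, d (g u) (g v) <= `|u - v|.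

Lemma lipschitz1_le g : (forall u v, u <= v -> d (g u) (g v) <= v - u) ->
  lipschitz1 g.
Proof.
move=> h u v; case: (leP u v) => [uv|/ltW vu].
  by rewrite distrC ger0_norm ?subr_ge0 //; exact: h.
by rewrite (dist_sym dM) ger0_norm ?subr_ge0 //; exact: h.
Qed.

Lemma lipschitz1_concat g1 g2 (l : R) : lipschitz1 g1 -> lipschitz1 g2 ->
  g1 l = g2 0 -> exists g, [/\ lipschitz1 g, forall u, u <= l -> g u = g1 u &
    forall u, l <= u -> g u = g2 (u - l)].
Proof.
move=> g1l g2l g12; pose g u := if u <= l then g1 u else g2 (u - l).
have gE u : l <= u -> g u = g2 (u - l).
  rewrite /g; case: (leP u l) => // h1 h2.
  by rewrite (_ : u = l) ?subrr //; apply/eqP; rewrite eq_le h1.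
exists g; split=> // [|u ul]; last by rewrite /g ul.
apply: lipschitz1_le => u v uv; case: (leP v l) => vl.
  rewrite /g vl (le_trans uv vl); apply: le_trans (g1l _ _) _.
  by rewrite distrC ger0_norm // subr_ge0.
case: (leP u l) => ul; last first.
  rewrite (gE u (ltW ul)) (gE v (ltW vl)); apply: le_trans (g2l _ _) _.
  by rewrite opprB addrA subrK distrC ger0_norm // subr_ge0.
rewrite (gE v (ltW vl)) {1}/g ul; apply: le_trans (dist_tri dM (g1 l) _ _) _.
have h1 : d (g1 u) (g1 l) <= l - u.
  by apply: le_trans (g1l _ _) _; rewrite distrC ger0_norm // subr_ge0.
have h2 : d (g1 l) (g2 (v - l)) <= v - l.
  rewrite g12; apply: le_trans (g2l _ _) _.
  by rewrite sub0r normrN ger0_norm // subr_ge0 ltW.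
by have := lerD h1 h2; lra.
Qed.

End Lipschitz.

(** * The conformal length as an integral along 1-Lipschitz curves *)

Section ConformalLength.
Context {R : realType} {T : Type} (d : T -> T -> R) (alpha : R) (rho : T -> R).
Hypotheses (dM : is_metric_on setT d) (alpha_gt1 : 1 < alpha).
Hypotheses (rho_gt0 : forall x, 0 < rho x)
  (rho_harnack : forall x y, rho x <= alpha `^ (d x y) * rho y).
Implicit Types (g : R -> T).

Local Notation E t := (alpha `^ t).

Local Notation lipschitz1 := (lipschitz1 d).

Definition rho_int g (s t : R) : R :=
  \int[lebesgue_measure]_(u in `[s, t]) rho (g u).

Lemma rho_le g s t : lipschitz1 g -> rho (g s) <= E `|s - t| * rho (g t).
Proof.
move=> gl; apply: le_trans (rho_harnack _ (g t)) _.
by rewrite ler_pM2r //; apply: exp_le.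
Qed.

Lemma rho_continuous g : lipschitz1 g -> continuous (fun t => rho (g t)).
Proof.
move=> gl t; apply/cvgrPdist_le => e e0.
have e'0 : 0 < e / rho (g t) by rewrite divr_gt0.
have [r r0 rP] := exp_small alpha_gt1 e'0.
near=> s.
have st : `|t - s| <= r.
  by near: s; apply/nbhs_ballP; exists r => //= s /ltW.
have h1 := rho_le s t gl; have h2 := rho_le t s gl.
have h3 := rP _ st; have k0 := exp_gt0 alpha_gt1 `|t - s|.
rewrite distrC in h1; set k := E _ in h1 h2 h3 k0.
have h4 : (k - 1) * rho (g t) <= e.
  by rewrite -ler_pdivlMr // lerBlDl.
have k1 : 1 <= k by rewrite /k exp_ge1.
have h5 : 0 < rho (g t) := rho_gt0 _.
rewrite mulrBl mul1r in h4.
rewrite ler_norml; apply/andP; split; first by lra.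
have [h6|h6] := leP (rho (g t)) (rho (g s)); first by lra.
have := ler_wpM2l (_ : 0 <= k - 1) (ltW h6); rewrite subr_ge0 => /(_ k1).
rewrite !mulrBl !mul1r; lra.
Unshelve. all: by end_near.
Qed.

Lemma rho_integrable g s t : lipschitz1 g ->
  lebesgue_measure.-integrable `[s, t] (EFin \o (fun u => rho (g u))).
Proof.
move=> gl; apply: continuous_compact_integrable; first exact: segment_compact.
by apply: continuous_subspaceT => u; exact: rho_continuous.
Qed.

Lemma integral_rho g s t : lipschitz1 g ->
  (\int[lebesgue_measure]_(u in `[s, t]) (rho (g u))%:E = (rho_int g s t)%:E)%E.
Proof.
by move=> gl; rewrite /rho_int /Rintegral fineK // integrable_fin_num // rho_integrable.
Qed.

Lemma rho_int_ge0 g s t : 0 <= rho_int g s t.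
Proof. by apply: Rintegral_ge0 => u _; exact: ltW. Qed.

Lemma rho_intD g s t u : lipschitz1 g -> s <= t -> t <= u ->
  rho_int g s u = rho_int g s t + rho_int g t u.
Proof.
move=> gl st tu; rewrite /rho_int.
have := @Rintegral_itvB R (fun u => rho (g u)) (BLeft s) (BRight u) t
  (rho_integrable s u gl).
rewrite !bnd_simp => /(_ st tu) h.
rewrite Rintegral_itv_obnd_cbnd in h; last first.
  apply: integrableS (rho_integrable t u gl) => //.
  by move=> x /=; rewrite !in_itv /= => /andP[/ltW -> ->].
by rewrite -h addrC subrK.
Qed.

Lemma rho_int_bounds g s t m M : lipschitz1 g -> s <= t ->
  (forall u, s <= u -> u <= t -> m <= rho (g u) <= M) ->
  m * (t - s) <= rho_int g s t <= M * (t - s).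
Proof.
move=> gl st h.
have cstE c : c * (t - s) = \int[lebesgue_measure]_(u in `[s, t]) c.
  rewrite Rintegral_cst //= lebesgue_measure_itv /= lte_fin.
  by case: ltP => [//|ts] /=; rewrite (_ : t = s) ?subrr //; apply/eqP; rewrite eq_le st ts.
have int c : lebesgue_measure.-integrable `[s, t] (EFin \o (fun=> c : R)).
  apply: continuous_compact_integrable; first exact: segment_compact.
  by apply: continuous_subspaceT => u; exact: cvg_cst.
rewrite !cstE; apply/andP; split; apply: le_Rintegral => //;
  try exact: rho_integrable;
  by move=> u /=; rewrite in_itv /= => /andP[su ut]; have /andP[] := h u su ut.
Qed.

(** By Harnack [rho] stays within a factor E (t - s) of its initial value. Together with
    [rho_int_ub] this determines the integral up to a factor tending to 1 with the step. *)
Lemma rho_int_lb g s t : lipschitz1 g -> s <= t ->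
  rho (g s) * (t - s) <= E (t - s) * rho_int g s t.
Proof.
move=> gl st.
have := @rho_int_bounds g s t (E (- (t - s)) * rho (g s)) (E (t - s) * rho (g s))
  gl st.
case/(_ _)/andP; last first.
  move=> h _; have := ler_wpM2l (exp_ge0 alpha_gt1 (t - s)) h.
  by rewrite !mulrA (expM_N alpha_gt1) mul1r.
move=> u su ut.
have us : `|u - s| <= t - s by rewrite ger0_norm ?subr_ge0 // lerD2r.
apply/andP; split; last first.
  apply: le_trans (rho_le u s gl) _; rewrite ler_pM2r //; exact: exp_le.
rewrite expN -ler_pdivlMl ?invr_gt0 ?exp_gt0 // invrK.
apply: le_trans (rho_le s u gl) _; rewrite ler_pM2r //; apply: exp_le => //.
by rewrite distrC.
Qed.

Lemma rho_int_ub g s t : lipschitz1 g -> s <= t ->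
  rho_int g s t <= E (t - s) * rho (g s) * (t - s).
Proof.
move=> gl st; have := @rho_int_bounds g s t 0 (E (t - s) * rho (g s)) gl st.
case/(_ _)/andP => // u su ut; rewrite ltW //=.
apply: le_trans (rho_le u s gl) _; rewrite ler_pM2r //; apply: exp_le => //.
by rewrite ger0_norm ?subr_ge0 // lerD2r.
Qed.

(** Whatever parameter [arc_param] selects, g takes there the value of h at the given length, so any
    h through which g factors by arc length computes [rho_length]. *)
Lemma rho_lengthE g (a b : R) h : a <= b -> curve d `[a, b] g ->
  (curve_length d g `[a, b] < +oo)%E -> lipschitz1 h ->
  (forall t, a <= t -> t <= b -> h (arc_length d g a t) = g t) ->
  rho_length d rho g a b = (rho_int h 0 (arc_length d g a b))%:E.
Proof.
move=> ab gc gf hl hg; rewrite /rho_length gf -integral_rho //.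
rewrite -/(arc_length d g a b); apply: eq_integral => l.
rewrite inE /= in_itv /= => /andP[l0 lL]; congr ((rho _)%:E).
rewrite /arc_param; case: xgetP => [t _ [/andP[at' tb] tl]|].
  by rewrite -hg // /arc_length tl.
have [t tab tl] := arc_length_surj dM ab gc gf l0 lL.
have /andP[at' tb] := tab.
move=> /(_ t); case; split=> //.
by rewrite (arc_lengthE gf) ?tl.
Qed.

Lemma rho_length_trace g (a b : R) : a <= b -> curve d `[a, b] g ->
  (curve_length d g `[a, b] < +oo)%E -> exists h l,
  [/\ 0 <= l, lipschitz1 h, h 0 = g a, h l = g b &
      rho_length d rho g a b = (rho_int h 0 l)%:E].
Proof.
move=> ab gc gf; have [h [hl h0 hL hg]] := arc_length_trace dM ab gc gf.
exists h, (arc_length d g a b); split=> //; last exact: rho_lengthE.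
by rewrite fine_ge0 ?curve_length_ge0.
Qed.

(** A 1-Lipschitz parametrization is at most of unit speed, so it overestimates the integral over
    arc length. The two integrals are compared over [s, t] and its image under arc length by
    [compare_additive]. *)
Lemma rho_length_lipschitz g (l : R) : 0 <= l -> lipschitz1 g ->
  (rho_length d rho g 0 l <= (rho_int g 0 l)%:E)%E.
Proof.
move=> l0 gl; have gc := lipschitz_curve dM l0 gl.
have len s t : 0 <= s -> s <= t -> t <= l -> (curve_length d g `[s, t] <= (t - s)%:E)%E.
  move=> s0 st tl; apply: (@curve_length_potential _ _ _ dM g id) => //.
  move=> u v su uv vt; apply: le_trans (gl _ _) _.
  by rewrite distrC ger0_norm // subr_ge0.
have gf : (curve_length d g `[0%R, l] < +oo)%E.
  by apply: le_lt_trans (len 0 l _ _ _) _; rewrite ?ltry.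
have [h [hl h0 hL hg]] := arc_length_trace dM l0 gc gf.
rewrite (rho_lengthE l0 gc gf hl hg) lee_fin.
pose A t := arc_length d g 0 t.
have A_nd s t : 0 <= s -> s <= t -> t <= l -> A s <= A t.
  by move=> *; exact: (arc_length_nd dM gf).
have A_len s t : 0 <= s -> s <= t -> t <= l -> A t - A s <= t - s.
  move=> s0 st tl; rewrite -lee_fin -(curve_length_arc dM gf) //; exact: len.
have A0 : A 0 = 0 by exact: (arc_length_start dM l0 gf).
rewrite -{1}A0 -/(A l) -[leRHS]mul1r.
apply: (compare_additive alpha_gt1 (G := fun s t => rho_int h (A s) (A t))) => //.
- move=> s t u s0 st tu ul.
  have h1 := A_nd _ _ s0 st (le_trans tu ul).
  have h2 := A_nd _ _ (le_trans s0 st) tu ul.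
  by rewrite (rho_intD hl h1 h2).
- by move=> s t u s0 st tu ul; rewrite -rho_intD.
move=> s t s0 st tl _; split; first exact: rho_int_ge0.
have sl := le_trans st tl; have ast := A_nd _ _ s0 st tl; have lst := A_len _ _ s0 st tl.
apply: le_trans (rho_int_ub hl ast) _; rewrite hg // mul1r.
apply: (@le_trans _ _ (E (t - s) * (rho (g s) * (t - s)))).
  rewrite -mulrA; apply: ler_pM; rewrite ?exp_ge0 //.
  - by rewrite mulr_ge0 ?subr_ge0 // ltW.
  - exact: exp_le.
  - by rewrite ler_pM2l.
apply: (@le_trans _ _ (E (t - s) * (E (t - s) * rho_int g s t))).
  by rewrite ler_pM2l ?exp_gt0 //; exact: rho_int_lb.
rewrite mulrA -expD //; apply: ler_wpM2r; first exact: rho_int_ge0.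
by apply: exp_le => //; lra.
Qed.

End ConformalLength.

(** * The conformal distance *)

Section ConformalDistance.
Context {R : realType} {T : Type} (d : T -> T -> R) (alpha : R) (rho : T -> R).
Hypotheses (dM : is_metric_on setT d) (alpha_gt1 : 1 < alpha).
Hypotheses (rho_gt0 : forall x, 0 < rho x)
  (rho_harnack : forall x y, rho x <= alpha `^ (d x y) * rho y).
Hypothesis d_length : forall x y (e : R), 0 < e -> exists (g : R -> T) (l : R),
  [/\ 0 <= l, lipschitz1 d g, g 0 = x, g l = y & l <= d x y + e].
Implicit Types (g : R -> T).

Local Notation E t := (alpha `^ t).
Local Notation J := (rho_int rho).
Local Notation dr := (rho_dist d rho).

Let rho_lengths x y := [set l | exists a b g,
    [/\ a <= b, curve d `[a, b] g, g a = x, g b = y &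
        l = rho_length d rho g a b]].

Lemma rho_length_ge0 g (a b : R) : (0 <= rho_length d rho g a b)%E.
Proof.
rewrite /rho_length; case: ifP => // _; apply: integral_ge0 => l _.
by rewrite lee_fin ltW.
Qed.

Let inf_ge0 x y : (0 <= ereal_inf (rho_lengths x y))%E.
Proof.
apply: le_ereal_inf_tmp => _ [a [b [g [_ _ _ _ ->]]]].
exact: rho_length_ge0.
Qed.

Let inf_le g (l : R) : 0 <= l -> lipschitz1 d g ->
  (ereal_inf (rho_lengths (g 0%R) (g l)) <= (J g 0%R l)%:E)%E.
Proof.
move=> l0 gl; apply: le_trans (rho_length_lipschitz dM alpha_gt1 rho_gt0 rho_harnack l0 gl).
apply: ereal_inf_lbound; exists 0, l, g; split=> //.
exact: (lipschitz_curve dM).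
Qed.

(** [rho_dist] applies [fine], which would turn an infinite infimum into 0; curves of finite length
    exclude this. *)
Let inf_fin x y : ereal_inf (rho_lengths x y) \is a fin_num.
Proof.
have [g [l [l0 gl <- <- _]]] := d_length x y ltr01.
rewrite ge0_fin_numE ?inf_ge0 //; apply: le_lt_trans (inf_le l0 gl) _.
exact: ltry.
Qed.

Lemma rho_dist_le g (l : R) : 0 <= l -> lipschitz1 d g -> dr (g 0) (g l) <= J g 0 l.
Proof.
by move=> l0 gl; rewrite -lee_fin [leLHS]fineK ?inf_fin //; exact: inf_le.
Qed.

Lemma rho_dist_approx x y (e : R) : 0 < e -> exists g l,
  [/\ 0 <= l, lipschitz1 d g, g 0 = x, g l = y & J g 0 l < dr x y + e].
Proof.
move=> e0; have [_ [a [b [g [ab gc <- <- ->]]]]] :=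
  lb_ereal_inf_adherent e0 (inf_fin x y).
rewrite -[ereal_inf _]fineK ?inf_fin // -EFinD => h.
have gf : (curve_length d g `[a, b] < +oo)%E.
  by move: h; rewrite /rho_length; case: ifP => // _; rewrite ltNge leey.
have [k [l [l0 kl k0 kb kE]]] :=
  rho_length_trace dM alpha_gt1 rho_gt0 rho_harnack ab gc gf.
by exists k, l; split=> //; move: h; rewrite kE lte_fin.
Qed.

Lemma rho_dist_ge0 x y : 0 <= dr x y.
Proof. exact/fine_ge0/inf_ge0. Qed.

(** The source of lower bounds on d_rho: the variation of F is integrated along a nearly optimal
    curve in steps of length at most 1, and alpha is the Harnack loss of such a step. *)
Lemma rho_dist_lipschitz (F : T -> R) C : 0 <= C ->
  (forall y z, d y z <= 1 -> `|F y - F z| <= C * rho y * d y z) ->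
  forall x y, `|F x - F y| <= C * alpha * dr x y.
Proof.
move=> C0 FC x y.
have Ca : 0 <= C * alpha by rewrite mulr_ge0 // ltW // (lt_trans _ alpha_gt1).
apply/ler_addgt0Pr => e e0.
have e'0 : 0 < e / (C * alpha + 1) by rewrite divr_gt0 // ltr_wpDl.
have [g [l [l0 gl <- <- h]]] := rho_dist_approx x y e'0.
apply: (@le_trans _ _ (C * alpha * J g 0 l)); last first.
  apply: le_trans (ler_wpM2l Ca (ltW h)) _; rewrite mulrDr lerD2l mulrCA.
  by rewrite ger_pMr // ler_pdivrMr ?ltr_wpDl // mul1r lerDl.
apply: (@local_to_global _ (fun s t => `|F (g s) - F (g t)| <= C * alpha * J g s t)
  0 l 1) => //.
  move=> s t s0 st tl st1.
  have gst : d (g s) (g t) <= t - s.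
    by apply: le_trans (gl _ _) _; rewrite distrC ger0_norm // subr_ge0.
  apply: le_trans (FC _ _ (le_trans gst st1)) _; rewrite -!mulrA.
  apply: ler_wpM2l => //.
  apply: (@le_trans _ _ (rho (g s) * (t - s))); first by rewrite ler_pM2l.
  apply: le_trans (rho_int_lb alpha_gt1 rho_gt0 rho_harnack gl st) _.
  apply: ler_wpM2r; first exact: rho_int_ge0.
  by rewrite -[leRHS](exp1 alpha_gt1); exact: exp_le.
move=> s t u s0 st tu ul h1 h2.
rewrite (rho_intD alpha_gt1 rho_gt0 rho_harnack gl st tu) mulrDr.
rewrite (_ : _ - _ = (F (g s) - F (g t)) + (F (g t) - F (g u))); last by ring.
exact: le_trans (ler_normD _ _) (lerD h1 h2).
Qed.

(** The distance to x, truncated at 1 and multiplied by [rho x], serves as test function. In E 3, a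
    factor E 2 compares [rho x] with [rho] within distance 2, and alpha is lost in
    [rho_dist_lipschitz]. *)
Lemma rho_dist_ge x y : rho x * Num.min 1 (d x y) <= E 3 * dr x y.
Proof.
have r0 := rho_gt0 x.
pose F z := rho x * Num.min 1 (d x z).
have -> : rho x * Num.min 1 (d x y) = `|F x - F y|.
  rewrite /F (distxx dM) (min_r ler01) mulr0 sub0r normrN ger0_norm //.
  by apply: mulr_ge0; [exact: ltW|rewrite le_min ler01 (dist_ge0 dM)].
rewrite (_ : E 3 = E 2 * alpha); last first.
  by rewrite -[X in _ * X](exp1 alpha_gt1) -expD //; congr (_ `^ _); ring.
apply: rho_dist_lipschitz => [|{}y z yz]; first exact: exp_ge0.
rewrite /F -mulrBr normrM (gtr0_norm r0).
have h1 := dist_tri dM y x z; have h2 := dist_tri dM z x y.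
rewrite (dist_sym dM z y) in h2.
have d0 := dist_ge0 dM y z.
(* Beyond distance 2 a step of length at most 1 stays where the truncation is constant. *)
have [xy2|xy2] := leP (d x y) 2.
  apply: ler_pM => //; first exact: ltW.
    apply: le_trans (rho_harnack x y) _; rewrite ler_pM2r //; exact: exp_le.
  rewrite ler_norml; case: (leP 1 (d x y)) => h3; case: (leP 1 (d x z)) => h4;
  by apply/andP; split; lra.
rewrite !min_l ?subrr ?normr0 ?mulr0 ?mulr_ge0 ?exp_ge0 //; try exact: ltW; lra.
Qed.

Lemma rho_dist_curve g s t : lipschitz1 d g -> s <= t ->
  dr (g s) (g t) <= E (t - s) * rho (g s) * (t - s).
Proof.
move=> gl st; pose h u := g (s + u).
have hl : lipschitz1 d h.
  by move=> u v; apply: le_trans (gl _ _) _; rewrite opprD addrACA subrr add0r.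
have ts : 0 <= t - s by rewrite subr_ge0.
have := rho_dist_le ts hl; rewrite /h addr0 addrC subrK => /le_trans; apply.
have := rho_int_ub alpha_gt1 rho_gt0 rho_harnack hl ts.
by rewrite subr0 /h addr0.
Qed.

Lemma rho_dist_near x y : d x y <= 1 -> dr x y <= 2 * E 2 * rho x * d x y.
Proof.
move=> xy1; have [/(dist0P dM) <-|xy] := eqVneq (d x y) 0.
  have [g [l [l0 gl g0 _ _]]] := d_length x x ltr01.
  have := rho_dist_curve gl (lexx 0).
  by rewrite (distxx dM) subrr !mulr0 g0.
have xy0 : 0 < d x y by rewrite lt_neqAle eq_sym xy (dist_ge0 dM).
(* Allowing the excess d x y gives a curve of length at most 2 d x y, hence at most 2; the case of
   distance 0 had to be separated for this. *)
have [g [l [l0 gl g0 gE le]]] := d_length x y xy0.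
have := rho_dist_curve gl l0; rewrite g0 gE subr0 => /le_trans; apply.
have r0 := rho_gt0 x.
apply: (@le_trans _ _ (E 2 * rho x * (2 * d x y))); last by lra.
apply: ler_pM => //; first by rewrite mulr_ge0 ?exp_ge0 // ltW.
  by rewrite ler_pM2r //; apply: exp_le => //; lra.
by lra.
Qed.

Let rho_intD' g s t u : lipschitz1 d g -> s <= t -> t <= u ->
  J g s u = J g s t + J g t u.
Proof. by move=> gl; exact: (rho_intD alpha_gt1 rho_gt0 rho_harnack gl). Qed.

(** Gives the symmetry of d_rho. On a short step reversal only exchanges the endpoint at which [rho]
    is evaluated, which costs three Harnack factors. *)
Lemma rho_int_reverse g (l : R) : 0 <= l -> lipschitz1 d g ->
  J (fun u => g (l - u)) 0 l <= J g 0 l.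
Proof.
move=> l0 gl; set h := fun u => _.
have hl : lipschitz1 d h.
  move=> u v; apply: le_trans (gl _ _) _.
  by rewrite opprB addrC addrA subrK distrC.
(* Puts the reversed integral in the form required of G, the reflected interval of [s, t] being
   [l - t, l - s]. *)
rewrite (_ : J h 0 l = J h (l - l) (l - 0)); last by rewrite subrr subr0.
rewrite -[leRHS]mul1r.
apply: (@compare_additive _ _ alpha_gt1 (fun s t => J h (l - t) (l - s)) (J g) 0 l 1
  ler01 l0).
- move=> s t u s0 st tu ul.
  by rewrite (@rho_intD' h (l - u) (l - t) (l - s)) ?lerD2l ?lerN2 // [leLHS]addrC.
- by move=> s t u *; rewrite -rho_intD'.
move=> s t s0 st tl st1; split; first exact: rho_int_ge0.
have hst : l - t <= l - s by lra.
apply: le_trans (rho_int_ub alpha_gt1 rho_gt0 rho_harnack hl hst) _.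
rewrite /h subKr (_ : l - s - (l - t) = t - s); last by ring.
rewrite mul1r; have ts0 : 0 <= t - s by lra.
apply: (@le_trans _ _ (E (t - s) * E (t - s) * (rho (g s) * (t - s)))).
  rewrite -!mulrA ler_pM2l ?exp_gt0 // !mulrA; apply: ler_wpM2r => //.
  by have := rho_le alpha_gt1 rho_gt0 rho_harnack t s gl; rewrite ger0_norm.
apply: (@le_trans _ _ (E (t - s) * E (t - s) * (E (t - s) * J g s t))).
  by rewrite ler_pM2l ?mulr_gt0 ?exp_gt0 //; apply: (rho_int_lb alpha_gt1).
rewrite mulrA -!expD //; apply: ler_wpM2r; first exact: rho_int_ge0.
by apply: exp_le => //; lra.
Qed.

(** Gives the triangle inequality of d_rho. The second half of the glued curve is a translate of
    [g2], and its integral is again compared step by step. *)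
Lemma rho_int_concat g1 g2 (l1 l2 : R) : 0 <= l1 -> 0 <= l2 ->
  lipschitz1 d g1 -> lipschitz1 d g2 -> g1 l1 = g2 0 ->
  exists2 g, lipschitz1 d g &
   [/\ g 0 = g1 0, g (l1 + l2) = g2 l2 & J g 0 (l1 + l2) <= J g1 0 l1 + J g2 0 l2].
Proof.
move=> l10 l20 g1l g2l g12; have [g [gl gE1 gE]] := lipschitz1_concat dM g1l g2l g12.
exists g => //; split; first by rewrite gE1.
  by rewrite gE ?lerDl // addrC addKr.
rewrite (rho_intD' gl l10) ?lerDl //; apply: lerD.
  rewrite le_eqVlt; apply/orP; left; apply/eqP; apply: eq_Rintegral => u.
  by rewrite inE /= in_itv /= => /andP[_ ul]; rewrite gE1.
rewrite -{1}(addr0 l1) -[leRHS]mul1r.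
apply: (@compare_additive _ _ alpha_gt1 (fun s t => J g (l1 + s) (l1 + t)) (J g2)
  0 l2 1 ler01 l20).
- by move=> s t u s0 st tu ul; rewrite -rho_intD' // lerD2l.
- by move=> s t u *; rewrite -rho_intD'.
move=> s t s0 st tl st1; split; first exact: rho_int_ge0.
have hst : l1 + s <= l1 + t by rewrite lerD2l.
apply: le_trans (rho_int_ub alpha_gt1 rho_gt0 rho_harnack gl hst) _.
rewrite gE ?lerDl // (_ : l1 + s - l1 = s); last by ring.
rewrite (_ : l1 + t - (l1 + s) = t - s); last by ring.
have ts0 : 0 <= t - s by lra.
apply: (@le_trans _ _ (E (t - s) * (E (t - s) * J g2 s t))).
  rewrite -mulrA ler_pM2l ?exp_gt0 //; apply: (rho_int_lb alpha_gt1) => //.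
rewrite mul1r mulrA -!expD //; apply: ler_wpM2r; first exact: rho_int_ge0.
by apply: exp_le => //; lra.
Qed.

Lemma rho_dist_metric : is_metric_on setT dr.
Proof.
have sym x y : dr x y <= dr y x.
  apply/ler_addgt0Pr => e e0.
  have [g [l [l0 gl gx gy h]]] := rho_dist_approx y x e0.
  apply: le_trans (ltW h); apply: le_trans (rho_int_reverse l0 gl).
  rewrite -gx -gy -{1}(subr0 l) -{2}(subrr l).
  apply: (@rho_dist_le (fun u => g (l - u)) l l0) => u v.
  by apply: le_trans (gl _ _) _; rewrite opprB addrC addrA subrK distrC.
split.
- by move=> x y _ _; exact: rho_dist_ge0.
- move=> x y _ _; split=> [h|<-].
    have := rho_dist_ge x y; rewrite h mulr0 pmulr_rle0 // ge_min.
    rewrite lt_geF //= => hd; apply/(dist0P dM)/eqP.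
    by rewrite eq_le hd (dist_ge0 dM).
  apply/eqP; rewrite eq_le rho_dist_ge0 andbT.
  have := @rho_dist_near x x; rewrite (distxx dM) mulr0; exact.
- by move=> x y _ _; apply/eqP; rewrite eq_le !sym.
- move=> x y z _ _ _; apply/ler_addgt0Pr => e e0.
  have e20 : 0 < e / 2 by lra.
  have [g1 [l1 [l10 g1l g1x g1y h1]]] := rho_dist_approx x y e20.
  have [g2 [l2 [l20 g2l g2x g2y h2]]] := rho_dist_approx y z e20.
  have g12 : g1 l1 = g2 0 by rewrite g1y g2x.
  have [g gl [gx gz h]] := rho_int_concat l10 l20 g1l g2l g12.
  have := rho_dist_le (addr_ge0 l10 l20) gl; rewrite gx gz g1x g2y => h3.
  lra.
Qed.

End ConformalDistance.

(** * The graph and its path metric *)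

Section Graph.
Context {R : realType} {Z : metricType R} (alpha tau : R) (S : int -> set Z).

Local Notation X := (filling alpha tau S).
Local Notation d := (@path_dist R Z alpha tau S).
Local Notation path := (@pl_path R Z alpha tau S).
Local Notation edge := (edge alpha tau S).
Local Notation vertex := (vertex S).
Implicit Types (x y z : X) (u v w : Z * int) (f : Z * int -> R) (s t l : R).

(** Interpolation of a vertex function along the edges. Besides the height, it will be applied to
    the distance in Z from a fixed point to the centre of a vertex. *)
Definition linear_ext f x : R := \sum_(u \in [set: Z * int]) val x u * f u.

Lemma linear_ext_bary f x v w t : val x = bary v w t ->
  linear_ext f x = (1 - t) * f v + t * f w.
Proof.
move=> xE; rewrite /linear_ext xE; have [<-|vw] := eqVneq v w.
  rewrite (fsbigE [:: v]) //=; last first.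
    move=> u _; rewrite inE => uv; rewrite /bary (negbTE uv).
    by rewrite !mulr0 addr0 mul0r.
  by rewrite big_cons big_nil in_setT /bary eqxx !mulr1 subrK mul1r addr0 -mulrDl subrK mul1r.
rewrite (fsbigE [:: v; w]) //=; last 2 first.
- by rewrite inE vw.
- move=> u _; rewrite !inE negb_or => /andP[uv uw]; rewrite /bary.
  by rewrite (negbTE uv) (negbTE uw) !mulr0 addr0 mul0r.
rewrite !big_cons big_nil !in_setT addr0 /bary !eqxx (negbTE vw) eq_sym (negbTE vw).
by rewrite !mulr1 !mulr0 addr0 add0r.
Qed.

Lemma heightE x : height x = linear_ext (fun v => v.2%:~R) x.
Proof. by []. Qed.

Lemma filling_pt f : filling_points alpha tau S f -> exists x, val x = f.
Proof. by move=> h; exists (exist _ f (mem_set h)). Qed.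

Lemma fillingP x : exists v w t, [/\ (vertex v /\ v = w) \/ edge v w,
  0 <= t <= 1 & val x = bary v w t].
Proof. exact: (set_valP x). Qed.

Lemma edge_pt v w t : edge v w -> 0 <= t <= 1 -> exists x, val x = bary v w t.
Proof. by move=> vw t01; apply: filling_pt; exists v, w, t; split=> //; right. Qed.

Lemma vertex_pt v : vertex v -> exists x, val x = bary v v 0.
Proof.
by move=> vv; apply: filling_pt; exists v, v, 0; split; rewrite ?lexx ?ler01 //; left.
Qed.

Lemma bary0 v w w' : bary v w 0 = bary v w' 0 :> (_ -> R).
Proof. by apply/funext => u; rewrite /bary !mul0r. Qed.

Lemma bary1 v w : bary v w 1 = bary w w 0 :> (_ -> R).
Proof. by apply/funext => u; rewrite /bary subrr mul0r add0r subr0 mul0r addr0. Qed.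

Lemma bary_swap v w t : bary v w t = bary w v (1 - t) :> (_ -> R).
Proof. by apply/funext => u; rewrite /bary subKr addrC. Qed.

Lemma baryvv v t : bary v v t = bary v v 0 :> (_ -> R).
Proof. by apply/funext => u; rewrite /bary -mulrDl subrK subr0 mul0r addr0. Qed.

Lemma edge_sym v w : edge v w -> edge w v.
Proof.
move=> [vv ww vw h1 [p [p1 p2]]]; split=> //; first exact: nesym.
  by rewrite distrC.
by exists p.
Qed.

Lemma pl_path_ge0 x y l : path x y l -> 0 <= l.
Proof. by elim=> // *; exact: addr_ge0. Qed.

Lemma pl_path_cat x y z l l' : path x y l -> path y z l' -> path x z (l + l').
Proof.
elim=> [?|{}x y' {}y v w s t {}l vw s01 t01 xE yE _ IH] h; first by rewrite add0r.
by rewrite -addrA; exact: pl_cons vw s01 t01 xE yE (IH h).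
Qed.

Lemma pl_path_segment x y v w s t : edge v w -> 0 <= s <= 1 -> 0 <= t <= 1 ->
  val x = bary v w s -> val y = bary v w t -> path x y `|s - t|.
Proof.
by move=> vw s01 t01 xE yE; rewrite -[`|_|]addr0; exact: pl_cons vw s01 t01 xE yE (pl_nil _).
Qed.

Lemma pl_path_sym x y l : path x y l -> path y x l.
Proof.
elim=> [?|{}x y' {}y v w s t {}l vw s01 t01 xE yE _ IH]; first exact: pl_nil.
rewrite addrC; apply: pl_path_cat IH _; rewrite distrC.
exact: pl_path_segment vw t01 s01 yE xE.
Qed.

(** Bounding path lengths from below reduces to segments of single edges; used with differences of
    coordinates and of heights. *)
Lemma pl_path_le (D : X -> X -> R) x y l : (forall x, D x x <= 0) ->
  (forall x y z, D x z <= D x y + D y z) ->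
  (forall x y v w s t, edge v w -> 0 <= s <= 1 -> 0 <= t <= 1 ->
    val x = bary v w s -> val y = bary v w t -> D x y <= `|s - t|) ->
  path x y l -> D x y <= l.
Proof.
move=> D0 Dt De; elim=> [//|{}x y' {}y v w s t {}l vw s01 t01 xE yE _ IH].
by apply: le_trans (Dt _ y' _) _; apply: lerD => //; exact: De vw s01 t01 xE yE.
Qed.

(** The coordinates separate the points of X and locate them in stars of vertices; this makes
    [path_dist] a metric and later yields completeness. *)
Lemma pl_path_coord x y l u : path x y l -> `|val x u - val y u| <= l.
Proof.
apply: (pl_path_le (D := fun x y => `|val x u - val y u|)).
- by move=> *; rewrite subrr normr0.
- move=> a b c; rewrite -(subrKA (val b u)); exact: ler_normD.
move=> {}x {}y v w s t vw s01 t01 -> ->; rewrite /bary.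
rewrite (_ : _ - _ = (s - t) * ((u == w)%:R - (u == v)%:R)); last by ring.
rewrite normrM ler_piMr //.
by case: (_ == _); case: (_ == _); rewrite ?subrr ?subr0 ?sub0r ?normrN ?normr0 ?normr1.
Qed.

Lemma linear_ext_segment f x y v w s t : val x = bary v w s -> val y = bary v w t ->
  linear_ext f x - linear_ext f y = (s - t) * (f w - f v).
Proof. by move=> /(linear_ext_bary f) -> /(linear_ext_bary f) ->; ring. Qed.

Lemma pl_path_height x y l : path x y l -> `|height x - height y| <= l.
Proof.
apply: (pl_path_le (D := fun x y => `|height x - height y|)).
- by move=> *; rewrite subrr normr0.
- move=> a b c; rewrite -(subrKA (height b)); exact: ler_normD.
move=> {}x {}y v w s t [_ _ _ h _] s01 t01 xE yE.
rewrite !heightE (linear_ext_segment _ xE yE) normrM ler_piMr //.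
by rewrite -rmorphB /= -intr_norm distrC -[1]/(1%:~R) ler_int.
Qed.

Lemma edge_height v w : edge v w -> (v.2%:~R : R) <= w.2%:~R + 1.
Proof.
move=> [_ _ _]; rewrite ler_norml => /andP[_ h] _.
by rewrite -[1]/(1%:~R) -rmorphD /= ler_int -lerBlDl.
Qed.

(** * Connectedness, Lipschitz functions and completeness of the filling *)

Section Filling.
Hypotheses (alpha_gt1 : 1 < alpha) (tau_gt3 : 3 < tau).
Hypothesis S_max : forall n, maximal_separated (alpha ^ (- n)) (S n).

Local Notation E t := (alpha `^ t).

Lemma scaleE (n : int) : alpha ^ (- n) = E (- n%:~R).
Proof. by rewrite -exp_int // rmorphN. Qed.

(** Otherwise p could be added to the net, against maximality. *)
Lemma net_near (p : Z) n : exists2 q, S n q & mdist p q < E (- n%:~R).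
Proof.
have [sep max] := S_max n; rewrite scaleE in sep max.
apply: contrapT => h.
have far q : S n q -> E (- n%:~R) <= mdist p q.
  by move=> nq; rewrite leNgt; apply/negP => pq; apply: h; exists q.
have Sp : S n `|` [set p] = S n.
  apply: max => [a b|]; last exact: subsetUl.
  case=> [na|->] [nb|->] ab //; [exact: sep| |exact: far].
  by rewrite metric_sym; exact: far.
apply: h; exists p; last by rewrite mdistxx exp_gt0.
by rewrite -Sp; right.
Qed.

Lemma vertex_ballE v p : vertex_ball alpha tau v p <-> mdist v.1 p < tau * E (- v.2%:~R).
Proof. by rewrite /vertex_ball ballEmdist /= scaleE. Qed.

Lemma tau_gt0 : 0 < tau. Proof. by apply: lt_trans tau_gt3. Qed.

Lemma near_ball v p : mdist p v.1 < E (- v.2%:~R) -> vertex_ball alpha tau v p.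
Proof.
move=> h; apply/vertex_ballE; rewrite metric_sym; apply: lt_le_trans h _.
by rewrite ler_peMl ?exp_ge0 //; apply: ltW; apply: lt_trans tau_gt3; lra.
Qed.

Lemma pl_path_vertex v w x y : vertex v -> vertex w -> `|v.2 - w.2| <= 1 ->
  vertex_ball alpha tau v `&` vertex_ball alpha tau w !=set0 ->
  val x = bary v v 0 -> val y = bary w w 0 -> exists2 l, path x y l & l <= 1.
Proof.
move=> vv ww h1 h2 xE yE; have [vw|/eqP vw] := eqVneq v w.
  have -> : x = y by apply: val_inj; rewrite xE yE vw.
  by exists 0; [exact: pl_nil|exact: ler01].
have e : edge v w by split.
exists `|0 - 1 : R|; last by rewrite sub0r normrN normr1.
apply: (pl_path_segment e); rewrite ?lexx ?ler01 //.
  by rewrite xE; exact: bary0.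
by rewrite yE bary1.
Qed.

(** At each lower height a net point close to the fixed point p is chosen; all the balls contain p,
    so consecutive vertices are adjacent. *)
Lemma descend v x p (k : nat) : vertex v -> val x = bary v v 0 ->
  mdist p v.1 < E (- v.2%:~R) -> exists w y l,
  [/\ vertex w, val y = bary w w 0, mdist p w.1 < E (- w.2%:~R),
      w.2 = v.2 - k%:Z & path x y l /\ l <= k%:R].
Proof.
move=> vv xE vp; elim: k => [|k [w [y [l [ww yE wp wk [xy lk]]]]]].
  by exists v, x, 0; split; rewrite ?subr0 //; split=> //; exact: pl_nil.
have [q Sq pq] := net_near p (v.2 - k.+1%:Z).
pose w' : Z * int := (q, v.2 - k.+1%:Z).
have w'w' : vertex w' by [].
have [y' y'E] := vertex_pt w'w'.
have [||l' yy' l'1] := pl_path_vertex ww w'w' _ _ yE y'E.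
- by rewrite wk /= intS; lia.
- by exists p; split; exact: near_ball.
exists w', y', (l + l'); split=> //; split; first exact: pl_path_cat xy yy'.
by rewrite -natr1 lerD.
Qed.

Lemma nearest_vertex x : exists v p, [/\ vertex v, val p = bary v v 0 &
  exists2 l, path x p l & l <= 1 / 2].
Proof.
have [v [w [t [[[vv vw]|e] t01 xE]]]] := fillingP x.
  have [p pE] := vertex_pt vv; exists v, p; split=> //.
  exists 0; last by lra.
  suff -> : x = p by exact: pl_nil.
  by apply: val_inj; rewrite xE pE -vw baryvv.
have [vv ww _ _ _] := e; have /andP[t0 t1] := t01.
have [th|th] := leP t (1 / 2).
  have [p pE] := vertex_pt vv; exists v, p; split=> //; exists `|t - 0|.
    by apply: (pl_path_segment e); rewrite ?lexx ?ler01 // pE; exact: bary0.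
  by rewrite subr0 ger0_norm.
have [p pE] := vertex_pt ww; exists w, p; split=> //; exists `|t - 1|.
  by apply: (pl_path_segment e); rewrite ?lexx ?ler01 // pE bary1.
by rewrite distrC ger0_norm; lra.
Qed.

(** Descend from both vertices to a height k whose scale exceeds their distance in Z; there one more
    step joins the two descents, which is the final 1 in the bound. *)
Lemma pl_path_down v w x y (k : int) : vertex v -> vertex w ->
  val x = bary v v 0 -> val y = bary w w 0 -> k <= v.2 -> k <= w.2 ->
  mdist v.1 w.1 <= E (- k%:~R) ->
  exists2 l, path x y l & l <= v.2%:~R + w.2%:~R - 2 * k%:~R + 1.
Proof.
move=> vv ww xE yE kv kw vw.
have ctr u : mdist u.1 u.1 < E (- u.2%:~R) by rewrite mdistxx exp_gt0.
have [v' [x' [l [v'v' x'E v'p v'h [xx' lk]]]]] := descend `|v.2 - k| vv xE (ctr v).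
have [w' [y' [l' [w'w' y'E w'p w'h [yy' lk']]]]] := descend `|w.2 - k| ww yE (ctr w).
have abs (n : int) : k <= n -> n - `|n - k|%N%:Z = k by lia.
have absr (n : int) : k <= n -> `|n - k|%N%:R = n%:~R - k%:~R :> R.
  by move=> kn; rewrite -rmorphB /= -[in RHS](gez0_abs (_ : 0 <= n - k)) ?subr_ge0.
rewrite abs // in v'h; rewrite abs // in w'h; rewrite absr // in lk; rewrite absr // in lk'.
have [||l'' mid l''1] := pl_path_vertex v'v' w'w' _ _ x'E y'E.
- by rewrite v'h w'h subrr normr0.
(* The centre of w is within twice the scale of the descendant of v, and 2 is at most tau. *)
- exists w.1; split; last exact: near_ball.
  apply/vertex_ballE; rewrite v'h in v'p *.
  apply: le_lt_trans (metric_triangle _ v.1 _) _; rewrite metric_sym.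
  apply: lt_le_trans (ltr_leD v'p vw) _.
  rewrite -mulr2n -[_ *+ 2]mulr_natl ler_pM2r ?exp_gt0 //.
  by apply: ltW; apply: lt_trans tau_gt3; lra.
exists (l + (l'' + l')).
  exact: pl_path_cat xx' (pl_path_cat mid (pl_path_sym yy')).
by lra.
Qed.

Lemma pl_path_connected x y : exists l, path x y l.
Proof.
have [v [p [vv pE [l xp _]]]] := nearest_vertex x.
have [w [q [ww qE [l' yq _]]]] := nearest_vertex y.
have [t t0 tP] : exists2 k : int, k <= v.2 /\ k <= w.2 & mdist v.1 w.1 <= E (- k%:~R).
  (* The 1 makes m positive, so that its logarithm tells how far down to go. *)
  pose m := mdist v.1 w.1 + 1; have m0 : 0 < m by rewrite ltr_wpDl ?mdist_ge0.
  pose k := - (Num.bound `|ln m / ln alpha|)%:Z - `|v.2|%N%:Z - `|w.2|%N%:Z.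
  exists k; first by rewrite /k; lia.
  apply: (@le_trans _ _ m); first by rewrite lerDl.
  rewrite -{1}(exp_log alpha_gt1 m0); apply: exp_le => //.
  apply: (@le_trans _ _ (Num.bound `|ln m / ln alpha|)%:R).
    exact: le_trans (ler_norm _) (ltW (archi_boundP (normr_ge0 _))).
  rewrite [leLHS]pmulrn -rmorphN /= ler_int {}/k; move: (Num.bound _) => n; lia.
have [l'' pq _] := pl_path_down vv ww pE qE t0.1 t0.2 tP.
exists (l + (l'' + l')); apply: pl_path_cat xp (pl_path_cat pq _).
exact: pl_path_sym.
Qed.

Lemma path_dist_le x y l : path x y l -> d x y <= l.
Proof.
by move=> xy; apply: ge_inf => //; exists 0 => l' /pl_path_ge0.
Qed.

(** Uses connectedness, since the infimum of the empty set would be 0. *)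
Lemma le_path_dist x y (c : R) : (forall l, path x y l -> c <= l) -> c <= d x y.
Proof.
move=> h; apply: lb_le_inf; last by move=> l /h.
by have [l xy] := pl_path_connected x y; exists l.
Qed.

Lemma path_dist_approx x y (e : R) : 0 < e -> exists2 l, path x y l & l < d x y + e.
Proof.
move=> e0; have [|l xy h] := @inf_adherent _ [set l | path x y l] e e0.
  split; last by exists 0 => l /pl_path_ge0.
  by have [l xy] := pl_path_connected x y; exists l.
by exists l.
Qed.

Lemma path_dist_coord x y u : `|val x u - val y u| <= d x y.
Proof. by apply: le_path_dist => l; exact: pl_path_coord. Qed.

Lemma height_lipschitz x y : `|height x - height y| <= d x y.
Proof. by apply: le_path_dist => l; exact: pl_path_height. Qed.

Lemma path_dist_metric : is_metric_on setT d.
Proof.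
split=> [x y _ _|x y _ _|x y _ _|x y z _ _ _].
- by apply: le_path_dist => l /pl_path_ge0.
- split=> [h|<-].
    apply: val_inj; apply/funext => u; apply/eqP; rewrite -subr_eq0 -normr_le0 -h.
    exact: path_dist_coord.
  apply/eqP; rewrite eq_le path_dist_le ?le_path_dist //; last exact: pl_nil.
  by move=> l /pl_path_ge0.
- by apply/eqP; rewrite eq_le; apply/andP; split; apply: le_path_dist => l;
    move=> /pl_path_sym; exact: path_dist_le.
- apply/ler_addgt0Pr => e e0; have e20 : 0 < e / 2 by lra.
  have [l xy h] := path_dist_approx x y e20.
  have [l' yz h'] := path_dist_approx y z e20.
  by have := path_dist_le (pl_path_cat xy yz); lra.
Qed.

Lemma segment_curve x y v w s t : edge v w -> 0 <= s <= 1 -> 0 <= t <= 1 ->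
  val x = bary v w s -> val y = bary v w t ->
  exists g, [/\ lipschitz1 d g, g 0 = x & g `|s - t| = y].
Proof.
move=> vw /andP[s0 s1] /andP[t0 t1] xE yE.
pose c := clamp 0 `|s - t|.
pose p (r : R) : R := if s <= t then s + c r else s - c r.
have c01 r : 0 <= c r <= `|s - t| by exact: clampP.
have p01 r : 0 <= p r <= 1.
  have /andP[] := c01 r; rewrite /p; move: (c r) => a.
  case: (leP s t) => st.
    by rewrite distrC ger0_norm ?subr_ge0 // => h1 h2; apply/andP; split; lra.
  by rewrite ger0_norm ?subr_ge0 ?(ltW st) // => h1 h2; apply/andP; split; lra.
have [g gE] := choice (fun r => edge_pt vw (p01 r)).
exists g; split.
- apply: (lipschitz1_le path_dist_metric) => a b ab.
  apply: le_trans (path_dist_le (pl_path_segment vw (p01 a) (p01 b) (gE a) (gE b))) _.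
  have : `|c a - c b| <= b - a.
    by apply: le_trans (clamp_lipschitz _ _ _) _; rewrite // distrC ger0_norm ?subr_ge0.
  rewrite /p; case: ifP => _; first by rewrite opprD addrACA subrr add0r.
  by rewrite (_ : _ - _ - _ = c b - c a) 1?distrC //; ring.
- apply: val_inj; rewrite gE xE /p /c clampE //.
  by case: ifP; rewrite ?addr0 ?subr0.
- apply: val_inj; rewrite gE yE /p /c clampE //.
  case: (leP s t) => st; congr bary.
    by rewrite distrC ger0_norm ?subr_ge0 //; ring.
  by rewrite ger0_norm ?subr_ge0 ?(ltW st) //; ring.
Qed.

Lemma pl_path_curve x y l : path x y l ->
  exists g, [/\ lipschitz1 d g, g 0 = x & g l = y].
Proof.
elim=> [{}x|{}x y' {}y v w s t {}l vw s01 t01 xE yE yl [g2 [g2l g20 g2E]]].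
  by exists (fun=> x); split=> // a b; rewrite (distxx path_dist_metric).
have [g1 [g1l g10 g1E]] := segment_curve vw s01 t01 xE yE.
have [|g [gl gE1 gE2]] := lipschitz1_concat path_dist_metric g1l g2l (l := `|s - t|).
  by rewrite g1E g20.
exists g; split=> //; first by rewrite gE1.
by rewrite gE2 ?lerDl ?(pl_path_ge0 yl) // addrC addKr.
Qed.

Lemma path_dist_length x y (e : R) : 0 < e -> exists (g : R -> X) (l : R),
  [/\ 0 <= l, lipschitz1 d g, g 0 = x, g l = y & l <= d x y + e].
Proof.
move=> e0; have [l xy h] := path_dist_approx x y e0.
have [g [gl g0 gE]] := pl_path_curve xy.
by exists g, l; split=> //; [exact: pl_path_ge0 xy|exact: ltW].
Qed.

Local Notation rho := (@filling_density R Z alpha tau S).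

Lemma filling_density_gt0 x : 0 < rho x.
Proof. exact: exp_gt0. Qed.

Lemma filling_density_harnack x y : rho x <= E (d x y) * rho y.
Proof.
rewrite /filling_density -expD //; apply: exp_le => //.
by have := ler_norm (height y - height x); rewrite distrC;
   have := height_lipschitz x y; lra.
Qed.

Lemma height_vertex x v : val x = bary v v 0 -> height x = v.2%:~R.
Proof. by move=> xE; rewrite heightE (linear_ext_bary _ xE) mul0r subr0 mul1r addr0. Qed.

Lemma linear_ext_vertex f x v : val x = bary v v 0 -> linear_ext f x = f v.
Proof. by move=> xE; rewrite (linear_ext_bary _ xE) mul0r subr0 mul1r addr0. Qed.

Lemma edge_scale v w : edge v w -> E (- w.2%:~R) <= alpha * E (- v.2%:~R).
Proof.
move=> /edge_height; rewrite -[X in X * _](exp1 alpha_gt1) -expD // => h.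
by apply: exp_le => //; lra.
Qed.

(** If f varies along edges by at most C times their scale, its extension has slope at most C times
    [rho]. In E (1 + l), the 1 compares an edge end with a point of the edge, and l accounts for the
    drift of the height along the path. *)
Lemma pl_path_linear_ext f C x y l : 0 <= C ->
  (forall v w, edge v w -> `|f v - f w| <= C * E (- v.2%:~R)) -> path x y l ->
  `|linear_ext f x - linear_ext f y| <= C * E (1 + l) * rho x * l.
Proof.
move=> C0 h; elim=> [{}x|{}x y' {}y v w s t {}l vw s01 t01 xE yE yl IH].
  by rewrite subrr normr0 mulr0.
have l0 := pl_path_ge0 yl.
rewrite -(subrKA (linear_ext f y')); apply: le_trans (ler_normD _ _) _.
rewrite mulrDr; have st0 : 0 <= `|s - t| by [].
have r0 := filling_density_gt0 x; have r1 := filling_density_gt0 y'.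
apply: lerD.
  rewrite (linear_ext_segment _ xE yE) normrM mulrC; apply: ler_wpM2r => //.
  rewrite distrC; apply: le_trans (h _ _ vw) _; rewrite -mulrA; apply: ler_wpM2l => //.
  rewrite /filling_density -expD //. apply: exp_le => //.
  have /andP[s0 s1] := s01.
  have : height x <= v.2%:~R + 1.
    rewrite heightE (linear_ext_bary _ xE).
    have := ler_wpM2l s0 (edge_height (edge_sym vw)); lra.
  lra.
apply: le_trans IH _; apply: ler_wpM2r => //; rewrite -!mulrA; apply: ler_wpM2l => //.
rewrite /filling_density -!expD //; apply: exp_le => //.
have := pl_path_height (pl_path_segment vw s01 t01 xE yE).
have := ler_norm (height x - height y'); lra.
Qed.

(** The approximating path has length at most 2, so E (1 + l) is at most E 3. *)
Lemma linear_ext_lipschitz f C x y : 0 <= C ->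
  (forall v w, edge v w -> `|f v - f w| <= C * E (- v.2%:~R)) -> d x y <= 1 ->
  `|linear_ext f x - linear_ext f y| <= C * E 3 * rho x * d x y.
Proof.
move=> C0 h xy; set K := C * E 3 * rho x.
have K0 : 0 <= K by rewrite /K !mulr_ge0 // ?exp_ge0 // ltW // filling_density_gt0.
apply/ler_addgt0Pr => e e0.
have e'0 : 0 < Num.min 1 (e / (K + 1)).
  by rewrite lt_min ltr01 divr_gt0 // ltr_wpDl.
have [l xyl hl] := path_dist_approx x y e'0.
have l2 : l <= d x y + 1 by apply: le_trans (ltW hl) _; rewrite lerD2l ge_min lexx.
have l3 : l <= d x y + e / (K + 1).
  by apply: le_trans (ltW hl) _; rewrite lerD2l ge_min lexx orbT.
apply: le_trans (pl_path_linear_ext C0 h xyl) _.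
have l0 := pl_path_ge0 xyl.
apply: (@le_trans _ _ (K * l)).
  rewrite /K; apply: ler_wpM2r => //; rewrite ler_pM2r ?filling_density_gt0 //.
  by apply: ler_wpM2l => //; apply: exp_le => //; lra.
apply: le_trans (ler_wpM2l K0 l3) _; rewrite mulrDr lerD2l mulrCA.
by rewrite ger_pMr // ler_pdivrMr ?ltr_wpDl // mul1r lerDl.
Qed.

Lemma bary_coord v w t : v != w -> bary v w t v = 1 - t :> R.
Proof. by move=> vw; rewrite /bary eqxx (negbTE vw) mulr1 mulr0 addr0. Qed.

Lemma bary_coord2 v w t : v != w -> bary v w t w = t :> R.
Proof. by move=> vw; rewrite /bary eqxx eq_sym (negbTE vw) mulr1 mulr0 add0r. Qed.

Lemma bary_coord3 u v w t : u != v -> u != w -> bary v w t u = 0 :> R.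
Proof. by move=> uv uw; rewrite /bary (negbTE uv) (negbTE uw) !mulr0 addr0. Qed.

Lemma star_pt x v : 0 < val x v -> vertex v /\ (val x = bary v v 0 \/
  exists w, [/\ edge v w, 0 < 1 - val x v <= 1, val x = bary v w (1 - val x v) &
    val x w = 1 - val x v]).
Proof.
have [a [b [t [[[va ab]|e] /andP[t0 t1] xE]]]] := fillingP x.
  rewrite xE -ab baryvv /bary subr0 mul1r mul0r addr0.
  by case: eqP => [-> _|_]; [split=> //; left|rewrite ltxx].
have ab : a != b by case: e => _ _ /eqP.
have [->|va] := eqVneq v a.
  rewrite xE bary_coord // subKr subr_gt0 => t1'.
  split; first by case: e.
  have [->|tn0] := eqVneq t 0; first by left; exact: bary0.
  by right; exists b; rewrite bary_coord2 // lt_neqAle eq_sym tn0 t0 t1.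
have [->|vb] := eqVneq v b; last by rewrite xE bary_coord3 // ltxx.
rewrite xE bary_coord2 // => t0'; split; first by case: e.
have [->|tn1] := eqVneq t 1; first by left; exact: bary1.
right; exists a; rewrite bary_coord // -bary_swap; split=> //; first exact: edge_sym.
by rewrite subr_gt0 lt_neqAle tn1 t1 lerBlDr lerDl.
Qed.

Lemma star_dist x p v : 0 < val x v -> val p = bary v v 0 -> d x p <= 1 - val x v.
Proof.
move=> xv pE; have [_ [xE|[w [e /andP[t0 t1] xE _]]]] := star_pt xv.
  have -> : x = p by apply: val_inj; rewrite xE pE.
  by rewrite (distxx path_dist_metric) pE /bary eqxx subr0 mul1r mul0r addr0 subrr.
apply: path_dist_le; rewrite -[X in path _ _ X]ger0_norm; last exact: ltW.
rewrite -[X in `|X|]subr0; apply: (pl_path_segment e) xE _.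
- by rewrite (ltW t0).
- by rewrite lexx ler01.
- by rewrite pE; exact: bary0.
Qed.

Lemma filling_complete (a : nat -> X) : cauchy_seq d a ->
  exists x, d (a n) x @[n --> \oo] --> (0 : R).
Proof.
move=> /(cauchyP path_dist_metric) ca.
have [N NP] := ca 8^-1 ltac:(lra).
have [v vN] : exists v, 2^-1 <= val (a N) v.
  have [v [w [t [h /andP[t0 t1] xE]]]] := fillingP (a N).
  have [vw|vw] := eqVneq v w.
    exists w; rewrite xE vw baryvv /bary eqxx subr0 !mul1r mul0r addr0 /=; lra.
  have [th|th] := leP t 2^-1.
    by exists v; rewrite xE bary_coord //; lra.
  by exists w; rewrite xE bary_coord2 //; lra.
have vn0 n : (N <= n)%N -> 0 < val (a n) v.
  move=> Nn; have := NP N n (leqnn N) Nn; have := path_dist_coord (a N) (a n) v.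
  have := ler_norm (val (a N) v - val (a n) v); lra.
have [s sP] : exists s, (1 - val (a n) v) @[n --> \oo] --> s.
  apply: cauchy_seq_cvg => e e0; have [M MP] := ca e e0; exists M => m n Mm Mn.
  rewrite (_ : _ - _ - _ = val (a n) v - val (a m) v); last by ring.
  by rewrite distrC; apply: le_lt_trans (path_dist_coord _ _ _) (MP _ _ Mm Mn).
have v01 n : (N <= n)%N -> 0 <= 1 - val (a n) v <= 1.
  move=> /vn0 h; have [_ [->|[w [_ /andP[h1 h2] _ _]]]] := star_pt h.
    by rewrite /bary eqxx subr0 mul1r mul0r addr0 subrr lexx ler01.
  by rewrite ltW.
have s0 : 0 <= s.
  by apply: (cvg_seq_ge sP); exists N => n /v01 /andP[].
have s1 : s <= 1.
  by apply: (cvg_seq_le sP); exists N => n /v01 /andP[].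
move/cvg_seqP : sP => sP; have [vv _] := star_pt (vn0 N (leqnn N)).
(* If the limit is v, the terms may keep changing edges, but their distances to v tend to 0. *)
have [s0'|sn0] := eqVneq s 0.
  have [p pE] := vertex_pt vv; exists p.
  apply/(dist_cvg0P path_dist_metric) => e e0; have [M MP] := sP e e0.
  exists (maxn N M) => n; rewrite geq_max => /andP[/vn0 nv /MP].
  rewrite s0' subr0 => h; apply: le_lt_trans (star_dist nv pE) _.
  exact: le_lt_trans (ler_norm _) h.
have {}s0 : 0 < s by rewrite lt_neqAle eq_sym sn0.
have s20 : 0 < s / 2 by lra.
have [M1 M1P] := sP _ s20; have [M2 M2P] := ca _ s20.
pose M := maxn N (maxn M1 M2).
have MN n : (M <= n)%N -> [/\ (N <= n)%N, (M1 <= n)%N & (M2 <= n)%N].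
  by rewrite /M !geq_max => /and3P.
have big n : (M <= n)%N -> exists w, [/\ edge v w,
    val (a n) = bary v w (1 - val (a n) v) & s / 2 < val (a n) w].
  move=> /MN[h1 h2 _]; have [_ [aE|[w [e _ aE aw]]]] := star_pt (vn0 n h1).
    have := M1P n h2; rewrite aE /bary eqxx subr0 mul1r mul0r addr0 subrr sub0r normrN.
    by rewrite gtr0_norm //; lra.
  exists w; split=> //; rewrite aw.
  by have := M1P n h2; rewrite ltr_norml => /andP[]; lra.
have [w [vw aM wM]] := big M (leqnn M).
have nvw : v != w by case: vw => _ _ /eqP.
have an n : (M <= n)%N -> val (a n) = bary v w (1 - val (a n) v).
  move=> Mn; have [u [vu aE _]] := big n Mn.
  (* On another edge at v the coordinate at w would be 0, whereas it exceeds s / 2 at index M and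
     later changes by less than s / 2. *)
  suff -> : w = u by [].
  apply/eqP; apply: contraTT wM => wu; rewrite -leNgt.
  have : val (a n) w = 0 by rewrite aE bary_coord3 // eq_sym.
  have [_ _ h1] := MN _ (leqnn M); have [_ _ h2] := MN _ Mn.
  have := M2P _ _ h1 h2; have := path_dist_coord (a M) (a n) w.
  have := ler_norm (val (a M) w - val (a n) w); lra.
have s01 : 0 <= s <= 1 by rewrite ltW.
have [x xE] := edge_pt vw s01; exists x.
apply/(dist_cvg0P path_dist_metric) => e e0; have [K KP] := sP e e0.
exists (maxn M K) => n; rewrite geq_max => /andP[Mn /KP]; apply: le_lt_trans.
apply: path_dist_le; apply: (pl_path_segment vw) (an _ Mn) xE => //.
by apply: v01; have [] := MN _ Mn.
Qed.

End Filling.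
End Graph.

(** * Comparison of the distances *)

Ltac positivity := repeat first [assumption | exact: ltr01 | exact: ltr0Sn
  | apply: mulr_gt0 | apply: addr_gt0 | rewrite invr_gt0 | apply: exprn_gt0
  | apply: exp_gt0 ].

Section Constants.
Context {R : realType} (alpha tau : R).
Local Notation E t := (alpha `^ t).

(** Bounds the Lipschitz constant of [rho] for d_rho: alpha ln alpha is its local slope relative to
    [rho], and the last alpha comes from [rho_dist_lipschitz]. *)
Definition density_const : R := alpha * ln alpha * alpha.
(** Centres of adjacent vertices are within tau (1 + alpha) scales; E 3 comes from
    [linear_ext_lipschitz], alpha from [rho_dist_lipschitz], and 1 from the terms [rho] in
    [quasi]. *)
Definition proj_const : R := tau * (1 + alpha) * E 3 * alpha + 1.
(** Two exponential branches, each integrated at the price 1 / ln alpha; alpha pays for steps of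
    length at most 1. *)
Definition potential_const : R := 2 * alpha / ln alpha.
(** 2 E 2 comes from [rho_dist_near], and alpha from curves that exceed the distance by up to 1. *)
Definition dist_const : R := 2 * E 2 * potential_const * alpha.
Definition quasi_const : R := proj_const * (dist_const + 2).
(** The first summand serves endpoints at distance at least 1, the second closer ones. *)
Definition geod_const : R :=
  potential_const * alpha * E 4 * proj_const * (1 + 2 * E 3) + 2 * E 2 * E 3.
Definition min_const : R := 2 * alpha * E 4 * quasi_const.

Hypotheses (alpha_gt1 : 1 < alpha) (tau_gt3 : 3 < tau).

Lemma alpha_gt0 : 0 < alpha. Proof. exact: lt_trans alpha_gt1. Qed.

Let a0 := alpha_gt0.
Let l0 : 0 < ln alpha := ln_alpha_gt0 alpha_gt1.
Let t0 : 0 < tau := tau_gt0 tau_gt3.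
Let e0 t : 0 < E t := exp_gt0 alpha_gt1 t.

Lemma density_const_gt0 : 0 < density_const.
Proof. by rewrite /density_const; positivity. Qed.

Lemma proj_const_ge1 : 1 <= proj_const.
Proof. by rewrite /proj_const lerDr; apply: ltW; positivity. Qed.

Let p0 : 0 < proj_const := lt_le_trans ltr01 proj_const_ge1.

Lemma potential_const_gt0 : 0 < potential_const.
Proof. by rewrite /potential_const; positivity. Qed.

Let q0 := potential_const_gt0.

Lemma dist_const_gt0 : 0 < dist_const.
Proof. by rewrite /dist_const; positivity. Qed.

Let d0 := dist_const_gt0.

Lemma quasi_const_gt0 : 0 < quasi_const.
Proof. by rewrite /quasi_const; positivity. Qed.

Let qu0 := quasi_const_gt0.

Lemma min_const_gt0 : 0 < min_const.
Proof. by rewrite /min_const; positivity. Qed.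

Lemma geod_const_gt0 : 0 < geod_const.
Proof. by rewrite /geod_const; positivity. Qed.

End Constants.

Section Estimates.
Context {R : realType} {Z : metricType R} (alpha tau : R) (S : int -> set Z).
Hypotheses (alpha_gt1 : 1 < alpha) (tau_gt3 : 3 < tau).
Hypothesis S_max : forall n, maximal_separated (alpha ^ (- n)) (S n).

Local Notation X := (filling alpha tau S).
Local Notation d := (@path_dist R Z alpha tau S).
Local Notation rho := (@filling_density R Z alpha tau S).
Local Notation dr := (rho_dist d rho).
Local Notation E t := (alpha `^ t).
Local Notation h := (@height R Z alpha tau S).
Implicit Types (x y w : X) (c : R -> X) (a b s t : R).

Let dM : is_metric_on setT d := path_dist_metric alpha_gt1 tau_gt3 S_max.
Let rho_gt0 x : 0 < rho x := filling_density_gt0 alpha_gt1 x.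
Let harnack x y : rho x <= E (d x y) * rho y :=
  filling_density_harnack alpha_gt1 tau_gt3 S_max x y.
Let d_length := @path_dist_length R Z alpha tau S alpha_gt1 tau_gt3 S_max.

Lemma filling_rho_metric : is_metric_on setT dr.
Proof. exact: (rho_dist_metric dM alpha_gt1 rho_gt0 harnack d_length). Qed.

Let drM := filling_rho_metric.

Lemma filling_rho_near x y : d x y <= 1 -> dr x y <= 2 * E 2 * rho x * d x y.
Proof. exact: (rho_dist_near dM alpha_gt1 rho_gt0 harnack d_length). Qed.

Lemma filling_rho_ge x y : rho x * Num.min 1 (d x y) <= E 3 * dr x y.
Proof. exact: (rho_dist_ge dM alpha_gt1 rho_gt0 harnack d_length). Qed.

(** The tangent line of the exponential bounds the variation of [rho], because the height is
    1-Lipschitz. *)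
Lemma rho_variation x y : `|rho x - rho y| <= density_const alpha * dr x y.
Proof.
apply: (rho_dist_lipschitz dM alpha_gt1 rho_gt0 harnack d_length).
  by rewrite mulr_ge0 // ltW ?ln_alpha_gt0 // alpha_gt0.
move=> {}x {}y xy; have hx := height_lipschitz alpha_gt1 tau_gt3 S_max x y.
have key z z' : `|height z - height z'| <= d x y ->
    rho z - rho z' <= ln alpha * rho z * d x y.
  move=> hz; have := exp_convex alpha_gt1 (- h z) (- h z').
  have k0 : 0 <= ln alpha * rho z by rewrite mulr_ge0 // ltW ?ln_alpha_gt0.
  have := ler_wpM2l k0 hz; have := ler_norm (h z' - h z); rewrite distrC => h1.
  have := ler_wpM2l k0 h1; rewrite /filling_density; lra.
have h1 := key x y hx; have h2 := key y x; rewrite distrC in h2; have {}h2 := h2 hx.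
have d0 := dist_ge0 dM x y; have l0 := ln_alpha_gt0 alpha_gt1.
have hyx : rho y <= alpha * rho x.
  apply: le_trans (harnack y x) _; rewrite ler_pM2r //.
  by rewrite -[leRHS](exp1 alpha_gt1); apply: exp_le => //; rewrite (dist_sym dM).
have h3 : ln alpha * rho y * d x y <= alpha * ln alpha * rho x * d x y.
  apply: ler_wpM2r => //; rewrite -mulrA mulrCA; apply: ler_wpM2l => //; exact: ltW.
have h4 : ln alpha * rho x * d x y <= alpha * ln alpha * rho x * d x y.
  apply: ler_wpM2r => //; rewrite -!mulrA ler_peMl ?mulr_ge0 // ltW //.
by rewrite ler_norml; apply/andP; split; lra.
Qed.

Let nearest x : {vp : (Z * int) * X | [/\ vertex S vp.1, val vp.2 = bary vp.1 vp.1 0 &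
  d x vp.2 <= 1 / 2]}.
Proof.
apply: cid; have [v [p [vv pE [l xp l2]]]] := nearest_vertex x.
by exists (v, p); split=> //=; exact: le_trans (path_dist_le xp) l2.
Qed.

Definition nearest_pt x : X := (sval (nearest x)).2.
Definition nearest_vx x : Z * int := (sval (nearest x)).1.
Definition proj x : Z := (nearest_vx x).1.

Lemma nearestP x : [/\ vertex S (nearest_vx x),
  val (nearest_pt x) = bary (nearest_vx x) (nearest_vx x) 0 & d x (nearest_pt x) <= 1 / 2].
Proof. exact: svalP (nearest x). Qed.

Lemma nearest_height x : `|height x - (nearest_vx x).2%:~R| <= 1 / 2.
Proof.
have [_ pE hd] := nearestP x; rewrite -(height_vertex pE).
exact: le_trans (height_lipschitz alpha_gt1 tau_gt3 S_max _ _) hd.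
Qed.

Definition quasi x y : R := mdist (proj x) (proj y) + rho x + rho y.

Lemma edge_mdist (p : Z) (v w : Z * int) : edge alpha tau S v w ->
  `|mdist p v.1 - mdist p w.1| <= tau * (1 + alpha) * E (- v.2%:~R).
Proof.
move=> e; have [_ _ _ _ [q [/vertex_ballE vq /vertex_ballE wq]]] := e.
have {}vq := vq alpha_gt1; have {}wq := wq alpha_gt1.
have hw := edge_scale alpha_gt1 e.
have vw : mdist v.1 w.1 <= tau * (1 + alpha) * E (- v.2%:~R).
  apply: le_trans (metric_triangle _ q _) _; rewrite (metric_sym q).
  apply: le_trans (ltW (ltrD vq wq)) _.
  rewrite -mulrDr -mulrA mulrDl mul1r; apply: ler_wpM2l; last by rewrite lerD2l.
  by apply: ltW; apply: lt_trans tau_gt3.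
have h1 := metric_triangle p v.1 w.1; have h2 := metric_triangle p w.1 v.1.
rewrite (metric_sym w.1) in h2.
by rewrite ler_norml; apply/andP; split; lra.
Qed.

(** The projection itself is discontinuous, so the interpolated distance F to [proj y] is used,
    which is Lipschitz for d_rho. Passing from x and y to their nearest vertices costs the two terms
    in [rho]; at these vertices F equals the distance of the projections and 0. *)
Lemma proj_dist x y :
  mdist (proj x) (proj y) <= (proj_const alpha tau - 1) * (dr x y + rho x + rho y).
Proof.
set C := tau * (1 + alpha); have a0 := alpha_gt0 alpha_gt1.
have C0 : 0 <= C by rewrite mulr_ge0 // ltW ?(tau_gt0 tau_gt3) // addr_gt0.
have C30 : 0 <= C * E 3 by rewrite mulr_ge0 // exp_ge0.
pose F := linear_ext (fun v => mdist (proj y) v.1) : X -> R.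
have Fl z z' : d z z' <= 1 -> `|F z - F z'| <= C * E 3 * rho z * d z z'.
  apply: (linear_ext_lipschitz alpha_gt1 tau_gt3 S_max) => // v w; exact: edge_mdist.
have Fn z : `|F z - F (nearest_pt z)| <= C * E 3 * alpha * rho z.
  have [_ _ hz] := nearestP z; have hz1 : d z (nearest_pt z) <= 1 by lra.
  apply: le_trans (Fl _ _ hz1) _.
  apply: le_trans (ler_wpM2l _ hz1) _; first by rewrite mulr_ge0 // ltW.
  by rewrite mulr1 ler_pM2r // ler_peMr // ltW.
have FE z : F (nearest_pt z) = mdist (proj y) (proj z).
  by have [_ zE _] := nearestP z; rewrite /F (linear_ext_vertex _ zE).
have Fd := rho_dist_lipschitz dM alpha_gt1 rho_gt0 harnack d_length C30 Fl x y.
have Fx := Fn x; have Fy := Fn y; rewrite !FE mdistxx in Fx Fy.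
rewrite /proj_const addrK -/C metric_sym.
rewrite subr0 in Fy; rewrite distrC in Fx.
have := ler_norm (mdist (proj y) (proj x) - F x).
have := ler_norm (F x - F y); have := ler_norm (F y).
rewrite !mulrDr; lra.
Qed.

Lemma quasi_le x y : quasi x y <= proj_const alpha tau * (dr x y + rho x + rho y).
Proof.
have := proj_dist x y; rewrite /quasi mulrBl mul1r.
by have := dist_ge0 drM x y; lra.
Qed.

Definition geo x y : R := E ((d x y - height x - height y) / 2).

Lemma geo_gt0 x y : 0 < geo x y. Proof. exact: exp_gt0. Qed.

Lemma quasi_gt0 x y : 0 < quasi x y.
Proof. by rewrite /quasi -addrA ltr_wpDl ?mdist_ge0 // addr_gt0. Qed.

Lemma quasi_ge_rho x y : rho x <= quasi x y.
Proof.
rewrite /quasi; have := mdist_ge0 (proj x) (proj y); have := rho_gt0 y; lra.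
Qed.

Lemma geo_sym x y : geo x y = geo y x.
Proof. by rewrite /geo (dist_sym dM) addrAC. Qed.

Lemma quasi_sym x y : quasi x y = quasi y x.
Proof. by rewrite /quasi metric_sym addrAC. Qed.

Lemma quasi_tri w x y : quasi x y <= quasi x w + quasi w y.
Proof.
rewrite /quasi; have := metric_triangle (proj x) (proj w) (proj y).
by have := rho_gt0 w; lra.
Qed.

Lemma rho_geo x y : rho x <= geo x y.
Proof.
apply: exp_le => //; have := height_lipschitz alpha_gt1 tau_gt3 S_max x y.
by have := ler_norm (height y - height x); rewrite distrC; lra.
Qed.

Lemma geo_quasi x y : geo x y <= E 4 * quasi x y.
Proof.
pose L := ln (quasi x y) / ln alpha.
have QL : E L = quasi x y by apply: exp_log => //; exact: quasi_gt0.
have m0 := mdist_ge0 (proj x) (proj y).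
have rx := rho_gt0 x; have ry := rho_gt0 y.
have Lx : - height x <= L by rewrite -(exp_leE alpha_gt1) QL /quasi -/(rho x); lra.
have Ly : - height y <= L by rewrite -(exp_leE alpha_gt1) QL /quasi -/(rho y); lra.
(* L is the logarithmic scale of [quasi x y]. The 1 leaves room for the nearest vertices, whose
   heights may be 1/2 lower; E 4 absorbs the rounding. *)
pose k := Num.floor (- L - 1).
have [k1 k2] : k%:~R <= - L - 1 /\ - L - 2 < k%:~R.
  split; first exact: Num.Theory.floor_le.
  by have := Num.Theory.floorD1_gt (- L - 1); rewrite -/k intrD; lra.
have [vx xE dx] := nearestP x; have [vy yE dy] := nearestP y.
have hx := nearest_height x; have hy := nearest_height y.
rewrite ler_norml in hx; rewrite ler_norml in hy.
have /andP[hx1 hx2] := hx; have /andP[hy1 hy2] := hy.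
have kx : k <= (nearest_vx x).2 by rewrite -(ler_int R); lra.
have ky : k <= (nearest_vx y).2 by rewrite -(ler_int R); lra.
have kq : mdist (nearest_vx x).1 (nearest_vx y).1 <= E (- k%:~R).
  apply: (@le_trans _ _ (E L)); last by apply: exp_le => //; lra.
  by rewrite QL /quasi -/(proj x) -/(proj y); lra.
have [l pl lb] := pl_path_down alpha_gt1 tau_gt3 S_max vx vy xE yE kx ky kq.
have dl := path_dist_le pl.
have := dist_tri dM (nearest_pt x) x y; have := dist_tri dM (nearest_pt y) (nearest_pt x) y.
rewrite (dist_sym dM (nearest_pt y) y) => t1 t2.
rewrite -QL -expD //; apply: exp_le => //; lra.
Qed.

Definition lipschitz_on c a b := forall s t, a <= s -> s <= t -> t <= b ->
  d (c s) (c t) <= t - s.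

(* Along [c] the height is at least [h (c a) - (s - a)] and at least
   [h (c b) - (b - s)]; [P] integrates the resulting bound on [rho]. *)
Lemma curve_potential c a b : a <= b -> lipschitz_on c a b ->
  exists P : R -> R,
   (forall s t, a <= s -> s <= t -> t <= b -> t - s <= 1 ->
     rho (c s) * (t - s) <= P t - P s) /\
   P b - P a <= potential_const alpha * E ((b - a - height (c a) - height (c b)) / 2).
Proof.
move=> ab cl; pose hx := height (c a); pose hy := height (c b).
(* The parameter at which the two lower bounds for the height agree. *)
pose m := (a + b + hx - hy) / 2.
have a0 := alpha_gt0 alpha_gt1; have l0 := ln_alpha_gt0 alpha_gt1.
have hxy : `|hx - hy| <= b - a.
  apply: le_trans (height_lipschitz alpha_gt1 tau_gt3 S_max _ _) _; exact: cl.
rewrite ler_norml in hxy; have /andP[hxy1 hxy2] := hxy.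
have am : a <= m by rewrite /m; lra.
have mb : m <= b by rewrite /m; lra.
pose e1 s := E (s - a - hx); pose e2 s := E (b - s - hy).
have em : e1 m = e2 m by rewrite /e1 /e2 /m; congr (_ `^ _); lra.
have c1 s : a <= s -> s <= b -> rho (c s) <= e1 s.
  move=> as' sb; apply: exp_le => //.
  have := height_lipschitz alpha_gt1 tau_gt3 S_max (c a) (c s).
  have := cl _ _ (lexx a) as' sb; have := ler_norm (h (c a) - h (c s)).
  by rewrite /hx; lra.
have c2 s : a <= s -> s <= b -> rho (c s) <= e2 s.
  move=> as' sb; apply: exp_le => //.
  have := height_lipschitz alpha_gt1 tau_gt3 S_max (c s) (c b).
  have := cl _ _ as' sb (lexx b); have := ler_norm (h (c b) - h (c s)).
  by rewrite distrC /hy; lra.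
have v1 s t : ln alpha * e1 s * (t - s) <= e1 t - e1 s.
  by have := exp_convex alpha_gt1 (s - a - hx) (t - a - hx); rewrite /e1; lra.
have v2 s t : ln alpha * e2 t * (t - s) <= e2 s - e2 t.
  by have := exp_convex alpha_gt1 (b - t - hy) (b - s - hy); rewrite /e2; lra.
have e2a s t : t - s <= 1 -> e2 s <= alpha * e2 t.
  move=> ts; rewrite /e2 -[X in _ <= X * _](exp1 alpha_gt1) -expD //.
  by apply: exp_le => //; lra.
have k0 : 0 < alpha / ln alpha by rewrite divr_gt0.
(* Increasing on both branches, and matched at m since [e1 m = e2 m]. As e2 decreases, its value at
   the left end of a step is traded for the one at the right end, at the price alpha. *)
pose P s := alpha / ln alpha * (if s <= m then e1 s else 2 * e1 m - e2 s).
have up s t : a <= s -> s <= t -> t <= b ->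
    rho (c s) * (t - s) <= alpha / ln alpha * (e1 t - e1 s).
  move=> as' st tb; have ts0 : 0 <= t - s by rewrite subr_ge0.
  rewrite mulrAC ler_pdivlMr //.
  have h1 : rho (c s) * (t - s) <= e1 s * (t - s).
    by apply: ler_wpM2r => //; apply: c1 => //; exact: le_trans tb.
  have h2 : 0 <= e1 t - e1 s.
    by apply: le_trans (v1 s t); rewrite !mulr_ge0 // ltW // exp_gt0.
  apply: (@le_trans _ _ (e1 t - e1 s)); last by rewrite ler_peMl // ltW.
  apply: le_trans (v1 s t); rewrite mulrC -mulrA; apply: ler_wpM2l => //.
  exact: ltW.
have down s t : a <= s -> s <= t -> t <= b -> t - s <= 1 ->
    rho (c s) * (t - s) <= alpha / ln alpha * (e2 s - e2 t).
  move=> as' st tb ts1; have ts0 : 0 <= t - s by rewrite subr_ge0.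
  rewrite mulrAC ler_pdivlMr //.
  have h1 : rho (c s) <= alpha * e2 t.
    by apply: le_trans (e2a s t ts1); apply: c2 => //; exact: le_trans tb.
  have h2 := ler_wpM2l (ltW a0) (v2 s t); apply: le_trans h2.
  rewrite (_ : alpha * _ = alpha * e2 t * (t - s) * ln alpha); last by ring.
  by apply: ler_wpM2r; [exact: ltW|exact: ler_wpM2r].
exists P; split.
  move=> s t as' st tb ts1; rewrite /P.
  have [tm|mt] := leP t m.
    by rewrite (le_trans st tm) -mulrBr; exact: up.
  (* A step across m is split there, and both parts are charged with [rho (c s)]. *)
  have [sm|ms] := leP s m.
    have u1 := up s m as' sm mb.
    have m1 : a <= m := am.
    have d1 : rho (c s) * (t - m) <= alpha / ln alpha * (e2 m - e2 t).
      rewrite mulrAC ler_pdivlMr //.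
      have h1 : rho (c s) <= alpha * e2 t.
        by apply: le_trans (e2a s t ts1); apply: c2 => //; exact: le_trans tb.
      have h2 := ler_wpM2l (ltW a0) (v2 m t); apply: le_trans h2.
      rewrite (_ : alpha * _ = alpha * e2 t * (t - m) * ln alpha); last by ring.
      apply: ler_wpM2r; [exact: ltW|apply: ler_wpM2r => //].
      by rewrite subr_ge0 ltW.
    have -> : rho (c s) * (t - s) = rho (c s) * (m - s) + rho (c s) * (t - m) by ring.
    rewrite -em in d1; lra.
  by have := down s t as' st tb ts1; lra.
have e1p s : 0 < e1 s := exp_gt0 alpha_gt1 _.
have e2p s : 0 < e2 s := exp_gt0 alpha_gt1 _.
rewrite /P am /potential_const -/hx -/hy.
have -> : E ((b - a - hx - hy) / 2) = e1 m by rewrite /e1 /m; congr (_ `^ _); lra.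
rewrite -mulrBr (_ : 2 * alpha / ln alpha * e1 m = alpha / ln alpha * (2 * e1 m)); last by ring.
rewrite ler_pM2l //; case: (leP b m) => bm.
  have -> : b = m by apply/eqP; rewrite eq_le bm mb.
  by have := e1p m; have := e1p a; lra.
by have := e1p a; have := e2p b; lra.
Qed.

(** The stand-in for a geodesic: the additive bound serves distant endpoints, the multiplicative one
    close endpoints, where an excess of 1 would be useless. *)
Definition rough_geodesic c a b := [/\ a <= b, lipschitz_on c a b,
  b - a <= 2 * d (c a) (c b) & b - a <= d (c a) (c b) + 1].

(** At distance at least 1, [filling_rho_ge] absorbs the values of [rho] at both ends in d_rho, so
    that geo <= C quasi turns the bound of [curve_potential] into one by d_rho. *)
Lemma rough_potential c a b : rough_geodesic c a b -> exists P : R -> R,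
   (forall s t, a <= s -> s <= t -> t <= b -> t - s <= 1 ->
     rho (c s) * (t - s) <= P t - P s) /\
   P b - P a <= geod_const alpha tau * dr (c a) (c b).
Proof.
move=> [ab cl ab2 ab1]; have a0 := alpha_gt0 alpha_gt1.
have t0 := tau_gt0 tau_gt3; have p1 := proj_const_ge1 alpha_gt1 tau_gt3.
have p0 : 0 < proj_const alpha tau := lt_le_trans ltr01 p1.
have q0 := potential_const_gt0 alpha_gt1.
have dr0 := dist_ge0 drM (c a) (c b).
have [d1|d1] := leP 1 (d (c a) (c b)).
  have [P [P1 P2]] := curve_potential ab cl; exists P; split=> //.
  apply: le_trans P2 _.
  apply: (@le_trans _ _ (potential_const alpha * alpha * E 4 * proj_const alpha tau *
    (1 + 2 * E 3) * dr (c a) (c b))); last first.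
    rewrite /geod_const [leRHS]mulrDl lerDl mulr_ge0 //; apply: ltW; positivity.
  have h1 : E ((b - a - h (c a) - h (c b)) / 2) <= alpha * geo (c a) (c b).
    rewrite /geo -[X in _ <= X * _](exp1 alpha_gt1) -expD //; apply: exp_le => //; lra.
  have h2 := filling_rho_ge (c a) (c b); rewrite (min_l d1) mulr1 in h2.
  have h3 := filling_rho_ge (c b) (c a); rewrite (dist_sym dM) (min_l d1) mulr1 in h3.
  rewrite (dist_sym drM) in h3.
  have h4 : dr (c a) (c b) + rho (c a) + rho (c b) <= (1 + 2 * E 3) * dr (c a) (c b).
    lra.
  have h5 := le_trans (quasi_le _ _) (ler_wpM2l (ltW p0) h4).
  have h6 := le_trans (geo_quasi _ _) (ler_wpM2l (exp_ge0 alpha_gt1 4) h5).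
  have h7 := le_trans h1 (ler_wpM2l (ltW a0) h6).
  by apply: le_trans (ler_wpM2l (ltW q0) h7) _; rewrite !mulrA.
(* The curve has length at most 2, so [rho] is at most E 2 times its initial value and a linear
   potential suffices. *)
exists (fun s => E 2 * rho (c a) * s); split.
  move=> s t as' st tb ts1; rewrite -mulrBr; apply: ler_wpM2r; first by rewrite subr_ge0.
  apply: le_trans (harnack _ (c a)) _; rewrite ler_pM2r //; apply: exp_le => //.
  by rewrite (dist_sym dM); have := cl _ _ (lexx a) as' (le_trans st tb); lra.
rewrite -mulrBr; apply: (@le_trans _ _ (E 2 * rho (c a) * (2 * d (c a) (c b)))).
  by apply: ler_wpM2l => //; apply: ltW; positivity.
have := filling_rho_ge (c a) (c b); rewrite (min_r (ltW d1)) => h1.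
rewrite /geod_const [leRHS]mulrDl ler_wpDl //.
  by rewrite mulr_ge0 //; apply: ltW; positivity.
have e2 : 0 <= 2 * E 2 by rewrite mulr_ge0 ?exp_ge0.
have := ler_wpM2l e2 h1; lra.
Qed.

Lemma potential_rho_dist c (P : R -> R) a b : lipschitz_on c a b ->
  (forall s t, a <= s -> s <= t -> t <= b -> t - s <= 1 ->
     rho (c s) * (t - s) <= P t - P s) ->
  forall s t, a <= s -> s <= t -> t <= b ->
    dr (c s) (c t) <= 2 * E 2 * P t - 2 * E 2 * P s.
Proof.
move=> cl hP s t as' st tb.
apply: (@local_to_global _ (fun s t => dr (c s) (c t) <= 2 * E 2 * P t - 2 * E 2 * P s)
  s t 1) => //.
  move=> u v su uv vt uv1; have au := le_trans as' su; have vb := le_trans vt tb.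
  have duv := cl _ _ au uv vb.
  apply: le_trans (filling_rho_near (le_trans duv uv1)) _.
  have h1 := le_trans (ler_wpM2l (ltW (rho_gt0 _)) duv) (hP _ _ au uv vb uv1).
  have k0 : 0 <= 2 * E 2 by rewrite mulr_ge0 ?exp_ge0.
  by rewrite -mulrBr; apply: le_trans _ (ler_wpM2l k0 h1); rewrite !mulrA.
move=> u v w su uv vw wt h1 h2; apply: le_trans (dist_tri drM (c v) _ _) _; lra.
Qed.

Lemma potential_length c (P : R -> R) a b : a <= b -> lipschitz_on c a b ->
  (forall s t, a <= s -> s <= t -> t <= b -> t - s <= 1 ->
     rho (c s) * (t - s) <= P t - P s) ->
  (curve_length dr c `[a, b] <= (2 * E 2 * (P b - P a))%:E)%E.
Proof.
move=> ab cl hP; rewrite mulrBr.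
apply: (curve_length_potential drM (P := fun s => 2 * E 2 * P s)) => // s t as' st tb.
exact: (potential_rho_dist cl hP).
Qed.

Lemma rough_length c a b : rough_geodesic c a b ->
  (curve_length dr c `[a, b] <=
    (2 * E 2 * geod_const alpha tau * dr (c a) (c b))%:E)%E.
Proof.
move=> rc; have [ab cl _ _] := rc; have [P [P1 P2]] := rough_potential rc.
apply: le_trans (potential_length ab cl P1) _; rewrite lee_fin -[leRHS]mulrA.
by rewrite ler_pM2l // mulr_gt0 ?exp_gt0.
Qed.

Lemma curve_geo_length c a b : a <= b -> lipschitz_on c a b ->
  b - a <= d (c a) (c b) + 1 ->
  (curve_length dr c `[a, b] <= (dist_const alpha * geo (c a) (c b))%:E)%E.
Proof.
move=> ab cl ab1; have [P [P1 P2]] := curve_potential ab cl.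
apply: le_trans (potential_length ab cl P1) _; rewrite lee_fin /dist_const.
have h1 : E ((b - a - h (c a) - h (c b)) / 2) <= alpha * geo (c a) (c b).
  by rewrite /geo -[X in _ <= X * _](exp1 alpha_gt1) -expD //; apply: exp_le => //; lra.
have h2 := le_trans P2 (ler_wpM2l (ltW (potential_const_gt0 alpha_gt1)) h1).
have k0 : 0 <= 2 * E 2 by rewrite mulr_ge0 ?exp_ge0.
by apply: le_trans (ler_wpM2l k0 h2) _; rewrite !mulrA.
Qed.

Lemma lipschitz1_on c a b : lipschitz1 d c -> lipschitz_on c a b.
Proof.
move=> cl s t _ st _; apply: le_trans (cl s t) _.
by rewrite distrC ger0_norm // subr_ge0.
Qed.

Lemma rho_dist_geo x y : dr x y <= dist_const alpha * geo x y.
Proof.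
have [c [l [l0 cl <- <- hl]]] := d_length x y ltr01.
rewrite -lee_fin; apply: le_trans (curve_geo_length l0 (lipschitz1_on cl) _).
  by apply: curve_length_dist => //=; rewrite in_itv /= lexx ?l0.
by rewrite subr0.
Qed.

Lemma quasi_geo x y : quasi x y <= quasi_const alpha tau * geo x y.
Proof.
have p0 := lt_le_trans ltr01 (proj_const_ge1 alpha_gt1 tau_gt3).
have h1 : dr x y + rho x + rho y <= (dist_const alpha + 2) * geo x y.
  have := rho_dist_geo x y; have := rho_geo x y; have := rho_geo y x.
  by rewrite (geo_sym y); lra.
apply: le_trans (quasi_le x y) _; apply: le_trans (ler_wpM2l (ltW p0) h1) _.
by rewrite mulrA.
Qed.

Lemma rho_dist_quasi x y : dr x y <= dist_const alpha * E 4 * quasi x y.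
Proof.
have h1 := ler_wpM2l (ltW (dist_const_gt0 alpha_gt1)) (geo_quasi x y).
by apply: le_trans (rho_dist_geo x y) _; rewrite -[leRHS]mulrA.
Qed.

(* Since [geo x y = geo x w * geo w y / rho w] up to a factor when [w] lies on a
   geodesic from [x] to [y], the quasi-triangle inequality bounds the smaller one. *)
Lemma geo_min x w y : d x w + d w y <= d x y + 1 ->
  Num.min (geo x w) (geo w y) <= min_const alpha tau * rho w.
Proof.
move=> dxy; have a0 := alpha_gt0 alpha_gt1.
have q0 := quasi_const_gt0 alpha_gt1 tau_gt3.
have h1 : geo x w * geo w y <= alpha * rho w * geo x y.
  rewrite /geo /filling_density -[X in _ <= X * _ * _](exp1 alpha_gt1) -!expD //.
  apply: exp_le => //; lra.
have h2 : geo x y <= E 4 * quasi_const alpha tau * (geo x w + geo w y).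
  have hq : quasi x y <= quasi_const alpha tau * (geo x w + geo w y).
    by apply: le_trans (quasi_tri w x y) _; rewrite mulrDr lerD ?quasi_geo.
  by have := le_trans (geo_quasi x y) (ler_wpM2l (exp_ge0 alpha_gt1 4) hq); rewrite mulrA.
set p := geo x w in h1 h2 *; set q := geo w y in h1 h2 *.
have p0 : 0 < p := geo_gt0 x w; have q1 : 0 < q := geo_gt0 w y.
have r0 := rho_gt0 w.
pose K := alpha * rho w * (E 4 * quasi_const alpha tau).
have K0 : 0 < K by rewrite /K; positivity.
have h3 : p * q <= K * (p + q).
  have k0 : 0 <= alpha * rho w by rewrite mulr_ge0 // ltW.
  by have := le_trans h1 (ler_wpM2l k0 h2); rewrite mulrA.
have -> : min_const alpha tau * rho w = 2 * K by rewrite /min_const /K; ring.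
(* If p is the smaller, p q <= K (p + q) <= 2 K q, and q cancels. *)
wlog pq : p q p0 q1 h3 {h1 h2} / p <= q.
  move=> hw; case: (leP p q) => pq.
    by have := hw p q p0 q1 h3 pq; rewrite min_l.
  have := hw q p q1 p0; rewrite mulrC addrC min_l ?(ltW pq) //.
  by apply=> //; exact: ltW.
rewrite min_l // -(ler_pM2r q1); apply: le_trans h3 _.
have := ler_wpM2l (ltW K0) pq; lra.
Qed.

(** The potential controls the value of [rho] at the left end of a step times its length; replacing
    this by the integral over the step costs alpha. The map k below is the geodesic by arc length,
    started at 0 and extended by clamping. *)
Lemma filling_GH_density : GH_density d rho (alpha * geod_const alpha tau).
Proof.
move=> a b c ab [_ _ cg]; have a0 := alpha_gt0 alpha_gt1.
have cl : lipschitz_on c a b.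
  move=> s t as' st tb; rewrite cg /= ?in_itv /= ?as' ?(le_trans st) ?(le_trans as') //.
  by rewrite distrC ger0_norm // subr_ge0.
have dab : d (c a) (c b) = b - a.
  by rewrite cg /= ?in_itv /= ?lexx ?ab // distrC ger0_norm // subr_ge0.
have rc : rough_geodesic c a b by split=> //; rewrite dab; lra.
have [P [P1 P2]] := rough_potential rc.
pose p := clamp a b; have pI s : a <= p s <= b by exact: clampP.
have pE s : a <= s -> s <= b -> p s = s by exact: clampE.
pose g s := c (p s).
have gl : lipschitz1 d g.
  by move=> s t; rewrite /g cg /= ?in_itv //=; exact: clamp_lipschitz.
have len s t : a <= s -> s <= t -> t <= b -> curve_length d c `[s, t] = (t - s)%:E.
  move=> as' st tb; apply/eqP; rewrite eq_le; apply/andP; split.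
    apply: (curve_length_potential dM (P := id)) => // u v su uv vt.
    by apply: cl => //; [exact: le_trans su|exact: le_trans tb].
  have <- : d (c s) (c t) = t - s.
    rewrite cg /= ?in_itv /= ?as' ?(le_trans st) ?(le_trans as') //.
    by rewrite distrC ger0_norm // subr_ge0.
  by apply: curve_length_dist => //=; rewrite in_itv /= lexx st.
have cc : curve d `[a, b] c.
  apply/(curveP dM c ab) => t tab e e0; exists e => // s sab st.
  by rewrite cg //= ?in_itv //= distrC.
pose k s := g (a + s).
have kl : lipschitz1 d k.
  by move=> s t; apply: le_trans (gl _ _) _; rewrite opprD addrACA subrr add0r.
have cf : (curve_length d c `[a, b] < +oo)%E by rewrite len // ltry.
rewrite (rho_lengthE dM alpha_gt1 rho_gt0 harnack ab cc cf kl); last first.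
  move=> t at' tb; rewrite /arc_length len //= /k /g.
  by rewrite (_ : a + (t - a) = t) ?pE //; ring.
rewrite lee_fin /arc_length len //= -mulrA.
apply: (@le_trans _ _ (alpha * P b - alpha * P a)); last first.
  by rewrite -mulrBr ler_pM2l.
have -> : alpha * P b - alpha * P a =
    alpha * P (a + (b - a)) - alpha * P (a + 0) by rewrite addr0 [a + (b - a)]addrC subrK.
apply: (@local_to_global _ (fun s t => rho_int rho k s t <=
   alpha * P (a + t) - alpha * P (a + s)) 0 (b - a) 1) => //.
- by rewrite subr_ge0.
- move=> s t s0 st tb st1.
  apply: le_trans (rho_int_ub alpha_gt1 rho_gt0 harnack kl st) _.
  have h1 : a <= a + s by rewrite lerDl.
  have h2 : a + t <= b by lra.
  have h3 : a + s <= a + t by rewrite lerD2l.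
  have h4 : a + t - (a + s) <= 1 by lra.
  have := P1 _ _ h1 h3 h2 h4; rewrite (_ : a + t - (a + s) = t - s); last by ring.
  rewrite -mulrBr -(ler_pM2l a0); apply: le_trans.
  rewrite /k /g pE //; last by apply: le_trans h2.
  rewrite -mulrA; apply: ler_wpM2r; first by rewrite mulr_ge0 ?subr_ge0 // ltW.
  by rewrite -[leRHS](exp1 alpha_gt1); exact: exp_le.
- move=> s t u s0 st tu ub g1 g2.
  rewrite (rho_intD alpha_gt1 rho_gt0 harnack kl st tu); lra.
Qed.

End Estimates.

(** * Uniformity *)

Section Uniform.
Context {R : realType} {Z : metricType R} (alpha tau : R) (S : int -> set Z).
Hypotheses (alpha_gt1 : 1 < alpha) (tau_gt3 : 3 < tau).
Hypothesis S_max : forall n, maximal_separated (alpha ^ (- n)) (S n).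

Local Notation X := (filling alpha tau S).
Local Notation d := (@path_dist R Z alpha tau S).
Local Notation rho := (@filling_density R Z alpha tau S).
Local Notation dr := (rho_dist d rho).
Local Notation E t := (alpha `^ t).
Implicit Types (x y w : X) (c : R -> X) (a b s t : R) (u v : nat -> X).

Let dM : is_metric_on setT d := path_dist_metric alpha_gt1 tau_gt3 S_max.
Let rho_gt0 x : 0 < rho x := filling_density_gt0 alpha_gt1 x.
Let drM : is_metric_on setT dr := filling_rho_metric alpha_gt1 tau_gt3 S_max.
Let dc0 : 0 < density_const alpha := density_const_gt0 alpha_gt1.
Let variation x y : `|rho x - rho y| <= density_const alpha * dr x y :=
  rho_variation alpha_gt1 tau_gt3 S_max x y.

(** [rho] is Lipschitz for d_rho, hence converges along u. Were the limit positive, [filling_rho_ge]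
    would make u Cauchy for d, and by completeness its limit would lie in X. *)
Lemma boundary_rho0 xi u : metric_boundary dr xi -> xi u ->
  rho (u n) @[n --> \oo] --> (0 : R).
Proof.
move=> bxi xiu; have [cxi _] := bxi.
have nlim := (metric_boundaryP drM cxi xiu).1 bxi.
have [/(cauchyP drM) cu _] := completion_mem drM cxi xiu.
have [|r rP] := @cauchy_seq_cvg R (fun n => rho (u n)).
  move=> e e0; have [N NP] := cu (e / density_const alpha) (divr_gt0 e0 dc0).
  exists N => m n Nm Nn; apply: le_lt_trans (variation _ _) _.
  by rewrite mulrC -ltr_pdivlMr //; exact: NP.
have r0 : 0 <= r.
  by apply: (cvg_seq_ge rP); exists 0%N => n _; exact: ltW.
have [rE|rn0] := eqVneq r 0; first by rewrite rE in rP.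
have {}r0 : 0 < r by rewrite lt_neqAle eq_sym rn0.
have [N NP] : exists N, forall n, (N <= n)%N -> r / 2 < rho (u n).
  move/cvg_seqP : rP => /(_ (r / 2)); rewrite divr_gt0 // => /(_ isT)[N NP].
  by exists N => n /NP; rewrite ltr_norml => /andP[]; lra.
have cd : cauchy_seq d u.
  apply/(cauchyP dM) => e e0; have e1 : 0 < Num.min 1 e by rewrite lt_min ltr01.
  have k0 : 0 < r / 2 * Num.min 1 e / E 3 by rewrite !divr_gt0 ?mulr_gt0 ?exp_gt0 // divr_gt0.
  have [M MP] := cu _ k0; exists (maxn N M) => m n; rewrite !geq_max.
  move=> /andP[Nm Mm] /andP[_ Mn].
  have := MP _ _ Mm Mn; rewrite ltr_pdivlMr ?exp_gt0 // mulrC => h1.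
  have h2 := filling_rho_ge alpha_gt1 tau_gt3 S_max (u m) (u n).
  have h3 := le_lt_trans h2 h1.
  have h4 : r / 2 * Num.min 1 (d (u m) (u n)) < r / 2 * Num.min 1 e.
    apply: le_lt_trans h3; apply: ler_wpM2r; last exact/ltW/NP.
    by rewrite le_min ler01 (dist_ge0 dM).
  move: h4; rewrite ltr_pM2l ?divr_gt0 // lt_min !gt_min ltxx /=.
  by move=> /andP[h5 /orP[h6|//]]; exact: lt_trans h5 h6.
have [x ux] := filling_complete alpha_gt1 tau_gt3 S_max cd.
case: (nlim x); apply: (cvg0_sym drM); apply/(dist_cvg0P drM) => e e0.
move/(cvg0_sym dM)/(dist_cvg0P dM) : ux => ux.
pose k := 2 * E 2 * rho x; have k0 : 0 < k by rewrite !mulr_gt0 ?exp_gt0.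
have e1 : 0 < Num.min 1 (e / k) by rewrite lt_min ltr01 divr_gt0.
have [M MP] := ux _ e1; exists M => n /MP; rewrite lt_min => /andP[h1 h2].
apply: le_lt_trans (filling_rho_near alpha_gt1 tau_gt3 S_max (ltW h1)) _.
by rewrite -/k mulrC -ltr_pdivlMr.
Qed.

Lemma boundary_dist_ge x xi : metric_boundary dr xi ->
  rho x <= density_const alpha * completion_dist dr (to_completion dr x) xi.
Proof.
move=> bxi; have [cxi _] := bxi; have [u xu] := completion_inh drM cxi.
rewrite mulrC -ler_pdivrMr //; apply/ler_addgt0Pr => e e0; rewrite -lerBlDr.
apply: (completion_dist_ge drM (completion_to drM x) cxi (to_completion_cst drM x) xu).
have /cvg_seqP/(_ _ (mulr_gt0 e0 dc0)) [N NP] := boundary_rho0 bxi xu.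
exists N => n /NP; rewrite subr0 gtr0_norm // => h.
have := le_trans (ler_norm _) (variation x (u n)) => h'.
rewrite lerBlDr ler_pdivrMr // mulrDl; lra.
Qed.

(** The boundary must be nonempty, as the infimum of the empty set is 0. *)
Lemma dist_to_boundary_ge x : metric_boundary dr !=set0 ->
  rho x <= density_const alpha * dist_to_boundary dr x.
Proof.
move=> [xi bxi]; rewrite mulrC -ler_pdivrMr //; apply: lb_le_inf.
  by exists (completion_dist dr (to_completion dr x) xi); exists xi.
move=> _ [zeta bz <-]; rewrite ler_pdivrMr // mulrC; exact: boundary_dist_ge.
Qed.

Lemma left_end_proper (I : set R) : I !=set0 -> ProperFilter (left_end I).
Proof.
move=> [t0 It0]; apply: filter_from_proper; last by move=> s Is; exists s.
apply: filter_from_filter; first by exists t0.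
move=> s t Is It; exists (Num.min s t); first by case: (leP s t).
by move=> r [Ir]; rewrite le_min => /andP[h1 h2].
Qed.

Lemma right_end_proper (I : set R) : I !=set0 -> ProperFilter (right_end I).
Proof.
move=> [t0 It0]; apply: filter_from_proper; last by move=> s Is; exists s.
apply: filter_from_filter; first by exists t0.
move=> s t Is It; exists (Num.max s t); first by case: (leP s t).
by move=> r [Ir]; rewrite ge_max => /andP[h1 h2].
Qed.

(** One summand for each of the two conditions of uniformity, and 1 to make it at least 1. *)
Definition uniform_const : R :=
  2 * E 2 * geod_const alpha tau + density_const alpha * dist_const alpha * min_const alpha tau + 1.

Lemma uniform_const_ge1 : 1 <= uniform_const.
Proof.
have g0 := geod_const_gt0 alpha_gt1 tau_gt3; have d0 := dist_const_gt0 alpha_gt1.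
have m0 := min_const_gt0 alpha_gt1 tau_gt3.
by rewrite /uniform_const lerDr; apply: ltW; positivity.
Qed.

(** * Uniformity of geodesics and of rough geodesics *)

Section UniformCurve.
Variables (I : set R) (c : R -> X).
Hypotheses (Ii : is_interval I) (I0 : I !=set0).
Hypothesis cl : forall s t, I s -> I t -> s <= t -> d (c s) (c t) <= t - s.
(** Being a rough geodesic need not pass to subintervals, because of the multiplicative bound.
    Requiring it only on enclosing intervals covers geodesics on any interval as well as one rough
    geodesic on a segment. *)
Hypothesis c_cofinal : forall s t, I s -> I t -> s <= t ->
  exists s' t', [/\ I s', I t', s' <= s, t <= t' & rough_geodesic c s' t'].

(** The additive bound, unlike the multiplicative one, does pass to subintervals. *)
Let c_add s t : I s -> I t -> s <= t -> t - s <= d (c s) (c t) + 1.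
Proof.
move=> Is It st; have [s' [t' [Is' It' ss tt [st' _ _ h]]]] := c_cofinal Is It st.
have := cl Is' Is ss; have := cl It It' tt.
have := dist_tri dM (c s) (c s') (c t'); have := dist_tri dM (c t) (c s) (c t'); lra.
Qed.

Let lip_on s t : I s -> I t -> lipschitz_on c s t.
Proof.
move=> Is It a b sa ab bt; apply: cl => //.
  by apply: (Ii Is It); rewrite sa (le_trans ab).
by apply: (Ii Is It); rewrite bt (le_trans sa).
Qed.

Lemma rough_curve : curve dr I c.
Proof.
split=> // t It; apply/cvgrPdist_lt => e e0; rewrite near_withinE.
pose k := 2 * E 2 * rho (c t); have k0 : 0 < k by rewrite !mulr_gt0 ?exp_gt0.
have r0 : 0 < Num.min 1 (e / k) by rewrite lt_min ltr01 divr_gt0.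
apply/nbhs_ballP; exists (Num.min 1 (e / k)) => //= s; rewrite /ball /= lt_min.
move=> /andP[h1 h2] Is; rewrite sub0r normrN ger0_norm ?(dist_ge0 drM) //.
have ds : d (c t) (c s) <= `|t - s|.
  case: (leP s t) => st; first by rewrite (dist_sym dM) ger0_norm ?subr_ge0 // cl.
  by rewrite distrC gtr0_norm ?subr_gt0 // cl // ltW.
apply: le_lt_trans (filling_rho_near alpha_gt1 tau_gt3 S_max (le_trans ds (ltW h1))) _.
by rewrite -/k mulrC -ltr_pdivlMr //; exact: le_lt_trans ds h2.
Qed.

(** For s <= t <= r, [geo_min] makes one of the pieces [s, t] and [t, r] short. If some left piece
    is long, every right piece is therefore short, and otherwise every left piece is. *)
Lemma rough_cigar t : I t ->
  (Order.min (curve_length dr c (I `&` [set s | s <= t]%R))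
             (curve_length dr c (I `&` [set s | t <= s]%R))
   <= (dist_const alpha * min_const alpha tau * rho (c t))%:E)%E.
Proof.
move=> It; set K := _ * rho (c t).
have dc := dist_const_gt0 alpha_gt1; have mc := min_const_gt0 alpha_gt1 tau_gt3.
have r0 := rho_gt0 (c t).
have K0 : 0 <= K by apply: ltW; rewrite /K; positivity.
have key s r : I s -> I r -> s <= t -> t <= r ->
    (curve_length dr c `[s, t] <= K%:E)%E \/ (curve_length dr c `[t, r] <= K%:E)%E.
  move=> Is Ir st tr.
  have h1 := curve_geo_length alpha_gt1 tau_gt3 S_max st (lip_on Is It) (c_add Is It st).
  have h2 := curve_geo_length alpha_gt1 tau_gt3 S_max tr (lip_on It Ir) (c_add It Ir tr).
  have h3 : d (c s) (c t) + d (c t) (c r) <= d (c s) (c r) + 1.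
    have := c_add Is Ir (le_trans st tr); have := cl Is It st; have := cl It Ir tr; lra.
  have := geo_min alpha_gt1 tau_gt3 S_max h3; rewrite ge_min => /orP[h|h]; [left|right].
    apply: le_trans h1 _; rewrite lee_fin /K -[leRHS]mulrA ler_pM2l //.
  apply: le_trans h2 _; rewrite lee_fin /K -[leRHS]mulrA ler_pM2l //.
have [h|h] := pselect (exists2 s, I s & s <= t /\ ~~ (curve_length dr c `[s, t] <= K%:E)%E).
  have [s Is [st sK]] := h; rewrite ge_min; apply/orP; right.
  apply: curve_length_le => // x l xl lI.
  have [Ir tr] : I (last x l) /\ t <= last x l by apply: lI; exact: mem_last.
  have [k|k] := key s _ Is Ir st tr; first by rewrite k in sK.
  rewrite -lee_fin; apply: le_trans k; apply: le_curve_length => // y yl.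
  rewrite /= in_itv /=; have [_ ->] := lI y yl => /=.
  exact: path_le_last.
rewrite ge_min; apply/orP; left; apply: curve_length_le => // x l xl lI.
have [Ix xt] : I x /\ x <= t by apply: lI; exact: mem_head.
have [k|k] := boolP (curve_length dr c `[x, t] <= K%:E)%E; last by case: h; exists x.
rewrite -lee_fin; apply: le_trans k; apply: le_curve_length => // y yl.
rewrite /= in_itv /=; have [_ ->] := lI y yl; rewrite andbT.
by move: yl; rewrite inE => /orP[/eqP -> //|]; exact: path_ge.
Qed.

(** A chain within e of the total length leaves less than e for whatever is added before its first
    point. *)
Lemma length_left_end (e : R) : (curve_length dr c I < +oo)%E -> 0 < e ->
  exists2 A, left_end I A & forall s t, A s -> A t -> dr (c s) (c t) <= e.
Proof.
move=> fin e0; have [x [l [xl lI h]]] := curve_length_approx I0 fin e0.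
have Ix : I x by apply: lI; exact: mem_head.
exists [set t | I t /\ t <= x]; first by exists x.
have key s t : I s -> I t -> s <= t -> t <= x -> dr (c s) (c t) <= e.
  move=> Is It st tx; have := @le_curve_length _ _ dr c I s (t :: x :: l).
  rewrite /= st tx xl => /(_ isT); set L := curve_length dr c I.
  have fL : L \is a fin_num by rewrite ge0_fin_numE ?curve_length_ge0.
  rewrite -(fineK fL) lee_fin => H.
  have : dr (c s) (c t) + (dr (c t) (c x) + chain_length dr c x l) <= fine L.
    by apply: H => y; rewrite !inE => /or3P[/eqP ->|/eqP ->|] // /lI.
  by have := dist_ge0 drM (c t) (c x); rewrite -/L in h; lra.
move=> s t [Is sx] [It tx]; case: (leP s t) => st; first exact: key.
by rewrite (dist_sym drM); apply: key => //; exact: ltW.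
Qed.

Lemma length_right_end (e : R) : (curve_length dr c I < +oo)%E -> 0 < e ->
  exists2 A, right_end I A & forall s t, A s -> A t -> dr (c s) (c t) <= e.
Proof.
move=> fin e0; have [x [l [xl lI h]]] := curve_length_approx I0 fin e0.
have Iz : I (last x l) by apply: lI; exact: mem_last.
exists [set t | I t /\ last x l <= t]; first by exists (last x l).
have key s t : I s -> I t -> s <= t -> last x l <= s -> dr (c s) (c t) <= e.
  move=> Is It st tx; have := @le_curve_length _ _ dr c I x (l ++ [:: s; t]).
  rewrite cat_path /= xl tx st => /(_ isT); set L := curve_length dr c I.
  have fL : L \is a fin_num by rewrite ge0_fin_numE ?curve_length_ge0.
  rewrite -(fineK fL) lee_fin chain_length_cat /= addr0 => H.
  have : chain_length dr c x l + (dr (c (last x l)) (c s) + dr (c s) (c t)) <= fine L.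
    apply: H => y; rewrite -cat_cons mem_cat !inE -/(y \in x :: l).
    by rewrite -[_ || (y \in l)]/(y \in x :: l) => /orP[/lI //|/orP[] /eqP ->].
  by have := dist_ge0 drM (c (last x l)) (c s); rewrite -/L in h; lra.
move=> s t [Is sx] [It tx]; case: (leP s t) => st; first exact: key.
by rewrite (dist_sym drM); apply: key => //; exact: ltW.
Qed.

(** A given chain is enclosed in a rough geodesic whose ends are moreover close to the limit points
    of c; its length bound then passes to the limit. *)
Lemma rough_uniform_length : (curve_length dr c I < +oo)%E ->
  exists xim xip, [/\ completion dr xim, completion dr xip,
    completion_dist dr (to_completion dr (c t)) xim @[t --> left_end I] --> (0 : R),
    completion_dist dr (to_completion dr (c t)) xip @[t --> right_end I] --> (0 : R) &
    (curve_length dr c I <=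
      (2 * E 2 * geod_const alpha tau * completion_dist dr xim xip)%:E)%E].
Proof.
move=> fin; have FL := left_end_proper I0; have FR := right_end_proper I0.
have [xim cm lm] := cauchy_filter_cvg drM FL (fun e e0 => length_left_end fin e0).
have [xip cp lp] := cauchy_filter_cvg drM FR (fun e e0 => length_right_end fin e0).
exists xim, xip; split=> //.
have [m0 _ ms mt] := completion_metric drM.
have ct t := completion_to drM (c t).
set K := 2 * E 2 * geod_const alpha tau.
have K0 : 0 < K.
  have := geod_const_gt0 alpha_gt1 tau_gt3; rewrite /K => g0; positivity.
apply: curve_length_le => [|x l xl lI]; first by rewrite mulr_ge0 ?m0 // ltW.
apply/ler_addgt0Pr => e e0; have e'0 : 0 < e / 2 / K by rewrite !divr_gt0.
have [s0 Is0 s0P] : exists2 s0, I s0 & forall s, I s -> s <= s0 ->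
    completion_dist dr (to_completion dr (c s)) xim <= e / 2 / K.
  move/cvgrPdist_le : lm => /(_ _ e'0)[s0 Is0 s0P]; exists s0 => // s Is ss.
  have := s0P s (conj Is ss); rewrite /= sub0r normrN; apply: le_trans; exact: ler_norm.
have [t0 It0 t0P] : exists2 t0, I t0 & forall t, I t -> t0 <= t ->
    completion_dist dr (to_completion dr (c t)) xip <= e / 2 / K.
  move/cvgrPdist_le : lp => /(_ _ e'0)[t0 It0 t0P]; exists t0 => // t It tt.
  have := t0P t (conj It tt); rewrite /= sub0r normrN; apply: le_trans; exact: ler_norm.
have Ix : I x by apply: lI; exact: mem_head.
have Iz : I (last x l) by apply: lI; exact: mem_last.
have xz : x <= last x l by apply: path_le_last => //; exact: mem_head.
have [|||s [t [Is It ss tt rc]]] := @c_cofinal (Num.min x s0) (Num.max (last x l) t0).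
- by case: (leP x s0).
- by case: (leP (last x l) t0).
- by rewrite ge_min le_max xz.
have [sx ss0] : s <= x /\ s <= s0 by split; apply: le_trans ss _; rewrite ge_min lexx ?orbT.
have [zt t0t] : last x l <= t /\ t0 <= t.
  by split; apply: le_trans tt; rewrite le_max lexx ?orbT.
have h1 := rough_length alpha_gt1 tau_gt3 S_max rc.
have h2 : chain_length dr c x l <= K * dr (c s) (c t).
  rewrite -lee_fin; apply: le_trans h1; apply: le_curve_length => // y yl.
  rewrite /= in_itv /= (le_trans _ zt) ?path_le_last // andbT.
  by move: yl; rewrite inE => /orP[/eqP -> //|/(path_ge xl)]; exact: le_trans.
have h3 : dr (c s) (c t) = completion_dist dr (to_completion dr (c s)) (to_completion dr (c t)).
  apply: esym; apply: (completion_distE drM (ct s) (ct t)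
    (to_completion_cst drM _) (to_completion_cst drM _)); exact: cvg_cst.
have h4 := mt _ xim _ (ct s) cm (ct t); have h5 := mt _ xip _ cm cp (ct t).
rewrite (ms xip _ cp (ct t)) in h5.
have h6 := s0P s Is ss0; have h7 := t0P t It t0t.
apply: le_trans h2 _; rewrite h3.
have h8 : completion_dist dr (to_completion dr (c s)) (to_completion dr (c t)) <=
    completion_dist dr xim xip + e / K.
  have -> : e / K = e / 2 / K + e / 2 / K by field; rewrite gt_eqF.
  lra.
apply: le_trans (ler_wpM2l (ltW K0) h8) _.
by rewrite mulrDr mulrCA divff ?gt_eqF // mulr1.
Qed.

Lemma rough_uniform : metric_boundary dr !=set0 ->
  (curve_length dr c I = +oo%E -> forall s t, I s -> I t -> s <= t ->
    rough_geodesic c s t) ->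
  uniform_curve dr uniform_const I c.
Proof.
move=> bne hinf; have uc := uniform_const_ge1.
have g0 := geod_const_gt0 alpha_gt1 tau_gt3; have k0 := dist_const_gt0 alpha_gt1.
have m0 := min_const_gt0 alpha_gt1 tau_gt3.
have e2 : 0 < 2 * E 2 by rewrite mulr_gt0 ?exp_gt0.
split; first exact: rough_curve.
- move=> fin; have [xim [xip [cm cp lm lp h]]] := rough_uniform_length fin.
  exists xim, xip; split=> //; apply: le_trans h _; rewrite lee_fin.
  have [+ _ _ _] := completion_metric drM => /(_ _ _ cm cp) h.
  apply: ler_wpM2r => //; rewrite /uniform_const -addrA lerDl.
  by apply: ltW; positivity.
- move=> inf; set K := 2 * E 2 * geod_const alpha tau.
  have K0 : 0 < K by rewrite /K mulr_gt0.
  have FL := left_end_proper I0; have FR := right_end_proper I0.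
  apply/cvgryPge => B.
  (* Once an interval contains a chain longer than K B, [rough_length] forces its endpoints more
     than B apart in d_rho. *)
  have [x [l [xl lI lB]]] : exists (x : R) (l : seq R), [/\ path <=%R x l,
      forall y : R, y \in x :: l -> I y & K * B < chain_length dr c x l].
    apply: contrapT => h.
    have : (curve_length dr c I <= (Num.max 0 (K * B))%:E)%E.
      apply: curve_length_le => [|x l xl lI]; first by rewrite le_max lexx.
      rewrite le_max; apply/orP; right; rewrite leNgt; apply/negP => lB.
      by apply: h; exists x, l.
    by rewrite inf leNgt ltry.
  have Ix : I x by apply: lI; exact: mem_head.
  have Iz : I (last x l) by apply: lI; exact: mem_last.
  exists ([set t | I t /\ t <= x], [set t | I t /\ last x l <= t]).
    by split; [exists x|exists (last x l)].
  move=> [s t] [/= [Is sx] [It zt]].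
  have xz : x <= last x l by apply: path_le_last => //; exact: mem_head.
  have rc := hinf inf s t Is It (le_trans sx (le_trans xz zt)).
  have h1 := rough_length alpha_gt1 tau_gt3 S_max rc.
  rewrite -(ler_pM2l K0); apply: le_trans (ltW lB) _.
  rewrite -lee_fin; apply: le_trans h1; apply: le_curve_length => // y yl.
  rewrite /= in_itv /= (le_trans _ zt) ?path_le_last // andbT.
  by move: yl; rewrite inE => /orP[/eqP -> //|/(path_ge xl)]; exact: le_trans.
- move=> t It; apply: le_trans (rough_cigar It) _; rewrite lee_fin.
  have h1 := dist_to_boundary_ge (c t) bne.
  have D0 : 0 <= dist_to_boundary dr (c t).
    rewrite -(pmulr_rge0 _ dc0); exact: le_trans (ltW (rho_gt0 _)) h1.
  have h2 := ler_wpM2l (mulr_ge0 (ltW k0) (ltW m0)) h1.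
  apply: le_trans h2 _.
  rewrite (_ : _ * _ * _ = density_const alpha * dist_const alpha * min_const alpha tau *
    dist_to_boundary dr (c t)); last by ring.
  apply: ler_wpM2r => //; rewrite /uniform_const.
  have : 0 < 2 * E 2 * geod_const alpha tau by positivity.
  lra.
Qed.

End UniformCurve.

Lemma geodesic_uniform I c : metric_boundary dr !=set0 -> geodesic d I c ->
  uniform_curve dr uniform_const I c.
Proof.
move=> bne [Ii I0 cg].
have cd s t : I s -> I t -> s <= t -> d (c s) (c t) = t - s.
  by move=> Is It st; rewrite cg // distrC ger0_norm // subr_ge0.
have rough s t : I s -> I t -> s <= t -> rough_geodesic c s t.
  move=> Is It st; split=> //; rewrite ?cd //; try lra.
  move=> a b sa ab bt; rewrite cd //.
    by apply: (Ii _ _ Is It); rewrite sa (le_trans ab).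
  by apply: (Ii _ _ Is It); rewrite bt (le_trans sa).
apply: rough_uniform => // [s t Is It st|s t Is It st].
  by rewrite cd.
by exists s, t; split=> //; exact: rough.
Qed.

Lemma filling_uniform_space : metric_boundary dr !=set0 ->
  uniform_space dr uniform_const.
Proof.
move=> bne; split=> // x y.
(* Equal points need a constant curve, since the excess allowed below is min 1 (d x y), which has to
   be positive. *)
have [xy|xy] := eqVneq (d x y) 0.
  exists 0, 0, (fun=> x); split=> //; first exact: (dist0P dM x y).1.
  apply: geodesic_uniform => //; split; first exact: interval_is_interval.
    by exists 0; rewrite /= in_itv /= lexx.
  move=> s t; rewrite /= !in_itv /= -!eq_le => /eqP <- /eqP <-.
  by rewrite subrr normr0 (distxx dM).
have dxy : 0 < d x y by rewrite lt_neqAle eq_sym xy (dist_ge0 dM).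
have e0 : 0 < Num.min 1 (d x y) by rewrite lt_min ltr01.
have [g [l [l0 gl gx gy h]]] := path_dist_length alpha_gt1 tau_gt3 S_max x y e0.
have h1 : l <= d x y + 1 by apply: le_trans h _; rewrite lerD2l ge_min lexx.
have h2 : l <= d x y + d x y by apply: le_trans h _; rewrite lerD2l ge_min lexx orbT.
have rc : rough_geodesic g 0 l.
  by split; rewrite ?subr0 ?gx ?gy //; [exact: lipschitz1_on|lra].
exists 0, l, g; split=> //; apply: rough_uniform => //.
- exact: interval_is_interval.
- by exists 0; rewrite /= in_itv /= lexx.
- by move=> s t _ _ st; apply: (lipschitz1_on gl (lexx s) st (lexx t)).
- move=> s t; rewrite /= !in_itv /= => /andP[s0 sl] /andP[t0 tl] st.
  by exists 0, l; rewrite !in_itv /= !lexx l0.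
- move=> inf; have := rough_length alpha_gt1 tau_gt3 S_max rc.
  by rewrite inf leNgt ltry.
Qed.
End Uniform.

(** * Boundary points as classes of sequences *)

Section Boundary.
Context {R : realType} {Z : metricType R} (alpha tau : R) (S : int -> set Z).
Hypotheses (alpha_gt1 : 1 < alpha) (tau_gt3 : 3 < tau).
Hypothesis S_max : forall n, maximal_separated (alpha ^ (- n)) (S n).

Local Notation X := (filling alpha tau S).
Local Notation d := (@path_dist R Z alpha tau S).
Local Notation rho := (@filling_density R Z alpha tau S).
Local Notation dr := (rho_dist d rho).
Local Notation E t := (alpha `^ t).
Local Notation gp := (gromov_prod d).
Implicit Types (x y p : X) (c : R -> X) (a b s t e : R) (u v : nat -> X).

Let dM : is_metric_on setT d := path_dist_metric alpha_gt1 tau_gt3 S_max.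
Let rho_gt0 x : 0 < rho x := filling_density_gt0 alpha_gt1 x.
Let drM : is_metric_on setT dr := filling_rho_metric alpha_gt1 tau_gt3 S_max.
Let variation x y : `|rho x - rho y| <= density_const alpha * dr x y :=
  rho_variation alpha_gt1 tau_gt3 S_max x y.
Let quasi_gt0 x y : 0 < quasi x y := quasi_gt0 alpha_gt1 x y.
Let geo_gt0 x y : 0 < geo x y := geo_gt0 alpha_gt1 x y.
Let quasi_sym x y : quasi x y = quasi y x := quasi_sym x y.
Let quasi_tri p x y : quasi x y <= quasi x p + quasi p y := quasi_tri alpha_gt1 p x y.
Let geo_quasi x y : geo x y <= E 4 * quasi x y := geo_quasi alpha_gt1 tau_gt3 S_max x y.
Let quasi_geo x y : quasi x y <= quasi_const alpha tau * geo x y :=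
  quasi_geo alpha_gt1 tau_gt3 S_max x y.
Let q0 : 0 < quasi_const alpha tau := quasi_const_gt0 alpha_gt1 tau_gt3.

Lemma mdist_metric : is_metric_on setT (@mdist R Z).
Proof.
split=> *; [exact: mdist_ge0|split=> [|->]|exact: metric_sym|exact: metric_triangle].
  exact: mdist_positivity.
exact: mdistxx.
Qed.

(** Change of base point: [geo] is the exponential of minus the product based at omega, while
    [gromov_prod] is based at p. *)
Lemma gromov_prod_geo p x y : E (- gp p x y) * (geo x p * geo y p) = rho p * geo x y.
Proof.
rewrite /geo /filling_density -!expD // /gromov_prod; congr (_ `^ _); lra.
Qed.

(** With [gromov_prod_small] this is a dictionary: the product at p is large exactly when
    [quasi x y] is small relative to the product of the [quasi] distances to p. *)
Lemma gromov_prod_large p (K : R) : exists2 e, 0 < e & forall x y,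
  quasi x y <= e * (quasi x p * quasi y p) -> K <= gp p x y.
Proof.
set C := E 4 * quasi_const alpha tau ^+ 2 * rho p.
have r0 := rho_gt0 p; have C0 : 0 < C by rewrite /C; positivity.
exists (E (- K) / C) => [|x y h]; first by rewrite divr_gt0 ?exp_gt0.
rewrite -lerN2 -(exp_leE alpha_gt1).
have g0 : 0 < geo x p * geo y p by rewrite mulr_gt0.
rewrite -(ler_pM2r g0) gromov_prod_geo.
have h1 : quasi x p * quasi y p <= quasi_const alpha tau ^+ 2 * (geo x p * geo y p).
  have := ler_pM (ltW (quasi_gt0 x p)) (ltW (quasi_gt0 y p)) (quasi_geo x p) (quasi_geo y p).
  by move=> /le_trans; apply; rewrite expr2 mulrACA.
have k0 : 0 <= E (- K) / C by rewrite ltW // divr_gt0 ?exp_gt0.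
have h2 := le_trans h (ler_wpM2l k0 h1).
have h3 := le_trans (geo_quasi x y) (ler_wpM2l (exp_ge0 alpha_gt1 4) h2).
apply: le_trans (ler_wpM2l (ltW (rho_gt0 p)) h3) _.
rewrite le_eqVlt; apply/orP; left; apply/eqP; rewrite /C.
by field; rewrite !gt_eqF ?exp_gt0.
Qed.

Lemma gromov_prod_small p e : 0 < e -> exists K : R, forall x y,
  K <= gp p x y -> quasi x y <= e * (quasi x p * quasi y p).
Proof.
move=> e0; set C := quasi_const alpha tau / rho p * E 4 ^+ 2.
have r0 := rho_gt0 p; have C0 : 0 < C by rewrite /C; positivity.
have eC : 0 < e / C by rewrite divr_gt0.
exists (- (ln (e / C) / ln alpha)) => x y hK.
have h : E (- gp p x y) <= e / C.
  by rewrite -[leRHS](exp_log alpha_gt1) // exp_leE // lerNl.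
have g0 : 0 < geo x p * geo y p by rewrite mulr_gt0.
have h0 := gromov_prod_geo p x y.
have h1 : geo x p * geo y p <= E 4 ^+ 2 * (quasi x p * quasi y p).
  have := ler_pM (ltW (geo_gt0 x p)) (ltW (geo_gt0 y p)) (geo_quasi x p) (geo_quasi y p).
  by move=> /le_trans; apply; rewrite expr2 mulrACA.
have h2 : geo x y = (rho p)^-1 * (E (- gp p x y) * (geo x p * geo y p)).
  by rewrite h0 mulrA mulVf ?mul1r // gt_eqF.
apply: le_trans (quasi_geo x y) _; rewrite h2.
have k0 : 0 <= quasi_const alpha tau / rho p by rewrite ltW // divr_gt0.
have h3 : E (- gp p x y) * (geo x p * geo y p) <= e / C * (E 4 ^+ 2 * (quasi x p * quasi y p)).
  by apply: ler_pM => //; [exact: exp_ge0|exact: ltW].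
rewrite [leLHS]mulrA; apply: le_trans (ler_wpM2l k0 h3) _.
rewrite le_eqVlt; apply/orP; left; apply/eqP; rewrite /C.
by field; rewrite !gt_eqF ?exp_gt0.
Qed.

Definition quasi_cauchy u := forall e, 0 < e -> exists N, forall m n,
  (N <= m)%N -> (N <= n)%N -> quasi (u m) (u n) < e.

Definition quasi_equiv u v := forall e, 0 < e -> exists N, forall n,
  (N <= n)%N -> quasi (u n) (v n) < e.

Definition quasi_class u : set (nat -> X) :=
  [set v | quasi_cauchy v /\ quasi_equiv u v].

Definition quasi_unbounded u := forall p (K : R), exists N, forall n,
  (N <= n)%N -> K <= quasi (u n) p.

Lemma quasi_unbounded_pair u v p e : quasi_unbounded u -> quasi_unbounded v -> 0 < e ->
  exists N, forall m n, (N <= m)%N -> (N <= n)%N ->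
    quasi (u m) (v n) <= e * (quasi (u m) p * quasi (v n) p).
Proof.
(* If A and B are at least 2 / e, then each of them is at most e A B / 2, so A + B <= e A B. *)
move=> uu vu e0; have [N NP] := uu p (2 / e); have [M MP] := vu p (2 / e).
exists (maxn N M) => m n; rewrite !geq_max => /andP[/NP h1 _] /andP[_ /MP h2].
have := quasi_tri p (u m) (v n); rewrite (quasi_sym p).
move: h1 h2; rewrite !ler_pdivrMr //.
have := quasi_gt0 (u m) p; have := quasi_gt0 (v n) p.
move: (quasi (u m) p) (quasi (v n) p) (quasi (u m) (v n)) => A B Q B0 A0 h1 h2 hQ.
have := ler_wpM2l (ltW B0) h1; have := ler_wpM2l (ltW A0) h2; lra.
Qed.

Lemma gromov_seq_unbounded u : quasi_unbounded u -> gromov_seq d u.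
Proof.
move=> uu p; apply/cvg_pair_pinftyP => K; have [e e0 eP] := gromov_prod_large p K.
have [N NP] := quasi_unbounded_pair p uu uu e0.
by exists N => m n Nm Nn; apply: eP; exact: NP.
Qed.

Lemma quasi_small_pair p e x y : quasi x y <= e * (rho p * rho p) -> 0 < e ->
  quasi x y <= e * (quasi x p * quasi y p).
Proof.
move=> h e0; apply: le_trans h _; rewrite ler_pM2l //.
by apply: ler_pM; rewrite ?(ltW (rho_gt0 p)) // quasi_sym; exact: quasi_ge_rho alpha_gt1 _ _.
Qed.

Lemma gromov_seq_cauchy u : quasi_cauchy u -> gromov_seq d u.
Proof.
move=> uu p; apply/cvg_pair_pinftyP => K; have [e e0 eP] := gromov_prod_large p K.
have [|N NP] := uu (e * (rho p * rho p)); first by rewrite !mulr_gt0.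
exists N => m n Nm Nn; apply: eP; apply: quasi_small_pair => //; exact/ltW/NP.
Qed.

Lemma quasi_cauchy_bounded u p : quasi_cauchy u -> exists2 K : R, 0 < K &
  exists N, forall n, (N <= n)%N -> quasi (u n) p <= K.
Proof.
move=> cu; have [N NP] := cu 1 ltr01; exists (1 + quasi (u N) p).
  by rewrite addr_gt0.
exists N => n Nn; have := quasi_tri (u N) (u n) p; have := NP n N Nn (leqnn N); lra.
Qed.

Lemma quasi_cauchy_not_unbounded u p : quasi_cauchy u -> ~ quasi_unbounded u.
Proof.
move=> cu uu; have [K K0 [N NP]] := quasi_cauchy_bounded p cu.
have [M MP] := uu p (K + 1); have := NP _ (leq_maxl N M); have := MP _ (leq_maxr N M).
lra.
Qed.

(* If [quasi (u n) p] does not tend to infinity, the Gromov condition against one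
   bounded term of the sequence bounds all later terms. *)
Lemma gromov_seq_dichotomy u : gromov_seq d u -> quasi_unbounded u \/ quasi_cauchy u.
Proof.
move=> gu; have [uu|uu] := pselect (quasi_unbounded u); [by left|right].
have small p e : 0 < e -> exists N, forall m n, (N <= m)%N -> (N <= n)%N ->
    quasi (u m) (u n) <= e * (quasi (u m) p * quasi (u n) p).
  move=> e0; have [K KP] := gromov_prod_small p e0.
  have /cvg_pair_pinftyP/(_ K)[N NP] := gu p.
  by exists N => m n Nm Nn; apply: KP; exact: NP.
have [p [K hK]] : exists p (K : R), forall N, exists2 n, (N <= n)%N & quasi (u n) p < K.
  apply: contrapT => h; apply: uu => p K; apply: contrapT => h'; apply: h.
  exists p, K => N; apply: contrapT => h''; apply: h'; exists N => n Nn.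
  by rewrite leNgt; apply/negP => k; apply: h''; exists n.
have K0 : 0 < K by have [n _] := hK 0%N; apply: lt_trans; exact: quasi_gt0.
(* With this factor the bound from the Gromov condition is at most half of [quasi (u m) p] and is
   absorbed in the triangle inequality. *)
have e0 : 0 < (2 * K)^-1 by rewrite invr_gt0 mulr_gt0.
have [N NP] := small p _ e0; have [n0 Nn0 n0K] := hK N.
have bd m : (N <= m)%N -> quasi (u m) p <= 2 * K.
  move=> Nm; have h1 := NP m n0 Nm Nn0; have h2 := quasi_tri (u n0) (u m) p.
  have h3 : (2 * K)^-1 * (quasi (u m) p * quasi (u n0) p) <= quasi (u m) p / 2.
    rewrite mulrCA ler_pM2l // ler_pdivrMl ?mulr_gt0 //; lra.
  lra.
move=> e e1.
have e2 : 0 < e / (2 * K) / (2 * K) / 2 by rewrite !divr_gt0 // mulr_gt0.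
have [M MP] := small p _ e2; exists (maxn N M) => m n.
rewrite !geq_max => /andP[Nm Mm] /andP[Nn Mn]; apply: le_lt_trans (MP _ _ Mm Mn) _.
have h : quasi (u m) p * quasi (u n) p <= (2 * K) * (2 * K).
  by apply: ler_pM; rewrite ?bd // ltW.
apply: le_lt_trans (ler_wpM2l (ltW e2) h) _.
have -> : e / (2 * K) / (2 * K) / 2 * (2 * K * (2 * K)) = e / 2.
  by field; rewrite gt_eqF.
by rewrite ltr_pdivrMr // ltr_pMr // ltr1n.
Qed.

Lemma gromov_small u v p e : gromov_prod d p (u n) (v n) @[n --> \oo] --> +oo -> 0 < e ->
  exists N, forall n, (N <= n)%N -> quasi (u n) (v n) <= e * (quasi (u n) p * quasi (v n) p).
Proof.
move=> /cvg_seq_pinftyP h e0; have [K KP] := gromov_prod_small p e0.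
by have [N NP] := h K; exists N => n /NP; exact: KP.
Qed.

(** By the same absorption, boundedness of u bounds v, so v falls on the Cauchy side of the
    dichotomy; then the products of distances to p are bounded and [quasi (u n) (v n)] tends to
    0. *)
Lemma quasi_cauchy_equiv u v : quasi_cauchy u -> gromov_class d u v ->
  quasi_cauchy v /\ quasi_equiv u v.
Proof.
move=> cu [gv h]; pose p := u 0%N.
have [K K0 [N NP]] := quasi_cauchy_bounded p cu.
have cv : quasi_cauchy v.
  have [uv|//] := gromov_seq_dichotomy gv; exfalso.
  have e0 : 0 < (2 * K)^-1 by rewrite invr_gt0 mulr_gt0.
  have [M MP] := gromov_small (h p) e0; have [L LP] := uv p (2 * K + 1).
  have hm : (N <= maxn N (maxn M L))%N by rewrite leq_maxl.
  have hm' : (M <= maxn N (maxn M L))%N by rewrite (leq_trans (leq_maxl M L)) ?leq_maxr.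
  have hm'' : (L <= maxn N (maxn M L))%N by rewrite (leq_trans (leq_maxr M L)) ?leq_maxr.
  move: (NP _ hm) (MP _ hm') (LP _ hm''); set n := maxn _ _ => h1 h2 h3.
  have h4 := quasi_tri (u n) (v n) p; rewrite (quasi_sym (v n) (u n)) in h4.
  have h5 : (2 * K)^-1 * (quasi (u n) p * quasi (v n) p) <= quasi (v n) p / 2.
    rewrite mulrA [leRHS]mulrC; apply: ler_wpM2r; first exact: ltW.
    by rewrite ler_pdivrMl ?mulr_gt0 //; lra.
  lra.
split=> // e e0.
have [K' K'0 [N' NP']] := quasi_cauchy_bounded p cv.
have e2 : 0 < e / K / K' / 2 by rewrite !divr_gt0.
have [M MP] := gromov_small (h p) e2; exists (maxn N (maxn N' M)) => n.
rewrite !geq_max => /and3P[/NP h1 /NP' h2 /MP h3]; apply: le_lt_trans h3 _.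
have h4 : quasi (u n) p * quasi (v n) p <= K * K' by apply: ler_pM; rewrite // ltW.
apply: le_lt_trans (ler_wpM2l (ltW e2) h4) _.
have -> : e / K / K' / 2 * (K * K') = e / 2 by field; rewrite !gt_eqF.
by rewrite ltr_pdivrMr // ltr_pMr // ltr1n.
Qed.

Lemma gromov_class_cauchy u : quasi_cauchy u -> gromov_class d u = quasi_class u.
Proof.
move=> cu; apply/seteqP; split=> v; first by move=> /(quasi_cauchy_equiv cu).
move=> [cv uv]; split; first exact: gromov_seq_cauchy.
move=> p; apply/cvg_seq_pinftyP => K; have [e e0 eP] := gromov_prod_large p K.
have [|N NP] := uv (e * (rho p * rho p)); first by rewrite !mulr_gt0.
exists N => n Nn; apply: eP; apply: quasi_small_pair => //; exact/ltW/NP.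
Qed.

(** All unbounded sequences form a single point of the Gromov boundary, which is omega. *)
Lemma gromov_class_unbounded u : quasi_unbounded u ->
  gromov_class d u = [set v | quasi_unbounded v].
Proof.
move=> uu; apply/seteqP; split=> v.
  move=> [gv h]; have [//|cv] := gromov_seq_dichotomy gv.
  exfalso; apply: (quasi_cauchy_not_unbounded (u 0%N) _ uu).
  (* If v were Cauchy, then by symmetry of the product u would be Cauchy too. *)
  have [] // := @quasi_cauchy_equiv v u cv; split; first exact: gromov_seq_unbounded.
  move=> p; have := h p; apply: cvg_trans; apply: near_eq_cvg; apply: nearW => n.
  by rewrite /gromov_prod (dist_sym dM (u n) (v n)) (addrC (d (v n) p)).
move=> vu; split; first exact: gromov_seq_unbounded.
move=> p; apply/cvg_seq_pinftyP => K; have [e e0 eP] := gromov_prod_large p K.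
have [N NP] := quasi_unbounded_pair p uu vu e0.
by exists N => n Nn; apply: eP; exact: NP.
Qed.

Lemma quasi_class_refl u : quasi_cauchy u -> quasi_class u u.
Proof. by move=> cu; split=> // e /cu[N NP]; exists N => n Nn; exact: NP. Qed.

Lemma quasi_class_eq u v : quasi_cauchy u -> quasi_class u v -> quasi_class u = quasi_class v.
Proof.
have tr (f g k : nat -> X) : quasi_equiv f g -> quasi_equiv g k -> quasi_equiv f k.
  move=> ab bc e e0; have [N NP] := ab (e / 2) ltac:(lra); have [M MP] := bc (e / 2) ltac:(lra).
  exists (maxn N M) => n; rewrite geq_max => /andP[/NP h1 /MP h2].
  by have := quasi_tri (g n) (f n) (k n); lra.
have sy (f g : nat -> X) : quasi_equiv f g -> quasi_equiv g f.
  by move=> ab e /ab[N NP]; exists N => n /NP; rewrite quasi_sym.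
move=> cu [cv uv]; apply/seteqP; split=> w [cw h]; split=> //.
  exact: tr (sy _ _ uv) h.
exact: tr uv h.
Qed.

Lemma gromov_boundary_quasi xi u : gromov_boundary d xi -> xi u -> quasi_cauchy u ->
  xi = quasi_class u.
Proof.
move=> [a ga ->] ua cu; have [ra|ca] := gromov_seq_dichotomy ga.
  rewrite (gromov_class_unbounded ra) in ua.
  by have := quasi_cauchy_not_unbounded (u 0%N) cu ua.
by rewrite (gromov_class_cauchy ca) in ua *; exact: quasi_class_eq.
Qed.

Lemma partial_omegaP w xi : quasi_unbounded w ->
  (gromov_boundary d `\ gromov_class d w) xi <->
  exists2 u, quasi_cauchy u & xi = quasi_class u.
Proof.
move=> wu; split=> [[[u gu ->] /= ne]|[u cu ->]].
  have [ru|cu] := gromov_seq_dichotomy gu.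
    by case: ne; rewrite (gromov_class_unbounded ru) (gromov_class_unbounded wu).
  by exists u => //; exact: gromov_class_cauchy.
split; first by exists u; [exact: gromov_seq_cauchy|rewrite gromov_class_cauchy].
move=> /= h; have := quasi_class_refl cu; rewrite h gromov_class_unbounded //= => uu.
exact: (quasi_cauchy_not_unbounded (u 0%N) cu uu).
Qed.

Lemma quasi_cauchy_rho0 u e : quasi_cauchy u -> 0 < e ->
  exists N, forall n, (N <= n)%N -> rho (u n) < e.
Proof.
move=> cu /cu[N NP]; exists N => n Nn.
exact: le_lt_trans (quasi_ge_rho alpha_gt1 (u n) (u n)) (NP _ _ Nn Nn).
Qed.

Lemma quasi_cauchy_rho_dist u : quasi_cauchy u -> cauchy_seq dr u.
Proof.
move=> cu; apply/(cauchyP drM) => e e0.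
set K := dist_const alpha * E 4; have K0 : 0 < K.
  by rewrite /K mulr_gt0 ?exp_gt0 // dist_const_gt0.
have [N NP] := cu (e / K) (divr_gt0 e0 K0); exists N => m n Nm Nn.
apply: le_lt_trans (rho_dist_quasi alpha_gt1 tau_gt3 S_max _ _) _.
by rewrite -/K mulrC -ltr_pdivlMr //; exact: NP.
Qed.

Let p1 := proj_const_ge1 alpha_gt1 tau_gt3.
Let p0 : 0 < proj_const alpha tau := lt_le_trans ltr01 p1.

Lemma quasi_lt x y e : 0 < e -> dr x y < e / (3 * proj_const alpha tau) ->
  rho x < e / (3 * proj_const alpha tau) -> rho y < e / (3 * proj_const alpha tau) ->
  quasi x y < e.
Proof.
move=> e0 h1 h2 h3; apply: le_lt_trans (quasi_le alpha_gt1 tau_gt3 S_max x y) _.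
rewrite mulrC -ltr_pdivlMr //.
rewrite (_ : e / proj_const alpha tau = 3 * (e / (3 * proj_const alpha tau))); first lra.
by field; rewrite gt_eqF.
Qed.

(** The bound of [quasi] by d_rho involves [rho] at both points. That [rho] vanishes along u is part
    of being quasi-Cauchy, and [rho_variation] carries it over to v. *)
Lemma cauchy_class_quasi u : quasi_cauchy u -> cauchy_class dr u = quasi_class u.
Proof.
move=> cu; apply/seteqP; split=> v; last first.
  move=> [cv uv]; split; first exact: quasi_cauchy_rho_dist.
  apply/(dist_cvg0P drM) => e e0; set K := dist_const alpha * E 4.
  have K0 : 0 < K by rewrite /K mulr_gt0 ?exp_gt0 // dist_const_gt0.
  have [N NP] := uv (e / K) (divr_gt0 e0 K0); exists N => n Nn.
  apply: le_lt_trans (rho_dist_quasi alpha_gt1 tau_gt3 S_max _ _) _.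
  by rewrite -/K mulrC -ltr_pdivlMr //; exact: NP.
move=> [/(cauchyP drM) cv /(dist_cvg0P drM) uv].
have dc0 := density_const_gt0 alpha_gt1.
have rv e : 0 < e -> exists N, forall n, (N <= n)%N -> rho (v n) < e.
  move=> e0; have e2 : 0 < e / 2 by lra.
  have [N NP] := quasi_cauchy_rho0 cu e2; have [M MP] := uv _ (divr_gt0 e2 dc0).
  exists (maxn N M) => n; rewrite geq_max => /andP[/NP h1 /MP].
  rewrite ltr_pdivlMr // mulrC => h2; have := variation (u n) (v n).
  by rewrite distrC => /(le_trans (ler_norm _)); lra.
split=> e e0; have e3 : 0 < e / (3 * proj_const alpha tau) by rewrite divr_gt0 // mulr_gt0.
  have [N NP] := cv _ e3; have [M MP] := rv _ e3.
  exists (maxn N M) => m n; rewrite !geq_max => /andP[Nm /MP h1] /andP[Nn /MP h2].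
  by apply: quasi_lt => //; exact: NP.
have [N NP] := uv _ e3; have [M MP] := rv _ e3; have [L LP] := quasi_cauchy_rho0 cu e3.
exists (maxn N (maxn M L)) => n; rewrite !geq_max => /and3P[/NP h1 /MP h2 /LP h3].
exact: quasi_lt.
Qed.

(** With [partial_omegaP] this identifies the two boundaries as sets of classes, whence phi is the
    identity. *)
Lemma partial_rhoP xi : metric_boundary dr xi <->
  exists2 u, quasi_cauchy u & xi = quasi_class u.
Proof.
split=> [bxi|[u cu ->]].
  have [cxi _] := bxi; have [u xu] := completion_inh drM cxi.
  have /cvg_seqP r0 := boundary_rho0 alpha_gt1 tau_gt3 S_max bxi xu.
  have [/(cauchyP drM) cu xiE] := completion_mem drM cxi xu.
  have qu : quasi_cauchy u.
    move=> e e0; have e3 : 0 < e / (3 * proj_const alpha tau) by rewrite divr_gt0 // mulr_gt0.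
    have [N NP] := cu _ e3; have [M MP] := r0 _ e3.
    have rE n : `|rho (u n) - 0| = rho (u n) by rewrite subr0 gtr0_norm.
    exists (maxn N M) => m n; rewrite !geq_max => /andP[Nm /MP h1] /andP[Nn /MP h2].
    by rewrite rE in h1; rewrite rE in h2; apply: quasi_lt => //; exact: NP.
  by exists u => //; rewrite xiE cauchy_class_quasi.
have cc : completion dr (quasi_class u).
  by exists u; [exact: quasi_cauchy_rho_dist|rewrite cauchy_class_quasi].
apply/(metric_boundaryP drM cc (quasi_class_refl cu)) => x /(dist_cvg0P drM) ux.
have dc0 := density_const_gt0 alpha_gt1; have r2 : 0 < rho x / 2 by rewrite divr_gt0.
have [N NP] := quasi_cauchy_rho0 cu r2; have [M MP] := ux _ (divr_gt0 r2 dc0).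
have := NP _ (leq_maxl N M); have := MP _ (leq_maxr N M).
set n := maxn N M; rewrite ltr_pdivlMr // mulrC => h1 h2.
have := variation (u n) x; rewrite distrC => /(le_trans (ler_norm _)); lra.
Qed.

End Boundary.

(** * Anchored rays *)

Section LimInf.
Context {R : realType}.
Implicit Types (f : nat -> \bar R) (m : \bar R).

Let limn_einf_sup f : limn_einf f = ereal_sup (range (einfs f)).
Proof. by rewrite limn_einf_lim; apply: cvg_lim => //; exact: cvg_einfs_sup. Qed.

Lemma limn_einf_ge f m : (exists N, forall n, (N <= n)%N -> (m <= f n)%E) ->
  (m <= limn_einf f)%E.
Proof.
move=> [N NP]; rewrite limn_einf_sup; apply: (@le_trans _ _ (einfs f N)).
  by apply: le_ereal_inf_tmp => _ [n /= Nn <-]; exact: NP.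
by apply: ereal_sup_ubound; exists N.
Qed.

Lemma limn_einf_le f m : (exists N, forall n, (N <= n)%N -> (f n <= m)%E) ->
  (limn_einf f <= m)%E.
Proof.
move=> [N NP]; rewrite limn_einf_sup; apply: ge_ereal_sup => _ [k _ <-].
apply: (@le_trans _ _ (f (maxn k N))); last by apply: NP; rewrite leq_maxr.
by apply: ereal_inf_lbound; exists (maxn k N) => //=; rewrite leq_maxl.
Qed.

End LimInf.

Section Rays.
Context {R : realType} {Z : metricType R} (alpha tau : R) (S : int -> set Z).
Hypotheses (alpha_gt1 : 1 < alpha) (tau_gt3 : 3 < tau).
Hypothesis S_max : forall n, maximal_separated (alpha ^ (- n)) (S n).

Local Notation X := (filling alpha tau S).
Local Notation d := (@path_dist R Z alpha tau S).
Local Notation rho := (@filling_density R Z alpha tau S).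
Local Notation dr := (rho_dist d rho).
Local Notation E t := (alpha `^ t).
Local Notation barZ := (completion (@mdist R Z)).
Local Notation dZ := (completion_dist (@mdist R Z)).
Local Notation toZ := (to_completion (@mdist R Z)).
Implicit Types (x y p : X) (c : R -> X) (a b s t e : R) (u : nat -> X)
  (v w : Z * int) (z : set (nat -> Z)).

Let dM : is_metric_on setT d := path_dist_metric alpha_gt1 tau_gt3 S_max.
Let rho_gt0 x : 0 < rho x := filling_density_gt0 alpha_gt1 x.
Let mM : is_metric_on setT (@mdist R Z) := mdist_metric.
Let t0 : 0 < tau := tau_gt0 tau_gt3.

(** Another vertex would be at distance at least 1, as the coordinate at v shows. *)
Lemma nearest_vertex_pt x v : val x = bary v v 0 -> nearest_vx x = v.
Proof.
move=> xE; have [_ pE hd] := nearestP x; apply/eqP; apply: contraT => nv.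
have := path_dist_coord alpha_gt1 tau_gt3 S_max x (nearest_pt x) v.
rewrite xE pE /bary eqxx subr0 !mul1r !mul0r !addr0 eq_sym (negbTE nv) subr0 normr1.
lra.
Qed.

Lemma proj_vertex x v : val x = bary v v 0 -> proj x = v.1.
Proof. by move=> xE; rewrite /proj (nearest_vertex_pt xE). Qed.

Lemma rho_vertex x v : val x = bary v v 0 -> rho x = E (- v.2%:~R).
Proof. by move=> xE; rewrite /filling_density (height_vertex xE). Qed.

Lemma exp_decay e : 0 < e -> exists N, forall n, (N <= n)%N -> E (- n%:R) < e.
Proof.
move=> e0; exists (Num.bound `|ln e / ln alpha|) => n Nn.
rewrite -[ltRHS](exp_log alpha_gt1 e0) exp_lt // ltrNl.
apply: lt_le_trans (_ : (Num.bound `|ln e / ln alpha|)%:R <= n%:R); last by rewrite ler_nat.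
apply: le_lt_trans (archi_boundP (normr_ge0 _)).
by rewrite -normrN; exact: ler_norm.
Qed.

Lemma exp_growth (K : R) : exists N, forall n, (N <= n)%N -> K <= E n%:R.
Proof.
have K0 : 0 < `|K| + 1 by rewrite ltr_wpDl.
have [|N NP] := @exp_decay (`|K| + 1)^-1; first by rewrite invr_gt0.
exists N => n /NP; rewrite expN ltf_pV2 ?posrE ?exp_gt0 // => h.
have := ler_norm K; lra.
Qed.

(** A step of length at most 1 crosses at most one integer. Only cells reaching beyond a are
    required, so the lemma applies to lines as well as to rays. *)
Lemma cell_lipschitz c a b : a <= b ->
  (forall k : int, a < k%:~R + 1 -> exists v w, edge alpha tau S v w /\
     forall s, 0 <= s <= 1 -> val (c (k%:~R + s)) = bary v w s) ->
  lipschitz_on c a b.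
Proof.
move=> _ cells s t as' st tb.
have same (k : int) s' t' : a <= s' -> k%:~R <= s' -> s' <= t' -> t' <= k%:~R + 1 ->
    d (c s') (c t') <= t' - s'.
  move=> as1 ks st' tk; have [sE|sk] := eqVneq s' (k%:~R + 1).
    have -> : t' = s' by apply/eqP; rewrite eq_le st' sE tk.
    by rewrite subrr (distxx dM).
  have [|v [w [vw vE]]] := cells k.
    by apply: le_lt_trans as1 _; rewrite lt_neqAle sk (le_trans st').
  have s01 : 0 <= s' - k%:~R <= 1 by apply/andP; split; lra.
  have t01 : 0 <= t' - k%:~R <= 1 by apply/andP; split; lra.
  have sE := vE _ s01; have tE := vE _ t01; rewrite addrC subrK in sE; rewrite addrC subrK in tE.
  apply: le_trans (path_dist_le (pl_path_segment vw s01 t01 sE tE)) _.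
  by rewrite opprB addrA subrK distrC ger0_norm // subr_ge0.
apply: (@local_to_global _ (fun s t => d (c s) (c t) <= t - s) s t 1) => //; last first.
  move=> x y w _ _ _ _ h1 h2; have := dist_tri dM (c y) (c x) (c w); lra.
move=> x y sx xy yt xy1; pose k := Num.floor x.
have k1 : k%:~R <= x := Num.Theory.floor_le x.
have k2 : x < k%:~R + 1 by have := Num.Theory.floorD1_gt x; rewrite intrD.
have ax := le_trans as' sx.
have [yk|ky] := leP y (k%:~R + 1); first exact: same yk.
have h1 := same k x (k%:~R + 1) ax k1 (ltW k2) (lexx _).
have h2 : d (c (k%:~R + 1)) (c y) <= y - (k%:~R + 1).
  have kE : (k + 1)%:~R = k%:~R + 1 :> R by rewrite intrD.
  apply: (same (k + 1) (k%:~R + 1) y (le_trans ax (ltW k2)) _ (ltW ky)); rewrite kE //.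
  lra.
have := dist_tri dM (c (k%:~R + 1)) (c x) (c y); lra.
Qed.

Definition anchored_at v z := dZ (toZ v.1) z < tau / 3 * E (- v.2%:~R).

Lemma anchored_atP v z : anchored_at v z <->
  dZ (toZ v.1) z < tau / 3 * alpha ^ (- v.2).
Proof. by rewrite /anchored_at scaleE. Qed.

Lemma toZ_dist (q r : Z) : dZ (toZ q) (toZ r) = mdist q r.
Proof.
apply: (completion_distE mM (completion_to mM q) (completion_to mM r)
  (to_completion_cst mM q) (to_completion_cst mM r)); exact: cvg_cst.
Qed.

Lemma toZ_tri (q r : Z) z : barZ z ->
  mdist q r <= dZ (toZ q) z + dZ (toZ r) z.
Proof.
move=> cz; have [_ _ ms mt] := completion_metric mM.
have cq := completion_to mM q; have cr := completion_to mM r.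
by rewrite -toZ_dist (ms (toZ r) _ cr cz); exact: mt.
Qed.

Lemma anchored_mdist v w z : barZ z -> anchored_at v z ->
  anchored_at w z -> mdist v.1 w.1 < tau / 3 * (E (- v.2%:~R) + E (- w.2%:~R)).
Proof.
move=> cz va wa; apply: le_lt_trans (toZ_tri _ _ cz) _.
by rewrite mulrDr; exact: ltrD.
Qed.

(** The centres are within tau / 3 times the sum of both scales, and the scale of w is the smaller;
    so the centre of w lies in the ball of v. *)
Lemma anchored_edge v w z : barZ z -> vertex S v -> vertex S w ->
  w.2 = v.2 + 1 -> anchored_at v z -> anchored_at w z -> edge alpha tau S v w.
Proof.
move=> cz vv ww wv va wa; have h := anchored_mdist cz va wa; split=> //.
- by move=> vw; move: wv; rewrite vw => /eqP; rewrite -subr_eq0 opprD addrA subrr sub0r.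
- by rewrite wv opprD addrA subrr sub0r normrN normr1.
exists w.1; split; last by apply: near_ball => //; rewrite mdistxx exp_gt0.
apply/vertex_ballE => //; apply: lt_le_trans h _.
have : E (- w.2%:~R) <= E (- v.2%:~R) by apply: exp_le => //; rewrite lerN2 ler_int wv lerDl.
have := exp_gt0 alpha_gt1 (- v.2%:~R); move: (E _) (E _) => A B A0 BA.
have := ler_wpM2l (ltW t0) BA; have := mulr_gt0 t0 A0; lra.
Qed.

(** A net point is taken near an approximation of z in Z; since tau / 3 > 1, the error of the
    approximation fits within the anchoring radius. *)
Lemma anchored_exists z (k : int) : barZ z ->
  exists v, [/\ vertex S v, v.2 = k & anchored_at v z].
Proof.
move=> cz; have [a za] := completion_inh mM cz.
have e0 : 0 < (tau / 3 - 1) * E (- k%:~R)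
  by apply: mulr_gt0; [rewrite subr_gt0 ltr_pdivlMr ?mul1r|exact: exp_gt0].
have /cvg_seqP/(_ _ e0)[N NP] := converges_in_completion_mem mM cz za.
have [q Sq pq] := net_near alpha_gt1 S_max (a N) k.
exists (q, k); split=> //; rewrite /anchored_at /=.
have := NP N (leqnn N); rewrite subr0 => /(le_lt_trans (ler_norm _)) h.
have [_ _ _ mt] := completion_metric mM.
have := mt _ (toZ (a N)) _ (completion_to mM q) (completion_to mM (a N)) cz.
rewrite toZ_dist metric_sym; lra.
Qed.

Lemma anchored_line (v : int -> Z * int) z : barZ z ->
  (forall k, [/\ vertex S (v k), (v k).2 = k & anchored_at (v k) z]) ->
  exists c, [/\ geodesic d setT c, forall k, edge alpha tau S (v k) (v (k + 1)) &
    forall k s, 0 <= s <= 1 -> val (c (k%:~R + s)) = bary (v k) (v (k + 1)) s].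
Proof.
move=> cz hv.
have e k : edge alpha tau S (v k) (v (k + 1)).
  have [v1 v2 v3] := hv k; have [w1 w2 w3] := hv (k + 1).
  by apply: (anchored_edge cz) => //; rewrite w2 v2.
pose fr (t : R) := t - (Num.floor t)%:~R.
have fr01 t : 0 <= fr t <= 1.
  rewrite /fr; have := Num.Theory.floor_le t; have := Num.Theory.floorD1_gt t.
  by rewrite intrD => h1 h2; apply/andP; split; lra.
have [c cE] := choice (fun t => edge_pt (e (Num.floor t)) (fr01 t)).
have cell (k : int) s : 0 <= s <= 1 -> val (c (k%:~R + s)) = bary (v k) (v (k + 1)) s.
  (* The right end of a cell belongs to the next one by the choice of the floor, so the two
     descriptions of that vertex have to be matched. *)
  move=> /andP[s0]; rewrite le_eqVlt => /orP[/eqP ->|s1].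
    have fE : Num.floor (k%:~R + 1 : R) = k + 1.
      by rewrite -[X in _ + X]/(1%:~R) -intrD Num.Theory.intrKfloor.
    by rewrite cE /fr fE intrD subrr bary1; exact: bary0.
  have fE : Num.floor (k%:~R + s : R) = k.
    by apply: Num.Theory.floor_def; rewrite intrD lerDl s0 ltrD2l.
  by rewrite cE /fr fE [k%:~R + s]addrC addrK.
exists c; split=> //; split=> //; first by exists 0.
move=> s t _ _; wlog st : s t / s <= t.
  move=> hw; case: (leP s t) => [|/ltW] h; first exact: hw.
  by rewrite (dist_sym dM) distrC; exact: hw.
rewrite distrC ger0_norm ?subr_ge0 //; apply/eqP; rewrite eq_le; apply/andP; split.
  apply: (@cell_lipschitz c s t) => // k _; exists (v k), (v (k + 1)).
  by split=> // *; exact: cell.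
have hE t' : height (c t') = t'.
  rewrite heightE (linear_ext_bary _ (cE t')) /fr.
  have [_ -> _] := hv (Num.floor t'); have [_ -> _] := hv (Num.floor t' + 1).
  by rewrite intrD; ring.
have := height_lipschitz alpha_gt1 tau_gt3 S_max (c s) (c t).
by rewrite !hE distrC ger0_norm // subr_ge0.
Qed.

Definition converges_to u z := z (fun n => proj (u n)) /\ rho (u n) @[n --> \oo] --> (0 : R).

Let rho_small u e : rho (u n) @[n --> \oo] --> (0 : R) -> 0 < e ->
  exists N, forall n, (N <= n)%N -> rho (u n) < e.
Proof.
by move=> /cvg_seqP h /h[N NP]; exists N => n /NP; rewrite subr0 gtr0_norm.
Qed.

Lemma converges_to_cauchy u z : barZ z -> converges_to u z ->
  quasi_cauchy u.
Proof.
move=> cz [zu r0] e e0; have [/(cauchyP mM) cu _] := completion_mem mM cz zu.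
have e3 : 0 < e / 3 by lra.
have [N NP] := cu _ e3; have [M MP] := rho_small r0 e3.
exists (maxn N M) => m n; rewrite !geq_max => /andP[Nm /MP h1] /andP[Nn /MP h2].
have := NP m n Nm Nn; rewrite /quasi /=; lra.
Qed.

Lemma converges_to_equiv u u' z : barZ z -> converges_to u z ->
  converges_to u' z -> quasi_equiv u u'.
Proof.
move=> cz [zu r0] [zu' r0'] e e0; have e3 : 0 < e / 3 by lra.
have [_ /(dist_cvg0P mM) h] := (completion_classP mM cz zu _).1 zu'.
have [N NP] := h _ e3; have [M MP] := rho_small r0 e3; have [L LP] := rho_small r0' e3.
exists (maxn N (maxn M L)) => n; rewrite !geq_max => /and3P[/NP h1 /MP h2 /LP h3].
by move: h1; rewrite /quasi /=; lra.
Qed.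

Lemma cauchy_converges_to u : quasi_cauchy u -> exists2 z, barZ z &
  converges_to u z.
Proof.
move=> cu; have cp : cauchy_seq (@mdist R Z) (fun n => proj (u n)).
  apply/(cauchyP mM) => e /cu[N NP]; exists N => m n Nm Nn.
  apply: le_lt_trans (NP m n Nm Nn); rewrite /quasi /= -addrA lerDl.
  by rewrite addr_ge0 // ltW.
exists (cauchy_class (@mdist R Z) (fun n => proj (u n))); first exact: completion_class.
split; first exact: cauchy_class_refl.
apply/cvg_seqP => e /(quasi_cauchy_rho0 alpha_gt1 cu)[N NP]; exists N => n /NP.
by rewrite subr0 gtr0_norm.
Qed.

Lemma anchored_converges u (v : nat -> Z * int) z : barZ z ->
  (forall n, val (u n) = bary (v n) (v n) 0) -> (forall n, anchored_at (v n) z) ->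
  (forall n, (v n).2 = (v 0%N).2 + n%:Z) -> converges_to u z.
Proof.
move=> cz uE va vh.
have rE n : rho (u n) = E (- (v 0%N).2%:~R) * E (- n%:R).
  by rewrite (rho_vertex (uE n)) vh intrD opprD expD.
have k0 : 0 < E (- (v 0%N).2%:~R) := exp_gt0 alpha_gt1 _.
have r0 : rho (u n) @[n --> \oo] --> (0 : R).
  apply/cvg_seqP => e e0; have [N NP] := exp_decay (divr_gt0 e0 k0).
  exists N => n /NP; rewrite subr0 gtr0_norm // rE ltr_pdivlMr //.
  by rewrite mulrC.
split=> //; apply: (converges_in_completion_in mM cz).
have c0 q : 0 <= dZ (toZ q) z.
  have [+ _ _ _] := completion_metric mM; apply=> //; exact: completion_to.
apply/cvg_seqP => e e0; have e3 : 0 < e / tau by rewrite divr_gt0.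
have [N NP] := rho_small r0 e3.
exists N => n /NP h; rewrite subr0 ger0_norm //= (proj_vertex (uE n)).
apply: lt_trans (va n) _; rewrite -(rho_vertex (uE n)).
move: h; rewrite ltr_pdivlMr // => h; have := mulr_gt0 t0 (rho_gt0 (u n)); lra.
Qed.

Lemma quasi_unbounded_rho u : (forall n, E n%:R <= rho (u n)) -> quasi_unbounded u.
Proof.
move=> h p K; have [N NP] := exp_growth K; exists N => n /NP /le_trans; apply.
exact: le_trans (h n) (quasi_ge_rho alpha_gt1 _ _).
Qed.

Lemma line_below c (v : int -> Z * int) : (forall k, (v k).2 = k) ->
  (forall k s, 0 <= s <= 1 -> val (c (k%:~R + s)) = bary (v k) (v (k + 1)) s) ->
  quasi_unbounded (fun n => c (- n%:R)).
Proof.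
move=> vk cE; apply: quasi_unbounded_rho => n.
have := cE (- n%:Z) 0; rewrite lexx ler01 addr0 => /(_ isT).
rewrite (bary0 _ _ (v (- n%:Z))) intrN => h.
by rewrite (rho_vertex h) vk intrN opprK.
Qed.

Lemma line_above c (v : int -> Z * int) z : barZ z ->
  (forall k, [/\ vertex S (v k), (v k).2 = k & anchored_at (v k) z]) ->
  (forall k s, 0 <= s <= 1 -> val (c (k%:~R + s)) = bary (v k) (v (k + 1)) s) ->
  converges_to (fun n => c n%:R) z.
Proof.
move=> cz hv cE; apply: (@anchored_converges _ (fun n => v n%:Z)) => // n.
- have := cE n%:Z 0; rewrite lexx ler01 addr0 => /(_ isT) ->; exact: bary0.
- by have [] := hv n%:Z.
- by have [_ -> _] := hv n%:Z; have [_ -> _] := hv 0; rewrite add0r.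
Qed.

Lemma line_through z : barZ z ->
  exists (v : int -> Z * int), forall k, [/\ vertex S (v k), (v k).2 = k & anchored_at (v k) z].
Proof. by move=> cz; have [v hv] := choice (fun k => anchored_exists k cz); exists v. Qed.

Lemma filling_starlike (omega : nat -> X) : quasi_unbounded omega ->
  roughly_starlike d (1 / 2) (gromov_class d omega).
Proof.
move=> ou; rewrite (gromov_class_unbounded alpha_gt1 tau_gt3 S_max ou).
split=> [x|xi].
  have [vx xE hx] := nearestP x; set w := nearest_vx x in vx xE.
  have cz := completion_to mM w.1; have [v0 hv0] := line_through cz.
  (* A line anchored at the centre of w is made to pass through w itself, which is anchored at its
     own centre. *)
  pose v k := if k == w.2 then w else v0 k.
  have hv k : [/\ vertex S (v k), (v k).2 = k & anchored_at (v k) (toZ w.1)].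
    rewrite /v; case: eqP => [->|_]; last exact: hv0.
    split=> //; rewrite /anchored_at toZ_dist mdistxx.
    by apply: mulr_gt0; [exact: divr_gt0|exact: exp_gt0].
  have [c [cg _ cE]] := anchored_line cz hv.
  exists c; split=> //; last by apply: line_below cE => k; have [] := hv k.
  apply: le_trans hx; apply: ge_inf.
    by exists 0 => _ [t _ <-]; exact: (dist_ge0 dM).
  exists (w.2%:~R) => //; congr (d x _); apply: val_inj.
  have := cE w.2 0; rewrite lexx ler01 addr0 => /(_ isT) ->.
  by rewrite xE /v eqxx; exact: bary0.
rewrite -(gromov_class_unbounded alpha_gt1 tau_gt3 S_max ou).
move=> /(partial_omegaP alpha_gt1 tau_gt3 S_max _ ou)[u cu ->].
have [z cz uz] := cauchy_converges_to cu; have [v hv] := line_through cz.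
have [c [cg _ cE]] := anchored_line cz hv; have cz' := line_above cz hv cE.
exists c; split=> //.
  split; [exact: converges_to_cauchy cz cz'|exact: converges_to_equiv cz uz cz'].
rewrite (gromov_class_unbounded alpha_gt1 tau_gt3 S_max ou).
by apply: line_below cE => k; have [] := hv k.
Qed.

Lemma ascending_vertices (gamma : R -> X) (v : nat -> Z * int) z :
  ascending_ray gamma v -> anchored alpha tau v z ->
  [/\ forall n, val (gamma n%:R) = bary (v n) (v n) 0, forall n, anchored_at (v n) z &
      forall n, (v n).2 = (v 0%N).2 + n%:Z].
Proof.
move=> asc anc; split=> n.
- have [_ _ gE] := asc n; have := gE 0; rewrite lexx ler01 addr0 => /(_ isT) ->.
  exact: bary0.
- exact/anchored_atP.
- elim: n => [|n IH]; first by rewrite addr0.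
  by have [_ -> _] := asc n; rewrite IH -addrA -PoszD addn1.
Qed.

(** The rays constructed above show that the condition in [anchored_class] is not vacuous and fixes
    the class; all rays anchored at z then agree, since their projections represent z. *)
Lemma anchored_classE u z : barZ z -> converges_to u z ->
  @anchored_class R Z alpha tau S z = quasi_class u.
Proof.
move=> cz uz; have cu := converges_to_cauchy cz uz.
have [v hv] := line_through cz; have [c [cg ce cE]] := anchored_line cz hv.
have asc : ascending_ray c (fun n => v n%:Z).
  move=> i; split.
  - by have := ce i%:Z; rewrite -PoszD addn1.
  - by have [_ -> _] := hv i%:Z; have [_ -> _] := hv i.+1%:Z; rewrite -addn1 PoszD.
  - by move=> s s01; have := cE i%:Z s s01; rewrite -PoszD addn1.
have anc : anchored alpha tau (fun n => v n%:Z) z.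
  by move=> i; apply/anchored_atP; have [] := hv i%:Z.
have cz' := line_above cz hv cE; have cc := converges_to_cauchy cz cz'.
rewrite /anchored_class; case: xgetP => [xi _ [bxi /(_ _ _ asc anc) xic]|].
  rewrite (gromov_boundary_quasi alpha_gt1 tau_gt3 S_max bxi xic cc).
  apply: esym; apply: quasi_class_eq => //; split=> //.
  exact: converges_to_equiv cz uz cz'.
move=> /(_ (quasi_class u)); case; split.
  exists u; first exact: gromov_seq_cauchy.
  by rewrite (gromov_class_cauchy alpha_gt1 tau_gt3 S_max cu).
move=> g w gw aw; have [wE wa wh] := ascending_vertices gw aw.
have gz := anchored_converges cz wE wa wh.
by split; [exact: converges_to_cauchy cz gz|exact: converges_to_equiv cz uz gz].
Qed.

End Rays.

(** * Busemann function and visual kernel *)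

Section Visual.
Context {R : realType} {Z : metricType R} (alpha tau : R) (S : int -> set Z).
Hypotheses (alpha_gt1 : 1 < alpha) (tau_gt3 : 3 < tau).
Hypothesis S_max : forall n, maximal_separated (alpha ^ (- n)) (S n).

Local Notation X := (filling alpha tau S).
Local Notation d := (@path_dist R Z alpha tau S).
Local Notation rho := (@filling_density R Z alpha tau S).
Local Notation dr := (rho_dist d rho).
Local Notation E t := (alpha `^ t).
Local Notation barZ := (completion (@mdist R Z)).
Local Notation dZ := (completion_dist (@mdist R Z)).
Local Notation dR := (completion_dist dr).
Implicit Types (x y p : X) (c : R -> X) (a s t e : R) (u : nat -> X)
  (w : Z * int) (xi zeta : set (nat -> X)).

Let dM : is_metric_on setT d := path_dist_metric alpha_gt1 tau_gt3 S_max.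
Let rho_gt0 x : 0 < rho x := filling_density_gt0 alpha_gt1 x.
Let drM : is_metric_on setT dr := filling_rho_metric alpha_gt1 tau_gt3 S_max.
Let mM : is_metric_on setT (@mdist R Z) := mdist_metric.
Let t0 : 0 < tau := tau_gt0 tau_gt3.

(** * The Busemann function of the reference ray *)

Section Reference.
Variables (gamma : R -> X) (v : nat -> Z * int) (z : set (nat -> Z)).
Hypotheses (cz : barZ z) (gamma_ray : descending_ray gamma v)
  (gamma_anchored : anchored alpha tau v z) (v0 : (v 0%N).2 = 0).

Local Notation b := (busemann d gamma).

Lemma ray_height n : (v n).2 = - n%:Z.
Proof.
elim: n => [|n IH]; first by rewrite v0 oppr0.
by have [_ -> _] := gamma_ray n; rewrite IH -opprD -PoszD addn1.
Qed.

Lemma ray_vertex n : val (gamma n%:R) = bary (v n) (v n) 0.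
Proof.
have [_ _ gE] := gamma_ray n; have := gE 0; rewrite lexx ler01 addr0 => /(_ isT) ->.
exact: bary0.
Qed.

Lemma ray_rho n : rho (gamma n%:R) = E n%:R.
Proof. by rewrite (rho_vertex (ray_vertex n)) ray_height intrN opprK. Qed.

Lemma ray_unbounded : quasi_unbounded (fun n => gamma n%:R).
Proof. by apply: quasi_unbounded_rho => // n; rewrite ray_rho. Qed.

Lemma ray_lipschitz s t : 0 <= s -> s <= t -> d (gamma s) (gamma t) <= t - s.
Proof.
move=> s0 st; apply: (@cell_lipschitz _ _ _ _ _ alpha_gt1 tau_gt3 S_max gamma 0 t) => //.
  exact: le_trans st.
case=> k h; last first.
  by move: h; rewrite -[X in _ + X]/(1%:~R) -intrD ltr0z; case: k.
by exists (v k), (v k.+1); have [ev _ kE] := gamma_ray k; split=> // a; exact: kE.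
Qed.

Lemma height_ray t : 0 <= t -> height (gamma t) = - t.
Proof.
move=> h0; have /andP[k1 k2] := Num.Theory.truncn_itv h0; set k := Num.truncn t in k1 k2.
have [_ kh kE] := gamma_ray k; have := kE (t - k%:R).
have -> : k%:R + (t - k%:R) = t by rewrite addrC subrK.
move=> h; rewrite heightE (linear_ext_bary _ (h _)).
  by rewrite kh ray_height intrD !intrN; ring.
by move: k2; rewrite -addn1 natrD => k2; apply/andP; split; lra.
Qed.

(** 8 is twice the exponent 4 of [geo_quasi], and tau + 3 is the constant of [ray_quasi]; the
    doubling undoes the half in [geo]. *)
Definition busemann_const : R := 8 + 2 * (ln (tau + 3) / ln alpha).

Let f x t := d (gamma t) x - t.

Let f_decr x s t : 0 <= s -> s <= t -> f x t <= f x s.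
Proof.
move=> s0 st; have h1 := ray_lipschitz s0 st; have := dist_tri dM (gamma s) (gamma t) x.
by rewrite (dist_sym dM (gamma t) (gamma s)) /f => h2; lra.
Qed.

Let f_ge x t : 0 <= t -> height x <= f x t.
Proof.
move=> h0; have := height_lipschitz alpha_gt1 tau_gt3 S_max x (gamma t).
rewrite height_ray // (dist_sym dM) => /(le_trans (ler_norm _)); rewrite /f; lra.
Qed.

(** Far down the ray, everything depending on x is dominated by the scale E n; anchoring bounds the
    drift of the ray in Z. *)
Let ray_quasi x : exists N, forall n, (N <= n)%N ->
  quasi x (gamma n%:R) <= (tau + 3) * E n%:R.
Proof.
have [N NP] := exp_growth alpha_gt1 (mdist (proj x) (v 0%N).1 + tau / 3 + rho x).
exists N => n /NP hK.
have an i : anchored_at alpha tau (v i) z by exact/anchored_atP/gamma_anchored.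
have := anchored_mdist cz (an 0%N) (an n); rewrite v0 ray_height oppr0 powRr0 !intrN opprK -pmulrn.
rewrite /quasi ray_rho (proj_vertex _ _ _ (ray_vertex n)) // => h.
have := metric_triangle (proj x) (v 0%N).1 (v n).1.
have e0 := exp_gt0 alpha_gt1 n%:R; have := mulr_gt0 t0 e0; lra.
Qed.

Let f_le x : exists n, f x n%:R <= height x + busemann_const.
Proof.
have [N NP] := ray_quasi x; exists N.
have := le_trans (geo_quasi alpha_gt1 tau_gt3 S_max x (gamma N%:R)) _.
move=> /(_ _ (ler_wpM2l _ (NP _ (leqnn N)))).
have t3 : 0 < tau + 3 by rewrite addr_gt0.
rewrite exp_ge0 // => /(_ isT); rewrite -[X in X * E N%:R](exp_log alpha_gt1 t3) -!expD // /geo.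
rewrite exp_leE // height_ray // (dist_sym dM) /f /busemann_const; lra.
Qed.

Lemma busemann_bounds x : height x <= b x <= height x + busemann_const.
Proof.
pose A := [set f x t | t in [set t | 0 <= t]].
have Alb : has_lbound A by exists (height x) => _ [t h0 <-]; exact: f_ge.
have A0 : A !=set0 by exists (f x 0), 0 => //=.
have -> : b x = inf A.
  (* The function under the limit is nonincreasing and bounded below by the height, so it converges
     to its infimum. *)
  apply: cvg_lim => //; apply/cvgrPdist_lt => e e0.
  have [_ [s /= s0 <-] sA] := inf_adherent e0 (conj A0 Alb).
  near=> t; have st : s <= t by near: t; apply: nbhs_pinfty_ge; exact: num_real.
  have h1 := f_decr x s0 st.
  have h2 : inf A <= f x t by apply: ge_inf => //; exists t => //=; exact: le_trans st.
  by rewrite ltr_norml; apply/andP; split; move: h1 h2 sA; rewrite /f; lra.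
apply/andP; split.
  by apply: lb_le_inf => // _ [t h0 <-]; exact: f_ge.
have [n nP] := f_le x; apply: le_trans nP; apply: ge_inf => //.
by exists n%:R => //=.
Unshelve. all: by end_near. Qed.

End Reference.
Lemma canonical_mapE xi : metric_boundary dr xi -> canonical_map dr xi = xi.
Proof.
move=> [cxi _]; rewrite /canonical_map; case: xgetP => [eta _ [ceta h]|/(_ xi)[]].
  have [u xiu] := completion_inh drM cxi.
  apply: (converges_in_completion_unique drM ceta cxi (h u xiu)).
  exact: converges_in_completion_mem.
by split=> // u xiu; exact: converges_in_completion_mem.
Qed.

Lemma converges_to_class u u' z : barZ z -> converges_to u z ->
  quasi_class u u' -> converges_to u' z.
Proof.
move=> cz [zu r0] [cu' h]; have [z' cz' [zu' r0']] := cauchy_converges_to alpha_gt1 cu'.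
split=> //; apply/(completion_classP mM cz zu); split.
  by have [] := completion_mem mM cz' zu'.
apply/(dist_cvg0P mM) => e /h[N NP]; exists N => n /NP; apply: le_lt_trans.
by rewrite /quasi /= -addrA lerDl addr_ge0 // ltW.
Qed.

Lemma quasi_cvg u u' z z' : barZ z -> barZ z' ->
  converges_to u z -> converges_to u' z' ->
  quasi (u n) (u' n) @[n --> \oo] --> dZ z z'.
Proof.
move=> cz cz' [zu r0] [zu' r0']; rewrite -[dZ z z']addr0 -[_ + 0]addr0.
apply: cvgD => //; apply: cvgD => //; exact: (completion_dist_cvg mM cz cz' zu zu').
Qed.

Lemma quasi_class_completion u : quasi_cauchy u -> completion dr (quasi_class u).
Proof.
move=> cu; rewrite -(cauchy_class_quasi alpha_gt1 tau_gt3 S_max cu).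
exact/completion_class/quasi_cauchy_rho_dist.
Qed.

(** The comparisons of d_rho with [quasi] and of the projections with d_rho pass to the limit, where
    all terms in [rho] vanish. *)
Lemma boundary_dist u u' z z' : barZ z ->
  barZ z' -> converges_to u z -> converges_to u' z' ->
  dR (quasi_class u) (quasi_class u') <= dist_const alpha * E 4 * dZ z z' /\
  dZ z z' <= proj_const alpha tau * dR (quasi_class u) (quasi_class u').
Proof.
move=> cz cz' uz uz'.
have cu := converges_to_cauchy alpha_gt1 cz uz; have cu' := converges_to_cauchy alpha_gt1 cz' uz'.
have cd := completion_dist_cvg drM (quasi_class_completion cu) (quasi_class_completion cu')
  (quasi_class_refl cu) (quasi_class_refl cu').
have cq := quasi_cvg cz cz' uz uz'.
have [_ r0] := uz; have [_ r0'] := uz'.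
have cm := completion_dist_cvg mM cz cz' uz.1 uz'.1.
have q0 : 0 <= dR (quasi_class u) (quasi_class u').
  have [+ _ _ _] := completion_metric drM; apply; exact: quasi_class_completion.
have p1 := proj_const_ge1 alpha_gt1 tau_gt3.
split.
  have cm' : dist_const alpha * E 4 * quasi (u n) (u' n) @[n --> \oo] -->
    dist_const alpha * E 4 * dZ z z' by exact: cvgMl_tmp.
  by have := ler_cvg_to cd cm'; apply; apply: nearW => n; exact: rho_dist_quasi.
apply: le_trans (_ : (proj_const alpha tau - 1) * dR (quasi_class u) (quasi_class u') <= _);
  last by rewrite mulrBl mul1r gerBl.
have h : (proj_const alpha tau - 1) * (dr (u n) (u' n) + rho (u n) + rho (u' n))
    @[n --> \oo] --> (proj_const alpha tau - 1) * (dR (quasi_class u) (quasi_class u') + 0 + 0).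
  by apply: cvgMl_tmp; apply: cvgD => //; exact: cvgD.
rewrite !addr0 in h.
by have := ler_cvg_to cm h; apply; apply: nearW => n; exact: proj_dist.
Qed.

(** * The visual kernel against the distance in the completion of Z *)

Section Kernel.
Variable b : X -> R.
Local Notation C := busemann_const.
Hypothesis b_bounds : forall x, height x <= b x <= height x + C.

Local Notation kernel := (visual_kernel d (ln alpha) b).
Local Notation bprod := (boundary_prod d b).

Lemma busemann_prod_ge x y (e : R) : 0 < e -> geo x y <= e ->
  - (ln e / ln alpha) <= busemann_prod d b x y.
Proof.
move=> e0; rewrite -[X in _ <= X -> _](exp_log alpha_gt1 e0) exp_leE //.
have /andP[h1 _] := b_bounds x; have /andP[h2 _] := b_bounds y.
by rewrite /busemann_prod; lra.
Qed.

Lemma busemann_prod_le x y (e : R) : 0 < e -> e <= geo x y ->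
  busemann_prod d b x y <= C - ln e / ln alpha.
Proof.
move=> e0; rewrite -[X in X <= _ -> _](exp_log alpha_gt1 e0) exp_leE //.
have /andP[_ h1] := b_bounds x; have /andP[_ h2] := b_bounds y.
by rewrite /busemann_prod; lra.
Qed.

Let kernelE (q : R) : (E (- q))%:E = expeR (- ((ln alpha)%:E * q%:E))%E.
Proof. by rewrite /= exp_expR // mulNr mulrC. Qed.

Lemma kernel_le xi zeta (q : R) : (q%:E <= bprod xi zeta)%E ->
  (kernel xi zeta <= (E (- q))%:E)%E.
Proof.
move=> h; rewrite /visual_kernel kernelE lee_expeR leeN2 lee_pmul2l //.
by rewrite lte_fin ln_alpha_gt0.
Qed.

Lemma kernel_ge xi zeta (q : R) : (bprod xi zeta <= q%:E)%E ->
  ((E (- q))%:E <= kernel xi zeta)%E.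
Proof.
move=> h; rewrite /visual_kernel kernelE lee_expeR leeN2 lee_pmul2l //.
by rewrite lte_fin ln_alpha_gt0.
Qed.

Definition kernel_const : R := 2 * quasi_const alpha tau * E C.

Lemma visual_kernel_bounds u u' z z' : barZ z ->
  barZ z' -> converges_to u z -> converges_to u' z' ->
  (kernel (quasi_class u) (quasi_class u') <= (E 4 * dZ z z')%:E)%E /\
  ((dZ z z')%:E <= kernel_const%:E * kernel (quasi_class u) (quasi_class u'))%E.
Proof.
move=> cz cz' uz uz'; have q0 := quasi_const_gt0 alpha_gt1 tau_gt3.
have cu := converges_to_cauchy alpha_gt1 cz uz; have cu' := converges_to_cauchy alpha_gt1 cz' uz'.
have e40 := exp_gt0 alpha_gt1 4.
have D0 : 0 <= dZ z z' by have [+ _ _ _] := completion_metric mM; apply.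
have k0 : 0 < kernel_const.
  by rewrite /kernel_const; apply: mulr_gt0; [exact: mulr_gt0|exact: exp_gt0].
split.
  (* The added e makes the bound positive, so that its logarithm is available even if z = z'. Every
     pair of representatives must be estimated here, whereas one pair suffices for the other
     inequality. *)
  apply/lee_addgt0Pr => e e0; pose e' := E 4 * dZ z z' + e.
  have e'0 : 0 < e' by rewrite /e' ltr_wpDl // mulr_ge0 // ltW.
  rewrite -EFinD -/e' -(exp_log alpha_gt1 e'0) -[X in E X]opprK; apply: kernel_le.
  apply: le_ereal_inf_tmp => _ [w [w' [uw uw' ->]]]; apply: limn_einf_ge.
  have wz := converges_to_class cz uz uw; have wz' := converges_to_class cz' uz' uw'.
  have e1 : 0 < e / E 4 by exact: divr_gt0.
  have /cvg_seqP/(_ _ e1)[N NP] := quasi_cvg cz cz' wz wz'.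
  exists N => n /NP h; rewrite lee_fin; apply: busemann_prod_ge => //.
  apply: le_trans (geo_quasi alpha_gt1 tau_gt3 S_max _ _) _; rewrite /e'.
  have {}h : quasi (w n) (w' n) <= dZ z z' + e / E 4.
    by have := le_lt_trans (ler_norm _) h; lra.
  apply: le_trans (ler_wpM2l (ltW e40) h) _.
  by rewrite mulrDr mulrCA divff ?mulr1 // gt_eqF.
move: D0; rewrite le_eqVlt => /orP[/eqP <-|D0].
  by apply: mule_ge0; [rewrite lee_fin ltW|exact: expeR_ge0].
(* Eventually [quasi] exceeds half its limit, and quasi <= C geo then bounds [geo] below by e. *)
pose e := dZ z z' / (2 * quasi_const alpha tau).
have e0 : 0 < e by apply: divr_gt0 => //; exact: mulr_gt0.
have DE : dZ z z' = kernel_const * E (- (C - ln e / ln alpha)).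
  rewrite opprB expB // exp_log // /kernel_const /e.
  by field; rewrite !gt_eqF // exp_gt0.
rewrite [X in X%:E]DE EFinM lee_pmul2l // ?lte_fin //; apply: kernel_ge.
apply: (@le_trans _ _ (limn_einf (fun n => (busemann_prod d b (u n) (u' n))%:E))).
  by apply: ereal_inf_lbound; exists u, u'; split=> //; exact: quasi_class_refl.
apply: limn_einf_le; have D2 : 0 < dZ z z' / 2 by exact: divr_gt0.
have /cvg_seqP/(_ _ D2)[N NP] := quasi_cvg cz cz' uz uz'.
exists N => n /NP; rewrite ltr_norml => /andP[h _]; rewrite lee_fin.
apply: busemann_prod_le => //; rewrite /e invfM mulrA ler_pdivrMr // [geo _ _ * _]mulrC.
by apply: le_trans (quasi_geo alpha_gt1 tau_gt3 S_max _ _); lra.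
Qed.

End Kernel.

Local Notation phi := (canonical_map dr).
Local Notation psi := (@anchored_class R Z alpha tau S).

Definition bilip_const : R := 1 + proj_const alpha tau + E 4 * proj_const alpha tau
  + dist_const alpha * E 4 + dist_const alpha * E 4 * kernel_const.

Let p0 : 0 < proj_const alpha tau := lt_le_trans ltr01 (proj_const_ge1 alpha_gt1 tau_gt3).
Let c0 : 0 < dist_const alpha := dist_const_gt0 alpha_gt1.
Let e0 : 0 < E 4 := exp_gt0 alpha_gt1 4.

Lemma kernel_const_gt0 : 0 < kernel_const.
Proof.
have q0 := quasi_const_gt0 alpha_gt1 tau_gt3; rewrite /kernel_const.
by apply: mulr_gt0; [exact: mulr_gt0|exact: exp_gt0].
Qed.

Lemma bilip_const_ge : [/\ 1 <= bilip_const, proj_const alpha tau <= bilip_const,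
  E 4 * proj_const alpha tau <= bilip_const, dist_const alpha * E 4 <= bilip_const &
  dist_const alpha * E 4 * kernel_const <= bilip_const].
Proof.
have k0 := kernel_const_gt0; have ep := mulr_gt0 e0 p0; have ce := mulr_gt0 c0 e0.
have cek := mulr_gt0 ce k0; have pp := p0; rewrite /bilip_const.
move: (dist_const alpha * E 4 * kernel_const) (E 4 * proj_const alpha tau)
  (dist_const alpha * E 4) (proj_const alpha tau) ep ce cek pp => x y p q *; split; lra.
Qed.

Lemma converges_to_exists z : barZ z ->
  exists u : nat -> X, converges_to u z.
Proof.
move=> cz; have [v hv] := line_through alpha_gt1 tau_gt3 S_max cz.
have [c [_ _ cE]] := anchored_line alpha_gt1 tau_gt3 S_max cz hv.
by exists (fun n => c n%:R); exact: (line_above alpha_gt1 tau_gt3 S_max cz hv cE).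
Qed.

Lemma metric_boundary_class (u : nat -> X) : quasi_cauchy u -> metric_boundary dr (quasi_class u).
Proof. by move=> cu; apply/(partial_rhoP alpha_gt1 tau_gt3 S_max); exists u. Qed.

Lemma phi_class (u : nat -> X) : quasi_cauchy u -> phi (quasi_class u) = quasi_class u.
Proof. by move=> /metric_boundary_class; exact: canonical_mapE. Qed.

Lemma phi_psi (u : nat -> X) z : barZ z -> converges_to u z ->
  phi (psi z) = quasi_class u.
Proof.
move=> cz uz; rewrite (anchored_classE alpha_gt1 tau_gt3 S_max cz uz).
by apply: phi_class; exact: converges_to_cauchy uz.
Qed.

Lemma phi_psi_dist z z' : barZ z -> barZ z' ->
  dR (phi (psi z)) (phi (psi z')) <= dist_const alpha * E 4 * dZ z z' /\
  dZ z z' <= proj_const alpha tau * dR (phi (psi z)) (phi (psi z')).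
Proof.
move=> cz cz'; have [u uz] := converges_to_exists cz; have [u' uz'] := converges_to_exists cz'.
by rewrite (phi_psi cz uz) (phi_psi cz' uz'); exact: boundary_dist.
Qed.

Lemma phi_psi_bij : set_bij barZ (metric_boundary dr) (phi \o psi).
Proof.
split=> [z cz|z z' /set_mem cz /set_mem cz' h|xi].
- have [u uz] := converges_to_exists cz; rewrite /= (phi_psi cz uz).
  by apply: metric_boundary_class; exact: converges_to_cauchy uz.
- have [+ h0 _ _] := completion_metric mM; move=> /(_ z z' cz cz') dz0.
  (* Injectivity comes from the lower biLipschitz bound. *)
  apply/(h0 z z' cz cz'); apply/eqP; rewrite eq_le dz0 andbT.
  have [_] := phi_psi_dist cz cz'; rewrite -[phi (psi z)]/((phi \o psi) z) h.
  have [u uz] := converges_to_exists cz'; rewrite /= (phi_psi cz' uz).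
  have [_ + _ _] := completion_metric drM; move=> /(_ (quasi_class u) (quasi_class u)).
  have cu := quasi_class_completion (converges_to_cauchy alpha_gt1 cz' uz).
  by move=> /(_ cu cu)[_ ->] //; rewrite mulr0.
move=> /(partial_rhoP alpha_gt1 tau_gt3 S_max)[u cu ->].
have [z cz uz] := cauchy_converges_to alpha_gt1 cu.
by exists z => //; exact: phi_psi.
Qed.

Lemma phi_psi_biLipschitz : biLipschitz_on dZ dR barZ bilip_const
  (phi \o psi).
Proof.
move=> z z' cz cz' /=; have [h1 h2] := phi_psi_dist cz cz'.
have [l1 l2 _ l4 _] := bilip_const_ge; have L0 : 0 < bilip_const by exact: lt_le_trans l1.
have [+ _ _ _] := completion_metric mM; move=> /(_ z z' cz cz') D0.
have T0 : 0 <= dR (phi (psi z)) (phi (psi z')).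
  by rewrite -(pmulr_rge0 _ p0); exact: le_trans h2.
split; last by apply: le_trans h1 _; exact: ler_wpM2r.
by rewrite ler_pdivrMl //; apply: le_trans h2 _; exact: ler_wpM2r.
Qed.

Lemma filling_visual (omega : nat -> X) (b : X -> R) : quasi_unbounded omega ->
  (forall x, height x <= b x <= height x + busemann_const) ->
  visual_metric d (gromov_class d omega) b (ln alpha) bilip_const
    (fun xi zeta => dR (phi xi) (phi zeta)).
Proof.
move=> ou bb; pose P := partial_omegaP alpha_gt1 tau_gt3 S_max.
have PE xi : (gromov_boundary d `\ gromov_class d omega) xi ->
    completion dr xi /\ phi xi = xi.
  move=> /(P _ _ ou)[u cu ->]; split; last exact: phi_class.
  by have [] := metric_boundary_class cu.
split.
  have [h1 h2 h3 h4] := completion_metric drM.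
  split=> [xi zeta /PE[cx ->] /PE[cy ->]|xi zeta /PE[cx ->] /PE[cy ->]|
    xi zeta /PE[cx ->] /PE[cy ->]|xi zeta eta /PE[cx ->] /PE[cy ->] /PE[cw ->]];
    [exact: h1|exact: h2|exact: h3|exact: h4].
move=> _ _ /(P _ _ ou)[u cu ->] /(P _ _ ou)[u' cu' ->]; rewrite !phi_class //.
have [z cz uz] := cauchy_converges_to alpha_gt1 cu.
have [z' cz' uz'] := cauchy_converges_to alpha_gt1 cu'.
have [h1 h2] := boundary_dist cz cz' uz uz'.
have [k1 k2] := visual_kernel_bounds bb cz cz' uz uz'.
have [l1 _ l3 _ l5] := bilip_const_ge; have L0 : 0 < bilip_const by exact: lt_le_trans l1.
move: h1 h2 k1 k2; set D := dZ z z'; set T := dR _ _; set K := visual_kernel _ _ _ _ _.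
move=> h1 h2 k1 k2.
have K0 : (0 <= K)%E by exact: expeR_ge0.
have T0 : 0 <= T.
  have [+ _ _ _] := completion_metric drM.
  by apply; exact: quasi_class_completion.
split.
  rewrite lee_pdivrMl //; apply: le_trans k1 _; rewrite -EFinM lee_fin.
  apply: le_trans (ler_wpM2l (ltW e0) h2) _; rewrite mulrA; exact: ler_wpM2r.
apply: (@le_trans _ _ ((dist_const alpha * E 4)%:E * (kernel_const)%:E * K)%E).
  rewrite -muleA; apply: le_trans (lee_wpmul2l _ k2).
    by rewrite -EFinM lee_fin.
  by rewrite lee_fin mulr_ge0 // ltW.
by rewrite -EFinM; apply: lee_wpmul2r => //; rewrite lee_fin.
Qed.

(** [rho] is Lipschitz for d_rho and unbounded along the descending ray. *)
Lemma filling_unbounded (u : nat -> X) : (forall n, rho (u n) = E n%:R) -> unbounded dr.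
Proof.
move=> rE K; have l0 := density_const_gt0 alpha_gt1.
have [N NP] := exp_growth alpha_gt1 (density_const alpha * K + 2).
exists (u N), (u 0%N); rewrite -(ltr_pM2l l0).
apply: lt_le_trans (rho_variation alpha_gt1 tau_gt3 S_max _ _).
apply: lt_le_trans (ler_norm _); rewrite !rE powRr0; have := NP _ (leqnn N); lra.
Qed.

End Visual.

Theorem theorem1p12 (R : realType) (alpha tau : R) (alpha_gt1 : 1 < alpha)
    (tau_gt : Num.max 3 (alpha / (alpha - 1)) < tau) :
  exists M A L : R, [/\ 1 <= M, 1 <= A, 1 <= L &
  forall (Z : metricType R) (S : int -> set Z),
    (forall n, maximal_separated (alpha ^ (- n)) (S n)) ->
  forall (gamma : R -> filling alpha tau S) (v : nat -> Z * int)
      (z : set (nat -> Z)),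
    completion mdist z -> descending_ray gamma v -> anchored alpha tau v z ->
    (v 0%N).2 = 0 ->
  let X := filling alpha tau S in
  let d : X -> X -> R := @path_dist R Z alpha tau S in
  let omega := ray_class gamma in
  let b := busemann d gamma in
  let rho : X -> R := @filling_density R Z alpha tau S in
  let d_rho := rho_dist d rho in
  let phi := canonical_map d_rho in
  let psi : set (nat -> Z) -> set (nat -> X) :=
    @anchored_class R Z alpha tau S in
  let partial_omega := gromov_boundary d `\ omega in
  let partial_rho := metric_boundary d_rho in
  [/\ roughly_starlike d (1 / 2) omega,
      GH_density d rho M,
      [/\ forall I c, geodesic d I c -> uniform_curve d_rho A I c,
          uniform_space d_rho A &
          unbounded d_rho],
      [/\ forall xi, partial_omega xi ->
            forall u, xi u -> converges_in_completion d_rho u (phi xi),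
          set_bij partial_omega partial_rho phi &
          visual_metric d omega b (ln alpha) L
            (fun xi zeta => completion_dist d_rho (phi xi) (phi zeta))] &
      set_bij (completion mdist) partial_rho (phi \o psi) /\
      biLipschitz_on (completion_dist mdist) (completion_dist d_rho)
        (completion mdist) L (phi \o psi)]].
Proof.
have tau_gt3 : 3 < tau by move: tau_gt; rewrite gt_max => /andP[].
have [l1 _ _ _ _] := bilip_const_ge alpha_gt1 tau_gt3.
exists (Num.max 1 (alpha * geod_const alpha tau)), (uniform_const alpha tau),
  (bilip_const alpha tau); split => //; first by rewrite le_max lexx.
  exact: uniform_const_ge1.
move=> Z S S_max gamma v z cz gr ga v0 X d omega b rho d_rho phi psi po pr.
have ou : quasi_unbounded (fun n => gamma n%:R) by exact: ray_unbounded gr v0.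
have bb x := busemann_bounds alpha_gt1 tau_gt3 S_max cz gr ga v0 x.
have dM := filling_rho_metric alpha_gt1 tau_gt3 S_max.
(* The anchor z of the reference ray provides a boundary point. *)
have bn : metric_boundary d_rho !=set0.
  have [u uz] := converges_to_exists alpha_gt1 tau_gt3 S_max cz.
  exists (quasi_class u); apply: metric_boundary_class => //.
  exact: converges_to_cauchy uz.
have porE : po = pr.
  apply/seteqP; split=> xi.
    move=> /(partial_omegaP alpha_gt1 tau_gt3 S_max _ ou) h.
    exact/(partial_rhoP alpha_gt1 tau_gt3 S_max).
  move=> /(partial_rhoP alpha_gt1 tau_gt3 S_max) h.
  exact/(partial_omegaP alpha_gt1 tau_gt3 S_max _ ou).
have phiE xi : pr xi -> phi xi = xi by exact: canonical_mapE.
split.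
- exact: filling_starlike.
- move=> s t c st cg; apply: le_trans (filling_GH_density alpha_gt1 tau_gt3 S_max st cg) _.
  rewrite lee_fin ler_wpM2r ?(dist_ge0 dM) //.
  by rewrite le_max lexx orbT.
- split=> [I c|//|].
  + exact: geodesic_uniform.
  + exact: filling_uniform_space.
  + apply: (filling_unbounded alpha_gt1 tau_gt3 S_max (u := fun n => gamma n%:R)) => n.
    exact: ray_rho gr v0 n.
- split=> [xi||].
  + rewrite porE => pxi u xiu; rewrite phiE //.
    by apply: converges_in_completion_mem => //; have [] := pxi.
  + rewrite porE; split=> [xi pxi|xi eta /set_mem h1 /set_mem h2|xi pxi].
    * by rewrite phiE.
    * by rewrite !phiE.
    * by exists xi => //; exact: phiE.
  + exact: filling_visual.
- by split; [exact: phi_psi_bij|exact: phi_psi_biLipschitz].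
Qed.
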